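(* Let $\psi:\mathbb{R}\to\mathbb{C}$ be a $2\pi$-periodic function satisfying the Lipschitz condition on $[-\pi,\pi]$: there is a constant $C>0$ such that $|\psi(u)-\psi(v)|\le C|u-v|$ for all $u,v\in[-\pi,\pi]$. Let $f$ be the function represented by $$f(x)=-32\int_{-\pi}^{\pi}\psi(u)\sinh(u)\,\mathrm{Im}\left[K_0\left(4e^{\pi i/4}\cosh^{1/2}(u)\sqrt{x}\right)\right]du,\qquad x>0 ,$$ and let $$a_n=\frac{1}{\cosh(\pi n/2)}\int_0^\infty \mathrm{Re}\left[J_{in}\left(2\sqrt{2x}\right)\right]K_{in}\left(2\sqrt{2x}\right)f(x)\,dx,\qquad n\in\mathbb{N}_0 .$$ For $x>0$ and $n\in\mathbb{N}_0$ let $$\Psi_n(x)=\int_0^\pi \mathrm{Im}\left[K_0\left(4e^{\pi i/4}\cosh^{1/2}(u)\sqrt{x}\right)\right]\sinh(u)\sin(nu)\,du .$$ Then for all $x>0$ $$f(x)=-\frac{32}{\pi^2}\sum_{n=1}^\infty \sinh(\pi n)\,\Psi_n(x)\,a_n ,$$ the series being understood as the limit of its partial sums.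
   Context: $\mathbb{N}_0=\{0,1,2,\dots\}$ and $i$ is the imaginary unit. $J_\nu(z)$ is the Bessel function of the first kind, $J_\nu(z)=\sum_{k=0}^\infty\frac{(-1)^k (z/2)^{\nu+2k}}{k!\,\Gamma(\nu+k+1)}$ for $z>0$, used with purely imaginary order. $K_\nu(z)$ is the modified Bessel function of the second kind (principal branch), $K_\nu(z)=\int_0^\infty e^{-z\cosh t}\cosh(\nu t)\,dt$ for $\mathrm{Re}\,z>0$. *)

(* Defs.v *)
From HB Require Import structures.
From mathcomp Require Import all_boot all_order all_algebra.
From mathcomp Require Import complex.
From mathcomp Require Import all_classical all_reals all_analysis.
Set Implicit Arguments.
Unset Strict Implicit.
Unset Printing Implicit Defensive.
Import Order.TTheory GRing.Theory Num.Theory.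
Import numFieldNormedType.Exports.
Local Open Scope classical_set_scope.
Local Open Scope ring_scope.
Local Open Scope complex_scope.

Definition cosh (R : realType) (u : R) : R := (expR u + expR (- u)) / 2.

Definition sinh (R : realType) (u : R) : R := (expR u - expR (- u)) / 2.

Definition cexp (R : realType) (z : R[i]) : R[i] :=
  (expR (complex.Re z))%:C * (cos (complex.Im z) +i* sin (complex.Im z)).

Definition ccosh (R : realType) (z : R[i]) : R[i] :=
  (cexp z + cexp (- z)) / 2.

(* Only meaningful for 0 < t, where it is the principal power. *)
Definition cpow (R : realType) (t : R) (w : R[i]) : R[i] :=
  cexp (w * (ln t)%:C).

(* Lebesgue integral over D of a complex-valued function of a real variable. *)
Definition cintegral (R : realType) (D : set R) (g : R -> R[i]) : R[i] :=
  (\int[lebesgue_measure]_(t in D) complex.Re (g t))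
  +i* (\int[lebesgue_measure]_(t in D) complex.Im (g t)).

(* Euler's integral: this is the Gamma function on the half-plane 0 < Re s
   only, not its meromorphic continuation. *)
Definition cgamma (R : realType) (s : R[i]) : R[i] :=
  cintegral `]0, +oo[ (fun t : R => cpow t (s - 1) * (expR (- t))%:C).

(* Meant for 0 < z and -1 < Re nu, so that every Gamma factor is evaluated in
   the half-plane where cgamma is the Gamma function.  The alias R[i]^o carries
   the topology of the modulus. *)
Definition besselJ (R : realType) (nu : R[i]) (z : R) : R[i] :=
  limn (series (fun k : nat =>
    (- 1) ^+ k * cpow (z / 2) (nu + (2 * k)%:R)
      / (k`!%:R * cgamma (nu + k%:R + 1)) : R[i]^o)).

(* Meant for 0 < Re z, where the integral converges absolutely. *)
Definition besselK (R : realType) (nu z : R[i]) : R[i] :=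
  cintegral `[0, +oo[
    (fun t : R => cexp (- z * (cosh t)%:C) * ccosh (nu * t%:C)).

(* Main.v *)
Require Import Defs.
From HB Require Import structures.
From mathcomp Require Import all_boot all_order all_algebra.
From mathcomp Require Import complex.
From mathcomp Require Import all_classical all_reals all_analysis.
From mathcomp Require Import measurable_realfun.
From mathcomp Require Import ring lra.
Set Implicit Arguments.
Unset Strict Implicit.
Unset Printing Implicit Defensive.
Import Order.TTheory GRing.Theory Num.Theory.
Import numFieldNormedType.Exports.
Local Open Scope classical_set_scope.
Local Open Scope ring_scope.

(* Put G(u, x) = Im K_0(4 e^(i pi/4) cosh(u)^(1/2) x^(1/2)). The key is the index integral, for n >= 1,
     sinh(u) * int_0^oo Re J_(in)(2 sqrt(2x)) K_(in)(2 sqrt(2x)) G(u, x) dx = - (pi/32) sin(nu) / sinh(pi n/2).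
   By Fubini it makes a_n sinh(pi n) equal to 2 pi times the n-th sine integral of psi, and the theorem becomes
   the Fourier expansion of psi integrated against sinh(u) G(u, x), which is odd in u and kills the cosines;
   since psi is Lipschitz, its Fourier sums converge boundedly.

   For the index integral, put x = e^xi / 2. Summing the power series of J term by term gives the Laplace
   transform of Re(J_(in)) K_(in) in x, and averaging it over the parameter gives its integral against
   K_0(2 la sqrt(2x)) for real la > 0, namely a multiple of int_0^oo cos(nv) / (la^2/2 + sinh v) dv.
   Both sides are Laplace transforms in la, so that comparing Taylor coefficients twice continues the
   identity to the ray arg la = pi/4; the right-hand side becomes int_0^oo cos(nv) c / (c^2 + sinh(v)^2) dv
   with c = cosh u. As 2 sinh(u) c / (c^2 + sinh(v)^2) = tanh(v + u) - tanh(v - u), it remains to integrate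
   cos(nv) against the square of the hyperbolic secant, which the Fourier series of cosh(n x/2) at x = 0
   evaluates to pi n / sinh(pi n/2). *)

(** * Real-valued Lebesgue integrals *)

(** Why the logarithmic variable: with [z = 2 e^(xi/2)] and the variable of K translated to [th],
    the phase [(z/2)^(i tau)] of J merges into [e^(i tau th)]. In the coordinates [th] and
    [t = xi - th] everything then factors: K gives [e^(-e^th) e^(-e^t)], the k-th term of J gives
    [e^(k th) e^(k t)]. Together with the Laplace factor [e^(-p e^t e^th)], each integral over [th]
    is an Euler integral whose Gamma value cancels the one in the denominator of J, and the sum over
    k is an exponential series.

    Two obstacles shape the estimates. Taken in absolute value, the series of J grows like [e^z],
    exactly the rate at which K decays, so this rate must be kept sharp; and the series needs a
    lower bound for [|Gamma(k + 1 + i tau)|], hence its non-vanishing, which is obtained from real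
    integrals. The ray [arg = pi/4] lies on the boundary of what one vertical Taylor expansion about
    a real point reaches under the majorants used here, whence the two expansions. *)

Section Rintegral_tools.
Context d (T : measurableType d) (R : realType) (m : {measure set T -> \bar R}).
Implicit Types (D : set T) (f g h : T -> R).

Lemma L1_le D f g : measurable D -> measurable_fun D f ->
  m.-integrable D (EFin \o g) -> (forall x, D x -> `|f x| <= g x) ->
  m.-integrable D (EFin \o f).
Proof.
move=> mD mf ig fg; apply: le_integrable ig => //; first exact/measurable_EFinP.
by move=> x Dx /=; rewrite lee_fin (le_trans (fg x Dx))// ler_norm.
Qed.

Lemma L1_measurable D f : m.-integrable D (EFin \o f) -> measurable_fun D f.
Proof. by move=> /measurable_int/measurable_EFinP. Qed.

Lemma L1_norm D f : measurable D -> m.-integrable D (EFin \o f) ->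
  m.-integrable D (EFin \o (fun x => `|f x|)).
Proof.
move=> mD intf; have mf := L1_measurable intf.
apply: (le_integrable mD _ _ intf); last by move=> x Dx /=; rewrite normr_id.
by apply/measurable_EFinP/measurableT_comp.
Qed.

Lemma L1D D f g : measurable D -> m.-integrable D (EFin \o f) ->
  m.-integrable D (EFin \o g) -> m.-integrable D (EFin \o (fun x => f x + g x)).
Proof.
by move=> mD intf intg; have := integrableD mD intf intg.
Qed.

Lemma L1B D f g : measurable D -> m.-integrable D (EFin \o f) ->
  m.-integrable D (EFin \o g) -> m.-integrable D (EFin \o (fun x => f x - g x)).
Proof.
by move=> mD intf intg; have := integrableB mD intf intg.
Qed.

Lemma L1Zl D (c : R) f : measurable D -> m.-integrable D (EFin \o f) ->
  m.-integrable D (EFin \o (fun x => c * f x)).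
Proof.
by move=> mD intf; have := integrableZl mD c intf.
Qed.

Lemma Rintegral_eq D f g : (forall x, D x -> f x = g x) ->
  \int[m]_(x in D) f x = \int[m]_(x in D) g x.
Proof. by move=> fg; apply: eq_Rintegral => x; rewrite inE => /fg. Qed.

Lemma Rintegral_le_bound D f g : measurable D -> measurable_fun D f ->
  m.-integrable D (EFin \o g) -> (forall x, D x -> `|f x| <= g x) ->
  `|\int[m]_(x in D) f x| <= \int[m]_(x in D) g x.
Proof.
move=> mD mf ig fg; have intf := L1_le mD mf ig fg.
apply: (le_trans (le_normr_Rintegral mD intf)).
by apply: le_Rintegral => //; exact: L1_norm.
Qed.

Lemma integral_Rintegral D f : m.-integrable D (EFin \o f) -> measurable D ->
  (\int[m]_(x in D) (f x)%:E = (\int[m]_(x in D) f x)%:E)%E.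
Proof.
move=> intf mD; rewrite /Rintegral fineK//; exact: integrable_fin_num.
Qed.

(** An integrable [G] is finite almost everywhere, so [fine] alters it on a null set only. Fubini's
    theorem calls for this: inner integrals are finite only almost everywhere. *)
Lemma L1_fine D (G : T -> \bar R) : measurable D -> m.-integrable D G ->
  m.-integrable D (EFin \o (fine \o G)) /\
  \int[m]_(x in D) fine (G x) = fine (\int[m]_(x in D) G x)%E.
Proof.
move=> mD intG; have mG := measurable_int _ intG.
have mfG : measurable_fun D (EFin \o (fine \o G)).
  by apply/measurable_EFinP/measurableT_comp.
split.
  apply: (le_integrable mD mfG _ intG) => x Dx /=.
  by case: (G x) => [r| |] //=; rewrite ?leey// normr0.
rewrite /Rintegral; congr fine; apply: ae_eq_integral => //.
by apply: filterS (integrable_ae mD intG) => x /= + Dx => /(_ Dx) /fineK.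
Qed.

Lemma L1_patch D f : measurable D ->
  m.-integrable D (EFin \o f) <-> m.-integrable setT (EFin \o (f \_ D)).
Proof. by move=> mD; rewrite -restrict_EFin; exact: integrable_mkcond. Qed.

Lemma Rdominated_cvg D (f_ : nat -> T -> R) f g : measurable D ->
  (forall n, measurable_fun D (f_ n)) ->
  (forall x, D x -> f_ ^~ x @ \oo --> f x) ->
  m.-integrable D (EFin \o g) ->
  (forall n x, D x -> `|f_ n x| <= g x) ->
  m.-integrable D (EFin \o f) /\
  (fun n => \int[m]_(x in D) f_ n x) @ \oo --> \int[m]_(x in D) f x.
Proof.
move=> mD mf_ ff intg fg.
have mf : measurable_fun D f by apply: (measurable_fun_cvg mf_) => x Dx; exact: ff.
have [|||||intf _ cf] := @dominated_convergence _ _ R m D mD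
    (fun n => EFin \o f_ n) (EFin \o f) (EFin \o g).
- by move=> n; exact/measurable_EFinP.
- exact/measurable_EFinP.
- by apply: aeW => x Dx; apply: cvg_EFin; [exact: nearW|exact: ff].
- exact: intg.
- by apply: aeW => x n Dx; rewrite lee_fin; exact: fg.
split => //; apply: fine_cvg; rewrite integral_Rintegral// in cf; exact: cf.
Qed.

End Rintegral_tools.

(** * Fubini's theorem on product sets for real-valued integrals *)

Section Fubini.
Context d1 d2 (T1 : measurableType d1) (T2 : measurableType d2) (R : realType).
Variables (m1 : {sigma_finite_measure set T1 -> \bar R})
          (m2 : {sigma_finite_measure set T2 -> \bar R}).

(** Fubini's theorem is applied on the full product space to extensions by zero; their sections are
    again extensions by zero, or vanish identically. *)
Let patch_section1 (D1 : set T1) (D2 : set T2) (f : T1 -> T2 -> R) x :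
  (fun y => ((fun z => (f z.1 z.2)%:E) \_ (D1 `*` D2)) (x, y)) =
  if x \in D1 then (EFin \o f x) \_ D2 else cst 0%E.
Proof.
apply/funext => y; rewrite patchE in_setX/=; case: ifPn => [/andP[-> yD2]|].
  by rewrite patchE yD2.
by case: ifPn => //= xD1; rewrite patchE => /negbTE ->.
Qed.

Let patch_section2 (D1 : set T1) (D2 : set T2) (f : T1 -> T2 -> R) y :
  (fun x => ((fun z => (f z.1 z.2)%:E) \_ (D1 `*` D2)) (x, y)) =
  if y \in D2 then (EFin \o (f ^~ y)) \_ D1 else cst 0%E.
Proof.
apply/funext => x; rewrite patchE in_setX/=; case: ifPn => [/andP[xD1 yD2]|].
  by rewrite yD2 patchE xD1.
by case: ifPn => //= xD1; rewrite patchE andbC/= => /negbTE ->.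
Qed.

(** Tonelli. The bound [g] is put on the extended-valued inner integral of the absolute value, which
    makes sense before any integrability is known. *)
Lemma L1_prod (D1 : set T1) (D2 : set T2) (f : T1 -> T2 -> R) (g : T1 -> R) :
  measurable D1 -> measurable D2 ->
  measurable_fun (D1 `*` D2) (fun z => f z.1 z.2) ->
  m1.-integrable D1 (EFin \o g) ->
  (forall x, D1 x -> (\int[m2]_(y in D2) `|f x y|%:E <= (g x)%:E)%E) ->
  (m1 \x m2)%E.-integrable (D1 `*` D2) (EFin \o (fun z => f z.1 z.2)).
Proof.
move=> mD1 mD2 mf intg fg.
pose F : T1 * T2 -> \bar R := (fun z => (f z.1 z.2)%:E) \_ (D1 `*` D2).
have mD12 : measurable (D1 `*` D2) by exact: measurableX.
have mF : measurable_fun setT F by apply/(measurable_restrictT _ mD12)/measurable_EFinP.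
apply: (proj2 (integrable_mkcond _ mD12)).
apply/integrable12ltyP => //.
have [_ igoo] := integrableP _ _ _ intg.
apply: le_lt_trans igoo.
rewrite [leRHS]integral_mkcond; apply: ge0_le_integral => //.
- by move=> x _; exact: integral_ge0.
- apply: (measurable_fun_fubini_tonelli_F (abse \o F)) => //=.
  exact: measurableT_comp.
- apply/(measurable_restrictT _ mD1)/measurableT_comp => //.
  exact: measurable_int intg.
- move=> x _; rewrite patchE; have FE1 := patch_section1 D1 D2 f x; case: ifPn => xD1.
    apply: le_trans (lee_abs _); apply: le_trans (fg x _); last by rewrite inE in xD1.
    rewrite [leRHS]integral_mkcond le_eqVlt; apply/orP; left; apply/eqP.
    apply: eq_integral => y _; move: FE1; rewrite xD1 => /(congr1 (@^~ y)) ->.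
    by rewrite !patchE; case: ifPn => // _; rewrite abse0.
  rewrite integral0_eq// => y _.
  by move: FE1; rewrite (negbTE xD1) => /(congr1 (@^~ y)) ->; rewrite abse0.
Qed.

Lemma Rintegral_prod (D1 : set T1) (D2 : set T2) (f : T1 -> T2 -> R) :
  measurable D1 -> measurable D2 ->
  (m1 \x m2)%E.-integrable (D1 `*` D2) (EFin \o (fun z => f z.1 z.2)) ->
  [/\ m1.-integrable D1 (EFin \o (fun x => \int[m2]_(y in D2) f x y)),
      m2.-integrable D2 (EFin \o (fun y => \int[m1]_(x in D1) f x y)),
      \int[(m1 \x m2)%E]_(z in D1 `*` D2) f z.1 z.2 = \int[m1]_(x in D1) \int[m2]_(y in D2) f x y &
      \int[(m1 \x m2)%E]_(z in D1 `*` D2) f z.1 z.2 = \int[m2]_(y in D2) \int[m1]_(x in D1) f x y].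
Proof.
move=> mD1 mD2 intf.
pose F : T1 * T2 -> \bar R := (fun z => (f z.1 z.2)%:E) \_ (D1 `*` D2).
have mD12 : measurable (D1 `*` D2) by exact: measurableX.
have intF : (m1 \x m2)%E.-integrable setT F by exact: (proj1 (integrable_mkcond _ mD12) intf).
have mF := measurable_int _ intF.
have F1 : fubini_F m2 F = (fun x => \int[m2]_(y in D2) (f x y)%:E)%E \_ D1.
  apply/funext => x; rewrite /fubini_F; transitivity (\int[m2]_y (fun y => F (x, y)) y)%E => //.
  rewrite patch_section1 patchE; case: ifPn => // _; first by rewrite [RHS]integral_mkcond.
  by rewrite integral0.
have F2 : fubini_G m1 F = (fun y => \int[m1]_(x in D1) (f x y)%:E)%E \_ D2.
  apply/funext => y; rewrite /fubini_G; transitivity (\int[m1]_x (fun x => F (x, y)) x)%E => //.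
  rewrite patch_section2 patchE; case: ifPn => // _; first by rewrite [RHS]integral_mkcond.
  by rewrite integral0.
have iF : m1.-integrable D1 (fun x => \int[m2]_(y in D2) (f x y)%:E)%E.
  by apply/integrable_mkcond => //; rewrite -F1; exact: integrable_fubini_F.
have iG : m2.-integrable D2 (fun y => \int[m1]_(x in D1) (f x y)%:E)%E.
  apply/integrable_mkcond => //; rewrite -F2.
  have mFs : measurable_fun setT (fun z : T2 * T1 => F (z.2, z.1)).
    by apply: measurableT_comp mF _; exact: measurable_fun_pair.
  apply: (@integrable_fubini_F _ _ _ _ _ m2 m1 (fun z => F (z.2, z.1))).
  apply/integrable12ltyP => //=.
  by apply/integrable21ltyP.
have [iF' eF] := L1_fine mD1 iF.
have [iG' eG] := L1_fine mD2 iG.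
split => //; rewrite /= in eF eG; rewrite ?eF ?eG /Rintegral; congr fine.
- by rewrite integral_mkcond [RHS]integral_mkcond -F1 integral12_prod_meas1.
- by rewrite integral_mkcond [RHS]integral_mkcond -F2 integral21_prod_meas1.
Qed.

Lemma RFubini (D1 : set T1) (D2 : set T2) (f : T1 -> T2 -> R) (g : T1 -> R) :
  measurable D1 -> measurable D2 ->
  measurable_fun (D1 `*` D2) (fun z => f z.1 z.2) ->
  m1.-integrable D1 (EFin \o g) ->
  (forall x, D1 x -> (\int[m2]_(y in D2) `|f x y|%:E <= (g x)%:E)%E) ->
  [/\ m1.-integrable D1 (EFin \o (fun x => \int[m2]_(y in D2) f x y)),
      m2.-integrable D2 (EFin \o (fun y => \int[m1]_(x in D1) f x y)) &
      \int[m1]_(x in D1) \int[m2]_(y in D2) f x y =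
      \int[m2]_(y in D2) \int[m1]_(x in D1) f x y].
Proof.
move=> mD1 mD2 mf intg fg.
have [i1 i2 e1 e2] := Rintegral_prod mD1 mD2 (L1_prod mD1 mD2 mf intg fg).
by split => //; rewrite -e1.
Qed.

Let abs_integral_le (D2 : set T2) (f h : T2 -> R) (c : R) : measurable D2 -> measurable_fun D2 f ->
  m2.-integrable D2 (EFin \o h) -> (forall y, D2 y -> `|f y| <= h y) -> \int[m2]_(y in D2) h y <= c ->
  (\int[m2]_(y in D2) `|f y|%:E <= c%:E)%E.
Proof.
move=> mD2 mf ih fh hc.
apply: (@le_trans _ _ (\int[m2]_(y in D2) h y)%:E); last by rewrite lee_fin.
rewrite -integral_Rintegral//; apply: ge0_le_integral => //.
- by apply/measurable_EFinP/measurableT_comp.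
- exact: measurable_int ih.
Qed.

Lemma L1_prod_dom (D1 : set T1) (D2 : set T2) (f h : T1 -> T2 -> R) (g : T1 -> R) :
  measurable D1 -> measurable D2 ->
  measurable_fun (D1 `*` D2) (fun z => f z.1 z.2) ->
  (forall x, D1 x -> measurable_fun D2 (f x)) ->
  (forall x, D1 x -> m2.-integrable D2 (EFin \o h x)) ->
  (forall x y, D1 x -> D2 y -> `|f x y| <= h x y) ->
  (forall x, D1 x -> \int[m2]_(y in D2) h x y <= g x) ->
  m1.-integrable D1 (EFin \o g) ->
  (m1 \x m2)%E.-integrable (D1 `*` D2) (EFin \o (fun z => f z.1 z.2)).
Proof.
move=> mD1 mD2 mf mfx ih fh hg ig; apply: (L1_prod mD1 mD2 mf ig) => x Dx.
exact: abs_integral_le (mfx x Dx) (ih x Dx) (fun y => fh x y Dx) (hg x Dx).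
Qed.

Lemma RFubini_dom (D1 : set T1) (D2 : set T2) (f h : T1 -> T2 -> R) (g : T1 -> R) :
  measurable D1 -> measurable D2 ->
  measurable_fun (D1 `*` D2) (fun z => f z.1 z.2) ->
  (forall x, D1 x -> measurable_fun D2 (f x)) ->
  (forall x, D1 x -> m2.-integrable D2 (EFin \o h x)) ->
  (forall x y, D1 x -> D2 y -> `|f x y| <= h x y) ->
  (forall x, D1 x -> \int[m2]_(y in D2) h x y <= g x) ->
  m1.-integrable D1 (EFin \o g) ->
  [/\ m1.-integrable D1 (EFin \o (fun x => \int[m2]_(y in D2) f x y)),
      m2.-integrable D2 (EFin \o (fun y => \int[m1]_(x in D1) f x y)) &
      \int[m1]_(x in D1) \int[m2]_(y in D2) f x y =
      \int[m2]_(y in D2) \int[m1]_(x in D1) f x y].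
Proof.
move=> mD1 mD2 mf mfx ih fh hg ig; apply: (RFubini mD1 mD2 mf ig) => x Dx.
exact: abs_integral_le (mfx x Dx) (ih x Dx) (fun y => fh x y Dx) (hg x Dx).
Qed.

End Fubini.

Lemma Rintegral_sum d (T : measurableType d) (R : realType) (m : {measure set T -> \bar R})
    (D : set T) (f : nat -> T -> R) (N : nat) : measurable D ->
  (forall k, m.-integrable D (EFin \o f k)) ->
  m.-integrable D (EFin \o (fun x => \sum_(0 <= k < N) f k x)) /\
  \int[m]_(x in D) \sum_(0 <= k < N) f k x = \sum_(0 <= k < N) \int[m]_(x in D) f k x.
Proof.
move=> mD intf; elim: N => [|N [i1 e1]].
  split; last first.
    rewrite big_geq// (@Rintegral_eq _ _ _ _ D _ (cst 0)); last by move=> x _; rewrite big_geq.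
    by rewrite Rintegral_cst// mul0r.
  have -> : EFin \o (fun x => \sum_(0 <= k < 0) f k x) = cst 0%E.
    by apply/funext => x /=; rewrite big_geq.
  exact: integrable0.
have E : (fun x => \sum_(0 <= k < N.+1) f k x) = (fun x => \sum_(0 <= k < N) f k x + f N x).
  by apply/funext => x; rewrite big_nat_recr.
by rewrite E; split; [exact: L1D|rewrite RintegralD// e1 big_nat_recr].
Qed.

(** * Translation, reflection and the substitution [x = e^t] for measurable functions *)

Section change_of_variables.
Context (R : realType).
Local Notation mu := (@lebesgue_measure R).

(** A substitution has to be checked on nonnegative functions only: the Jacobian [w] is nonnegative,
    so multiplying by it commutes with taking positive and negative parts. The equality of values
    therefore holds whether or not [f] is integrable. *)
Lemma integral_transfer (D E : set R) (phi w : R -> R) (f : R -> R) :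
  measurable D -> measurable E ->
  measurable_fun E phi -> measurable_fun E w -> (forall t, 0 <= w t) ->
  (forall h : R -> R, measurable_fun setT h -> (forall x, 0 <= h x) ->
    (\int[mu]_(x in D) (h x)%:E = \int[mu]_(t in E) (h (phi t) * w t)%:E)%E) ->
  measurable_fun setT f ->
  (mu.-integrable D (EFin \o f) <->
   mu.-integrable E (EFin \o (fun t => f (phi t) * w t))) /\
  \int[mu]_(x in D) f x = \int[mu]_(t in E) (f (phi t) * w t).
Proof.
move=> mD mE mphi mw w0 H mf.
have mfphi : measurable_fun E (fun t => f (phi t) * w t).
  by apply: measurable_funM => //; apply: measurableT_comp mf mphi.
split.
  have H1 := H (fun x => `|f x|) (measurableT_comp (@normr_measurable _ _) mf)
                (fun=> normr_ge0 _).
  have e : (\int[mu]_(t in E) (`|f (phi t)| * w t)%:E =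
            \int[mu]_(t in E) `|(f (phi t) * w t)%:E|)%E.
    by apply: eq_integral => t _ /=; rewrite normrM (ger0_norm (w0 t)).
  split=> /integrableP[_ h]; apply/integrableP; split => /=.
  - exact/measurable_EFinP.
  - by rewrite -e -H1.
  - exact/measurable_EFinP/measurable_funTS.
  - by rewrite H1 e.
have wpos t (r : R) : Num.max (r * w t) 0 = Num.max r 0 * w t.
  by rewrite maxr_pMl// mul0r.
rewrite /Rintegral; congr fine; rewrite integralE [RHS]integralE; congr (_ - _)%E.
- rewrite (funerpos f) (H _ (measurable_funrpos mf))//.
  by apply: eq_integral => t _; rewrite funeposE/= -EFin_max wpos.
- rewrite (funerneg f) (H _ (measurable_funrneg mf))//.
  by apply: eq_integral => t _; rewrite funenegE/= -EFin_max -mulNr wpos.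
Qed.

(** Translation invariance: the translated measure agrees with Lebesgue measure on half-open
    intervals, which determine it. *)
Lemma Rintegral_shift (c : R) (f : R -> R) : measurable_fun setT f ->
  (mu.-integrable setT (EFin \o f) <->
   mu.-integrable setT (EFin \o (fun t => f (t + c)))) /\
  \int[mu]_x f x = \int[mu]_t f (t + c).
Proof.
move=> mf.
have mphi : measurable_fun setT (fun t : R => t + c) by exact: measurable_funD.
have [|||||||e1 e2] := @integral_transfer setT setT (fun t => t + c) (cst 1) f => //.
- move=> h mh h0.
  have : (\int[pushforward mu ((fun t : R => (t + c)%R) : R -> measurableTypeR R)]_x (h x)%:E =
       \int[mu]_(t in (fun t : R => (t + c)%R) @^-1` setT) (h (t + c)%R)%:E)%E.
    by rewrite ge0_integral_pushforward//; [exact/measurable_EFinP|move=> ? _; rewrite lee_fin].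
  rewrite preimage_setT => e; under [RHS]eq_integral do rewrite mulr1.
  rewrite -e; apply: eq_measure_integral => A mA _.
  apply: lebesgue_measure_unique => // _ [[a b]] _ <-.
  rewrite [RHS]/= /pushforward.
  rewrite (_ : _ @^-1` _ = `]a - c, b - c]%classic); last first.
    by apply/seteqP; split => x/=; rewrite !in_itv/= ltrBlDr lerBrDr.
  by rewrite !lebesgue_measure_itv/= !lte_fin ltrD2r -!EFinB; case: ifP => // _; congr EFin; ring.
- split; last by rewrite e2; apply: eq_Rintegral => t _; rewrite mulr1.
  by rewrite e1; split; apply: eq_integrable => // t _ /=; rewrite mulr1.
Qed.

Lemma Rintegral_opp (f : R -> R) : measurable_fun setT f ->
  (mu.-integrable setT (EFin \o f) <->
   mu.-integrable setT (EFin \o (fun t => f (- t)))) /\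
  \int[mu]_x f x = \int[mu]_t f (- t).
Proof.
move=> mf.
have mphi : measurable_fun setT (fun t : R => - t) by exact: oppr_measurable.
have [|||||||e1 e2] := @integral_transfer setT setT (fun t => - t) (cst 1) f => //.
- move=> h mh h0.
  have : (\int[pushforward mu (-%R : _ -> measurableTypeR R)]_x (h x)%:E =
       \int[mu]_(t in (fun t : R => (- t)%R) @^-1` setT) (h (- t)%R)%:E)%E.
    by rewrite ge0_integral_pushforward//; [exact/measurable_EFinP|move=> ? _; rewrite lee_fin].
  rewrite preimage_setT => e; under [RHS]eq_integral do rewrite mulr1.
  rewrite -e; apply: eq_measure_integral => A mA _.
  by rewrite /= lebesgue_measureN.
- split; last by rewrite e2; apply: eq_Rintegral => t _; rewrite mulr1.
  by rewrite e1; split; apply: eq_integrable => // t _ /=; rewrite mulr1.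
Qed.

Lemma integral_expR_Nybnd (b : R) :
  (\int[mu]_(t in `]-oo, b]) (expR t)%:E = (expR b)%:E)%E.
Proof.
rewrite -[b in LHS]opprK ge0_integration_by_substitutionNy; last 2 first.
- by apply: continuous_subspaceT; exact: continuous_expR.
- by move=> x _; exact: expR_ge0.
rewrite (@ge0_continuous_FTC2y _ _ (fun x => - expR (- x)) _ 0).
- by rewrite opprK sub0e -EFinN opprK.
- by move=> x _; exact: expR_ge0.
- apply: continuous_subspaceT => x; apply: continuous_comp; last exact: continuous_expR.
  exact: opp_continuous.
- by rewrite -oppr0; apply: cvgN; exact: cvgr_expR.
- by move=> x _.
- apply: cvg_at_right_filter; apply: cvgN; apply: continuous_comp.
    exact: opp_continuous.
  exact: continuous_expR.
- move=> x _; rewrite derive1E.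
  have : is_derive x 1 (fun x => - expR (- x)) (expR (- x)).
    by apply: is_derive_eq; ring.
  by move=> h; rewrite derive_val.
Qed.

(** A point [(t, s)] below the graph of the exponential goes to [e^t], any other point to 0. The
    area below the graph over [a < e^t <= b] is [b - a], so on the positive half-line the image of
    planar measure is Lebesgue measure; this gives the substitution [x = e^t] for functions that are
    merely measurable. *)
Let expmap (z : R * R) : R := if (0 < z.2 < expR z.1) then expR z.1 else 0.

Let measurable_expmap : measurable_fun setT expmap.
Proof.
apply: measurable_fun_ifT => //.
- apply: measurable_and.
    by apply: measurable_fun_ltr => //.
  by apply: measurable_fun_ltr => //; exact: measurableT_comp.
- by apply: measurableT_comp => //.
Qed.

(** The condition [0 <= a] keeps the value 0, which carries infinite mass, out of the interval. *)
Let measure_expmap (a b : R) : 0 <= a < b ->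
  (mu \x mu)%E (expmap @^-1` `]a, b]) = (b - a)%:E.
Proof.
move=> /andP[a0 ab]; have b0 : 0 < b by exact: le_lt_trans ab.
pose A := [set t : R | a < expR t <= b].
have mA : measurable A.
  rewrite (_ : A = expR @^-1` `]a, b]); last by apply/seteqP; split => t/=; rewrite in_itv.
  by rewrite -[X in measurable X]setTI; apply: measurable_expR.
have mexp (D : set R) : measurable_fun D (fun t : R => (expR t)%:E).
  by apply/measurable_EFinP; exact: measurable_funTS.
rewrite [LHS]/= /product_measure1.
transitivity (\int[mu]_t (((fun t : R => (expR t)%:E) \_ A) t))%E.
  apply: eq_integral => t _; rewrite patchE /=.
  case: ifPn => [|]; rewrite ?inE ?notin_setE => At.
    rewrite (_ : xsection _ _ = `]0, expR t[%classic).
      by rewrite lebesgue_measure_itv/= lte_fin expR_gt0 sube0.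
    apply/seteqP; split => s; rewrite /xsection/= inE /= /expmap/= !in_itv/=.
      by case: ifPn => // _; rewrite ltNge a0.
    by move=> ->.
  rewrite (_ : xsection _ _ = set0) ?measure0//.
  apply/seteqP; split => s //; rewrite /xsection/= inE /= /expmap/= !in_itv/=.
  by case: ifPn => // _; rewrite ltNge a0.
rewrite -integral_mkcond.
have lnbE t : (expR t <= b) = (t <= ln b) by rewrite -{1}(@lnK _ b)// ler_expR.
have := integral_expR_Nybnd (ln b); rewrite lnK//.
move: a0; rewrite le_eqVlt => /predU1P[a0|a0].
  rewrite -a0 subr0 => <-; congr integral.
  by apply/seteqP; split => t/=; rewrite in_itv/= /A/= -a0 expR_gt0/= lnbE.
rewrite (_ : `]-oo, ln b]%classic = `]-oo, ln a]%classic `|` A); last first.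
  have lnaE t : (a < expR t) = (ln a < t) by rewrite -{1}(@lnK _ a)// ltr_expR.
  apply/seteqP; split => t/=; rewrite !in_itv/= /A/= lnaE lnbE.
    by case: (leP t (ln a)) => [|_ h]; [left|right].
  case=> [h|/andP[]//]; rewrite (le_trans h)// ler_ln// ?posrE// ltW//.
rewrite ge0_integral_setU//.
- rewrite integral_expR_Nybnd lnK//.
  by move=> e; rewrite EFinB -e addeAC subee// add0e.
- exact: mexp.
- rewrite disj_set2E; apply/eqP/seteqP; split => t//=; rewrite in_itv/= /A/= => -[h /andP[h2 _]].
  by move: h2; rewrite -(@lnK _ a)// ltr_expR ltNge h.
Qed.

Let measure_expmap_sub (A : set R) : measurable A -> A `<=` `]0, +oo[ ->
  (mu \x mu)%E (expmap @^-1` A) = mu A.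
Proof.
move=> mA A0; pose D : set R := `]0, +oo[%classic.
have mD : measurable D by exact: measurable_itv.
have mC : measurable (~` D) by exact: measurableC.
pose P := pushforward (mu \x mu)%E (expmap : R * R -> measurableTypeR R).
(* The image measure is completed by Lebesgue measure off the positive half-line, so that uniqueness
   can be tested on all half-open intervals; those containing 0 in their interior are cut there. *)
pose m' := measure_add (mrestr P mD) (mrestr mu mC).
have : mu A = m' measurable_expmap A.
  apply: lebesgue_measure_unique => // _ [[a b]] _ <-.
  rewrite [RHS]measure_addE/= /mrestr.
  have [b0|b0] := leP b 0.
    rewrite (_ : _ `&` D = set0); last first.
      by apply/seteqP; split => t //=; rewrite /D/= !in_itv/= ?andbT => -[/andP[_ tb] t0];
        move: (lt_le_trans t0 (le_trans tb b0)); rewrite ltxx.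
    rewrite (setIidl (B := ~` D)) ?measure0 ?add0e//.
    by move=> t/=; rewrite /D/= !in_itv/= ?andbT => /andP[_ tb]; apply/negP; rewrite -leNgt (le_trans tb).
  have [a0|a0] := leP 0 a.
    rewrite (_ : _ `&` ~` D = set0); last first.
      apply/disjoints_subset; rewrite setCK => t/=.
      by rewrite /D/= !in_itv/= ?andbT => /andP[+ _]; exact: le_lt_trans.
    rewrite (setIidl (B := D)); last first.
      by move=> t/=; rewrite /D/= !in_itv/= ?andbT => /andP[+ _]; exact: le_lt_trans.
    rewrite measure0 adde0 lebesgue_measure_itv/= lte_fin.
    have [ab|ba] := ltP a b; first by rewrite /P/= /pushforward measure_expmap ?a0// EFinB.
    by rewrite set_itv_ge ?measure0// bnd_simp -leNgt.
  rewrite (_ : _ `&` D = `]0, b]%classic); last first.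
    apply/seteqP; split => t/=; rewrite /D/= !in_itv/= ?andbT.
      by move=> [/andP[_ ->] ->].
    by move=> /andP[t0 ->]; rewrite t0 (lt_trans a0 t0).
  rewrite (_ : _ `&` ~` D = `]a, 0]%classic); last first.
    apply/seteqP; split => t/=; rewrite /D/= !in_itv/= ?andbT.
      by move=> [/andP[-> _]] /negP; rewrite -leNgt.
    by move=> /andP[-> t0]; split; [rewrite (le_trans t0)// ltW|apply/negP; rewrite -leNgt].
  rewrite /P/= /pushforward measure_expmap ?lexx// !lebesgue_measure_itv/= !lte_fin a0 (lt_trans a0 b0).
  by rewrite -!EFinB -EFinD; congr EFin; ring.
move=> ->; rewrite [RHS]measure_addE/= /mrestr (setIidl A0).
rewrite (_ : A `&` ~` D = set0) ?measure0 ?adde0//.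
by apply/disjoints_subset; rewrite setCK.
Qed.

Lemma Rintegral_expR (f : R -> R) : measurable_fun setT f ->
  (mu.-integrable `]0, +oo[ (EFin \o f) <->
   mu.-integrable setT (EFin \o (fun t => f (expR t) * expR t))) /\
  \int[mu]_(x in `]0, +oo[) f x = \int[mu]_t (f (expR t) * expR t).
Proof.
move=> mf; apply: integral_transfer => //.
move=> h mh h0.
have : (\int[pushforward (mu \x mu) (expmap : R * R -> measurableTypeR R)]_(x in `]0%R, +oo[)
     (h x)%:E = \int[mu \x mu]_(z in expmap @^-1` `]0%R, +oo[) (h (expmap z))%:E)%E.
  rewrite ge0_integral_pushforward//.

  - exact/measurable_EFinP/measurable_funTS.
  - by move=> x _; rewrite lee_fin.
move=> e; transitivity (\int[mu \x mu]_(z in expmap @^-1` `]0%R, +oo[) (h (expmap z))%:E)%E.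
  rewrite -e; apply: eq_measure_integral => A mA A0.
  by apply/esym/measure_expmap_sub.
move=> {e}.
have mem_dom z : (z \in expmap @^-1` `]0, +oo[) = (0 < z.2 < expR z.1).
  apply/idP/idP; rewrite inE/= in_itv/= andbT /expmap; case: ifPn => //; first by rewrite ltxx.
  by rewrite expR_gt0.
(* The region below the graph enters as an indicator factor; by Tonelli its inner integral is the
   length of []0, e^t[], which is the Jacobian. *)
pose g (z : R * R) : R := h (expR z.1) * (0 < z.2 < expR z.1)%R%:R.
have mg : measurable_fun setT g.
  apply: measurable_funM; first by do 2 apply: measurableT_comp => //.
  have : measurable_fun setT (fun z : R * R => if 0 < z.2 < expR z.1 then 1 else 0 : R).
    apply: measurable_fun_ifT => //; apply: measurable_and; first exact: measurable_fun_ltr.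
    by apply: measurable_fun_ltr => //; exact: measurableT_comp.
  by apply: eq_measurable_fun => z _; case: ifP.
transitivity (\int[(mu \x mu)%E]_z (g z)%:E)%E.
  rewrite integral_mkcond; apply: eq_integral => z _.
  rewrite patchE mem_dom /g/= /expmap; case: ifP => [->|_]; by rewrite /= ?mulr1 ?mulr0.
rewrite fubini_tonelli1; last 2 first.
- exact/measurable_EFinP.
- by move=> z; rewrite lee_fin mulr_ge0// ler0n.
apply: eq_integral => t _; rewrite /fubini_F/=.
transitivity (\int[mu]_y ((fun=> (h (expR t))%:E) \_ `]0%R, expR t[%classic) y)%E.
  apply: eq_integral => s _; rewrite patchE /g/= mem_setE in_itv/=.
  by case: ifP => _; rewrite /= ?mulr1 ?mulr0.
rewrite -integral_mkcond integral_cst//= lebesgue_measure_itv/= lte_fin expR_gt0.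
by rewrite sube0 EFinM.
Qed.

End change_of_variables.

(** * Measurability of elementary functions *)

Section measurability.
Context (R : realType).

Lemma measurable_sin : measurable_fun setT (@sin R).
Proof. by apply: continuous_measurable_fun; exact: continuous_sin. Qed.

Lemma measurable_cos : measurable_fun setT (@cos R).
Proof. by apply: continuous_measurable_fun; exact: continuous_cos. Qed.

Lemma measurable_sqrt : measurable_fun setT (@Num.sqrt R).
Proof. by apply: continuous_measurable_fun; exact: sqrt_continuous. Qed.

(** Continuity fails only at 0, and a function on a single point is measurable. *)
Lemma measurable_inv : measurable_fun setT (@GRing.inv R).
Proof.
rewrite -(setvU [set 0]); apply/measurable_funU => //; first exact: measurableC.
split; last exact: measurable_fun_set1.
apply: open_continuous_measurable_fun; first exact/closed_openC/closed_eq.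
by move=> x; rewrite inE/= => /eqP x0; exact: inv_continuous.
Qed.

End measurability.

Ltac meas1 :=
  match goal with
  | H : measurable_fun ?D ?f |- measurable_fun ?D ?f => exact H
  | |- measurable_fun _ (fun _ => ?c) => exact: measurable_cst
  | |- measurable_fun _ (fun x => x) => exact: measurable_id
  | |- measurable_fun _ (fun x => fst x) => exact: measurable_funTS
  | |- measurable_fun _ (fun x => snd x) => exact: measurable_funTS
  | |- measurable_fun _ (fun x => @GRing.add _ _ (@GRing.opp _ _)) => apply: measurable_funB
  | |- measurable_fun _ (fun x => @GRing.add _ _ _) => apply: measurable_funD
  | |- measurable_fun _ (fun x => @GRing.mul _ _ _) => apply: measurable_funM
  | |- measurable_fun _ (fun x => @GRing.opp _ _) => apply: (measurableT_comp (@oppr_measurable _ setT))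
  | |- measurable_fun _ (fun x => @GRing.inv _ _) => apply: (measurableT_comp (@measurable_inv _))
  | |- measurable_fun _ (fun x => expR _) => apply: (measurableT_comp (@measurable_expR _))
  | |- measurable_fun _ (fun x => sin _) => apply: (measurableT_comp (@measurable_sin _))
  | |- measurable_fun _ (fun x => cos _) => apply: (measurableT_comp (@measurable_cos _))
  | |- measurable_fun _ (fun x => ln _) => apply: (measurableT_comp (@measurable_ln _))
  | |- measurable_fun _ (fun x => Num.sqrt _) => apply: (measurableT_comp (@measurable_sqrt _))
  | |- measurable_fun _ (fun x => `|_|) => apply: (measurableT_comp (@normr_measurable _ _))
  | |- measurable_fun _ (fun x => @GRing.exp _ _ _) => apply: measurable_funX
  | |- measurable_fun _ id => exact: measurable_id
  | |- measurable_fun _ (cst _) => exact: measurable_cst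
  | |- measurable_fun _ fst => exact: measurable_funTS
  | |- measurable_fun _ snd => exact: measurable_funTS
  | |- measurable_fun ?D (@GRing.mul _ ?c) => apply: (@measurable_funM _ _ _ D (cst c) id)
  | |- measurable_fun ?D (@GRing.add _ ?c) => apply: (@measurable_funD _ _ _ D (cst c) id)
  | |- measurable_fun _ (@GRing.opp _) => apply: measurable_funTS; exact: oppr_measurable
  | |- measurable_fun _ expR => apply: measurable_funTS; exact: measurable_expR
  | |- measurable_fun _ sin => apply: measurable_funTS; exact: measurable_sin
  | |- measurable_fun _ cos => apply: measurable_funTS; exact: measurable_cos
  end.
Ltac meas := repeat meas1.

(** * The fundamental theorem on unbounded intervals and exponential majorants *)

Section FTC.
Context (R : realType).
Local Notation mu := (@lebesgue_measure R).
Implicit Types (F f : R -> R).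

Lemma FTC_seg F f (a b : R) : a <= b -> (forall x : R, is_derive x 1 F (f x)) ->
  continuous f -> \int[mu]_(x in `[a, b]) f x = F b - F a.
Proof.
rewrite le_eqVlt => /predU1P[<- _ _|ab dF cf].
  by rewrite set_itv1 Rintegral_set1 subrr.
have cF : continuous F.
  by move=> x; apply/differentiable_continuous/derivable1_diffP; case: (dF x).
rewrite /Rintegral (@continuous_FTC2 _ f F a b)//.
- exact: continuous_subspaceT.
- split.
  + by move=> x _; case: (dF x).
  + by apply: cvg_at_right_filter; exact: cF.
  + by apply: cvg_at_left_filter; exact: cF.
- by move=> x _; rewrite derive1E; exact: derive_val.
Qed.

Lemma FTC_cy F f (a l : R) : (forall x : R, is_derive x 1 F (f x)) -> continuous f ->
  mu.-integrable `[a, +oo[ (EFin \o f) -> F x @[x --> +oo] --> l ->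
  \int[mu]_(x in `[a, +oo[) f x = l - F a.
Proof.
move=> dF cf intf Fl.
have mf : measurable_fun setT f by exact: continuous_measurable_fun.
have [|n|x||n x|_ lim] := @Rdominated_cvg _ _ R mu `[a, +oo[
   (fun n => f \_ `[a, a + n.+1%:R]) f (fun x => `|f x|).
- exact: measurable_itv.
- by apply: measurable_funTS; apply/(measurable_restrictT _ (measurable_itv _))/measurable_funTS.
- rewrite /= in_itv/= andbT => ax; apply: cvg_near_cst.
  near=> n; rewrite patchE mem_set//= in_itv/= ax/=.
  rewrite -lerBlDl; apply: (@le_trans _ _ n%:R); last by rewrite ler_nat.
  by near: n; exact: nbhs_infty_ger.
- exact: (L1_norm _ intf).
- by rewrite patchE; case: ifP => // _; rewrite normr0.
apply: (cvg_unique _ lim) => //.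
rewrite (_ : (fun n => _) = (fun n => F (a + n.+1%:R) - F a)).
  apply: cvgB; last exact: cvg_cst.
  apply: ((cvg_pinftyP F l).1 Fl); apply/cvgryPge => r.
  near=> n; rewrite -lerBlDl; apply: (@le_trans _ _ n%:R); last by rewrite ler_nat.
  by near: n; exact: nbhs_infty_ger.
apply/funext => n; rewrite -Rintegral_mkcondr setIidr; last by apply: subset_itvl.
by apply: FTC_seg => //; rewrite lerDl.
Unshelve. all: by end_near. Qed.

Lemma FTC_T F f (l l' : R) : (forall x : R, is_derive x 1 F (f x)) -> continuous f ->
  mu.-integrable setT (EFin \o f) -> F x @[x --> +oo] --> l ->
  F x @[x --> -oo] --> l' -> \int[mu]_x f x = l - l'.
Proof.
move=> dF cf intf Fl Fl'.
have mf : measurable_fun setT f by exact: continuous_measurable_fun.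
have [|n|x _||n x _|_ lim] := @Rdominated_cvg _ _ R mu setT
   (fun n => f \_ `[- n%:R, n%:R]) f (fun x => `|f x|).
- by [].
- by apply/(measurable_restrictT _ (measurable_itv _))/measurable_funTS.
- apply: cvg_near_cst.
  near=> n; rewrite patchE mem_set//= in_itv/= -ler_norml.
  by near: n; exact: nbhs_infty_ger.
- exact: (L1_norm _ intf).
- by rewrite patchE; case: ifP => // _; rewrite normr0.
apply: (cvg_unique _ lim) => //.
rewrite (_ : (fun n => _) = (fun n => F n%:R - F (- n%:R))).
  apply: cvgB.
    by apply: ((cvg_pinftyP F l).1 Fl); exact: cvgr_idn.
  apply: ((cvg_ninftyP F l').1 Fl'); apply/cvgNrNy; exact: cvgr_idn.
apply/funext => n; rewrite -Rintegral_mkcondr setTI.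
by apply: FTC_seg => //; rewrite -subr_ge0 opprK addr_ge0.
Unshelve. all: by end_near. Qed.

Lemma cvg_expRN (p : R) : 0 < p -> expR (- (p * x)) @[x --> +oo] --> 0.
Proof.
move=> p0; apply: (@cvg_comp _ _ _ (fun x => p * x) (fun x => expR (- x)) _ +oo); last exact: cvgr_expR.
exact: gt0_cvgMry.
Qed.

Lemma continuous_explin (p c : R) : continuous (fun x : R => expR (- (p * x)) * c).
Proof.
move=> x; apply: cvgMl; apply: continuous_comp; last exact: continuous_expR.
by apply: cvgN; apply: cvgMr.
Qed.

Lemma L1_expRN_cy (p : R) : 0 < p -> mu.-integrable `[0, +oo[ (EFin \o (fun x => expR (- (p * x)))).
Proof.
move=> p0; apply/integrableP; split.
  by apply/measurable_EFinP; meas.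
under eq_integral => x _ do rewrite /= ger0_norm ?expR_ge0//.
rewrite (@ge0_continuous_FTC2y _ _ (fun x => expR (- (p * x)) * (- p^-1)) _ 0) ?ltry//.
- by apply: continuous_subspaceT; have := @continuous_explin p 1; under eq_fun do rewrite mulr1.
- rewrite -[0](mul0r (- p^-1)); apply: cvgMl; exact: cvg_expRN.
- by apply: cvg_at_right_filter; exact: (@continuous_explin p (- p^-1)).
- move=> x _; rewrite derive1E.
  have : is_derive x 1 (fun x => expR (- (p * x)) * (- p^-1)) (expR (- (p * x))).
    by apply: is_derive_eq; rewrite /GRing.scale/=; field; rewrite gt_eqF.
  by move=> h; rewrite derive_val.
Qed.

Lemma Rintegral_even (f : R -> R) : measurable_fun setT f -> (forall x, f (- x) = f x) ->
  mu.-integrable `[0, +oo[ (EFin \o f) ->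
  mu.-integrable setT (EFin \o f) /\ \int[mu]_x f x = 2 * \int[mu]_(x in `[0, +oo[) f x.
Proof.
move=> mf ef intf.
have intf' : mu.-integrable `]0, +oo[ (EFin \o f).
  apply: integrableS intf => //.
  by move=> x/=; rewrite !in_itv/= !andbT => /ltW.
(* Closed half-line in [g], open one in [g1]: in [g x + g1 (- x)] the point 0 is counted once. *)
pose g : R -> R := f \_ (`[0 : R, +oo[%classic : set (measurableTypeR R)); pose g1 : R -> R := f \_ (`]0 : R, +oo[%classic : set (measurableTypeR R)).
have mg1 : measurable_fun [set: R] g1.
  by apply/(measurable_restrictT _ (measurable_itv _))/measurable_funTS.
have ig : mu.-integrable setT (EFin \o g).
  exact: (proj1 (L1_patch mu f (measurable_itv (Interval (BLeft (0 : R)) (BInfty _ false)))) intf).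
have ig1 : mu.-integrable setT (EFin \o g1).
  exact: (proj1 (L1_patch mu f (measurable_itv (Interval (BRight (0 : R)) (BInfty _ false)))) intf').
have [e1 e2] := Rintegral_opp mg1; have ig' := e1.1 ig1.
have fE : f = (fun x => g x + g1 (- x)).
  apply/funext => x; rewrite /g /g1 !patchE !mem_setE !in_itv/= !andbT oppr_gt0 ef.
  by case: leP => _; rewrite ?addr0 ?add0r.
rewrite fE; split; first exact: L1D.
rewrite RintegralD// -e2 -fE /g /g1 -!Rintegral_mkcond.
by rewrite Rintegral_itv_obnd_cbnd// -mulr2n mulr_natl.
Qed.

Lemma L1_expR_abs (p : R) : 0 < p -> mu.-integrable setT (EFin \o (fun x => expR (- (p * `|x|)))).
Proof.
move=> p0; apply: (Rintegral_even _ _ _).1; first by meas.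
- by move=> x; rewrite normrN.
- apply: L1_le (L1_expRN_cy p0) _ => //; first by meas.
  by move=> x; rewrite /= in_itv/= andbT => x0; rewrite ger0_norm ?expR_ge0// ger0_norm.
Qed.

(** For [t < 0] the term [- a |t|] is already there. For [t >= 0] use [e^y >= y^2 / 2]; the constant
    is the maximum of [2 a t - b c^2 t^2 / 2], found by completing the square. It makes double
    exponentials comparable with [e^(-a|t|)] on the whole line. *)
Lemma gexp_bound (a b c t : R) : 0 < a -> 0 < b -> 0 < c ->
  a * t - b * expR (c * t) <= 2 * a ^+ 2 / (b * c ^+ 2) - a * `|t|.
Proof.
move=> a0 b0 c0.
have K0 : 0 <= 2 * a ^+ 2 / (b * c ^+ 2).
  by rewrite divr_ge0 ?mulr_ge0// ?exprn_ge0// ltW.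
have [t0|t0] := leP 0 t; last first.
  rewrite ltr0_norm// mulrN opprK; have : 0 <= b * expR (c * t).
    by rewrite mulr_ge0 ?expR_ge0// ltW.
  move: K0; lra.
rewrite ger0_norm//.
have h : b * ((c * t) ^+ 2 / 2) <= b * expR (c * t).
  rewrite ler_pM2l//; have := @expR_ge1Dxn _ (c * t) 1 (mulr_ge0 (ltW c0) t0).
  by apply: le_trans; rewrite (_ : 2`!%:R = 2)// lerDr.
suff : 2 * a * t <= 2 * a ^+ 2 / (b * c ^+ 2) + b * ((c * t) ^+ 2 / 2) by move: h; lra.
have s0 : 0 < b * c ^+ 2 by rewrite mulr_gt0// exprn_gt0.
have hK : 2 * a ^+ 2 / (b * c ^+ 2) * (b * c ^+ 2) = 2 * a ^+ 2 by rewrite mulfVK ?gt_eqF.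
rewrite -(ler_pM2r s0) [leRHS]mulrDl hK -subr_ge0.
rewrite (_ : _ - _ = (b * c ^+ 2 * t - 2 * a) ^+ 2 / 2) ?divr_ge0 ?sqr_ge0//; by field.
Qed.

Lemma L1_gexp (a b c : R) : 0 < a -> 0 < b -> 0 < c ->
  mu.-integrable setT (EFin \o (fun t => expR (a * t - b * expR (c * t)))).
Proof.
move=> a0 b0 c0; pose K := expR (2 * a ^+ 2 / (b * c ^+ 2)).
have i1 : mu.-integrable setT (EFin \o (fun t => K * expR (- (a * `|t|)))).
  by apply: L1Zl => //; exact: L1_expR_abs.
apply: L1_le i1 _ => //; first by meas.
by move=> t _; rewrite ger0_norm ?expR_ge0// -expRD ler_expR gexp_bound.
Qed.

Lemma cvgy_expR_abs (p : R) : 0 < p -> expR (- (p * `|x|)) @[x --> +oo] --> 0.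
Proof.
move=> p0; apply: cvg_trans (cvg_expRN p0); apply: near_eq_cvg.
by near=> x; rewrite ger0_norm.
Unshelve. all: by end_near. Qed.

Lemma cvgNy_expR_abs (p : R) : 0 < p -> expR (- (p * `|x|)) @[x --> -oo] --> 0.
Proof.
move=> p0; apply/cvgNy_compNP; rewrite /comp; under eq_fun do rewrite normrN.
exact: cvgy_expR_abs.
Qed.

Lemma cvgy0_expR_abs (p K : R) (F : R -> R) : 0 < p ->
  (forall x, `|F x| <= K * expR (- (p * `|x|))) -> F x @[x --> +oo] --> 0.
Proof.
move=> p0 FK; apply: norm_cvg0; apply: (@squeeze_cvgr _ _ _ _ (cst 0) (fun x => K * expR (- (p * `|x|)))).
- by apply: nearW => x; rewrite normr_ge0/=.
- exact: cvg_cst.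
- by rewrite -[0](mulr0 K); apply: cvgMr; exact: cvgy_expR_abs.
Qed.

Lemma cvgNy0_expR_abs (p K : R) (F : R -> R) : 0 < p ->
  (forall x, `|F x| <= K * expR (- (p * `|x|))) -> F x @[x --> -oo] --> 0.
Proof.
move=> p0 FK; apply: norm_cvg0; apply: (@squeeze_cvgr _ _ _ _ (cst 0) (fun x => K * expR (- (p * `|x|)))).
- by apply: nearW => x; rewrite normr_ge0/=.
- exact: cvg_cst.
- by rewrite -[0](mulr0 K); apply: cvgMr; exact: cvgNy_expR_abs.
Qed.

Lemma L1_expcos (p al : R) : 0 < p -> mu.-integrable `[0, +oo[ (EFin \o (fun x => expR (- (p * x)) * cos (al * x))).
Proof.
move=> p0; apply: L1_le (L1_expRN_cy p0) _ => //; first by meas.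
by move=> x _; rewrite normrM ger0_norm ?expR_ge0// ler_piMr ?expR_ge0// cos_max.
Qed.

Lemma L1_expsin (p al : R) : 0 < p -> mu.-integrable `[0, +oo[ (EFin \o (fun x => expR (- (p * x)) * sin (al * x))).
Proof.
move=> p0; apply: L1_le (L1_expRN_cy p0) _ => //; first by meas.
by move=> x _; rewrite normrM ger0_norm ?expR_ge0// ler_piMr ?expR_ge0// sin_max.
Qed.

Lemma cvgy0_mul_bounded (f g : R -> R) (K : R) : f x @[x --> +oo] --> 0 -> (forall x, `|g x| <= K) ->
  (f x * g x) @[x --> +oo] --> 0.
Proof.
move=> f0 gK; apply: norm_cvg0.
have K0 : 0 <= K by apply: le_trans (gK 0).
apply: (@squeeze_cvgr _ _ _ _ (cst 0) (fun x => `|f x| * K)).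
- by apply: nearW => x; rewrite normr_ge0/= normrM ler_wpM2l.
- exact: cvg_cst.
- by rewrite -[0](mul0r K); apply: cvgMl; rewrite -(normr0 R); exact: cvg_norm.
Qed.

Lemma integral_expcos (p al : R) : 0 < p ->
  \int[mu]_(x in `[0, +oo[) (expR (- (p * x)) * cos (al * x)) = p / (p ^+ 2 + al ^+ 2).
Proof.
move=> p0; have q0 : p ^+ 2 + al ^+ 2 != 0 by rewrite gt_eqF// ltr_wpDr ?sqr_ge0// exprn_gt0.
(* Real part of [e^((-p + i al) x) / (-p + i al)]; the imaginary part is the primitive for the
   sine. *)
pose F x := expR (- (p * x)) * ((al * sin (al * x) - p * cos (al * x)) / (p ^+ 2 + al ^+ 2)).
transitivity (0 - F 0); last by rewrite /F !mulr0 oppr0 expR0 sin0 cos0; field.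
apply: FTC_cy.
- by move=> x; rewrite /F; apply: is_derive_eq; rewrite /GRing.scale/=; field.
- move=> x; apply: cvgM; first by have := @continuous_explin p 1; under eq_fun do rewrite mulr1; apply.
  by apply: continuous_comp; [exact: cvgMr|exact: continuous_cos].
- exact: L1_expcos.
- rewrite /F; apply: (@cvgy0_mul_bounded _ _ ((`|al| + `|p|) / `|p ^+ 2 + al ^+ 2|)); first exact: cvg_expRN.
  move=> x; rewrite normrM normfV ler_wpM2r ?invr_ge0//.
  by rewrite (le_trans (ler_normB _ _))// lerD// normrM ler_piMr// ?sin_max ?cos_max.
Qed.

Lemma integral_expsin (p al : R) : 0 < p ->
  \int[mu]_(x in `[0, +oo[) (expR (- (p * x)) * sin (al * x)) = al / (p ^+ 2 + al ^+ 2).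
Proof.
move=> p0; have q0 : p ^+ 2 + al ^+ 2 != 0 by rewrite gt_eqF// ltr_wpDr ?sqr_ge0// exprn_gt0.
pose F x := expR (- (p * x)) * ((- al * cos (al * x) - p * sin (al * x)) / (p ^+ 2 + al ^+ 2)).
transitivity (0 - F 0); last by rewrite /F !mulr0 oppr0 expR0 sin0 cos0; field.
apply: FTC_cy.
- by move=> x; rewrite /F; apply: is_derive_eq; rewrite /GRing.scale/=; field.
- move=> x; apply: cvgM; first by have := @continuous_explin p 1; under eq_fun do rewrite mulr1; apply.
  by apply: continuous_comp; [exact: cvgMr|exact: continuous_sin].
- exact: L1_expsin.
- rewrite /F; apply: (@cvgy0_mul_bounded _ _ ((`|al| + `|p|) / `|p ^+ 2 + al ^+ 2|)); first exact: cvg_expRN.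
  move=> x; rewrite normrM normfV ler_wpM2r ?invr_ge0//.
  by rewrite (le_trans (ler_normB _ _))// lerD// normrM ?normrN ler_piMr// ?sin_max ?cos_max.
Qed.

End FTC.

(** * Elementary inequalities for sine, cosine and hyperbolic cosine *)

Section sine_bounds.
Context (R : realType).

Lemma is_derive_continuous (f df : R -> R) : (forall x : R, is_derive x 1 f (df x)) -> continuous f.
Proof.
by move=> dF x; apply/differentiable_continuous/derivable1_diffP; case: (dF x).
Qed.

Lemma sin_le_id (x : R) : 0 <= x -> sin x <= x.
Proof.
move=> x0; have [|c _] := @MVT_segment R sin cos 0 x x0 (fun y _ => is_derive_sin y).
  by apply: continuous_subspaceT; exact: continuous_sin.
by rewrite sin0 !subr0 => ->; rewrite ler_piMl// cos_le1.
Qed.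

Lemma ler_norm_sin (x : R) : `|sin x| <= `|x|.
Proof.
wlog x0 : x / 0 <= x.
  move=> h; have [|/ltW] := leP 0 x; first exact: h.
  by rewrite -oppr_ge0 => /h; rewrite sinN !normrN.
rewrite (ger0_norm x0) ler_norml sin_le_id// andbT.
have [x1|x1] := leP x 1; last first.
  by rewrite (le_trans _ (sin_geN1 x))// lerN2 ltW.
rewrite (@le_trans _ _ 0) ?oppr_le0// sin_ge0_pi// x0/=.
by rewrite (le_trans x1)// (le_trans _ (pi_ge2 R))// ler1n.
Qed.

Lemma cos_ge_sqr (x : R) : 1 - x ^+ 2 / 2 <= cos x.
Proof.
have -> : cos x = 1 - 2 * sin (x / 2) ^+ 2.
  by rewrite {1}(splitr x) cosD -!expr2 cos2sin2; ring.
rewrite lerD2l lerN2.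
have : sin (x / 2) ^+ 2 <= (x / 2) ^+ 2.
  by rewrite -[leLHS]real_normK ?num_real// -[leRHS]real_normK ?num_real// lerXn2r ?nnegrE// ler_norm_sin.
by rewrite expr_div_n; lra.
Qed.

(** The parenthesis is the square of [e^(d/2) - e^(-d/2)], which for [d >= 0] is at least [d/2]
    because [e^(d/2) >= 1 + d/2] and [e^(-d/2) <= 1]. The constant 4 is not sharp. *)
Lemma sqr_le_coshB1 (d : R) : d ^+ 2 <= 4 * (expR d - 2 + expR (- d)).
Proof.
wlog d0 : d / 0 <= d.
  move=> h; have [|/ltW] := leP 0 d; first exact: h.
  by rewrite -oppr_ge0 => /h; rewrite sqrrN opprK; lra.
have e1 : expR d = expR (d / 2) ^+ 2 by rewrite -expRM_natl; congr expR; field.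
have e2 : expR (- d) = expR (- (d / 2)) ^+ 2 by rewrite -expRM_natl; congr expR; field.
have e3 : expR (d / 2) * expR (- (d / 2)) = 1 by rewrite expRxMexpNx_1.
have h1 : 1 + d / 2 <= expR (d / 2) by exact: expR_ge1Dx.
have h2 : expR (- (d / 2)) <= 1 by rewrite expR_le1 oppr_le0 divr_ge0.
rewrite e1 e2; set a := expR _ in e3 h1 *; set b := expR _ in e3 h2 *.
have -> : a ^+ 2 - 2 + b ^+ 2 = (a - b) ^+ 2 by rewrite sqrrB e3; ring.
have : d / 2 <= a - b by lra.
move=> h; have : (d / 2) ^+ 2 <= (a - b) ^+ 2 by rewrite lerXn2r ?nnegrE//; lra.
by rewrite expr_div_n; lra.
Qed.

End sine_bounds.

(** * The reciprocal Gamma function on vertical lines *)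

Section gamma.
Context (R : realType) (tau : R).
Local Notation mu := (@lebesgue_measure R).

(** Euler's integrand at real argument [k + 1] after the substitution [s = e^t]; thus [gammaC] and
    [gammaS] below are the real and imaginary parts of [Gamma(k + 1 + i tau)]. *)
Definition gamma_weight (k : nat) (t : R) : R := expR (k.+1%:R * t - expR t).

Definition gammaC (k : nat) : R := \int[mu]_t (gamma_weight k t * cos (tau * t)).
Definition gammaS (k : nat) : R := \int[mu]_t (gamma_weight k t * sin (tau * t)).

Lemma measurable_gamma_weight k : measurable_fun setT (gamma_weight k).
Proof. by rewrite /gamma_weight; meas. Qed.

Lemma gamma_weightS k t : gamma_weight k.+1 t = expR t * gamma_weight k t.
Proof. by rewrite /gamma_weight -expRD; congr expR; rewrite -[in LHS]natr1; ring. Qed.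

Lemma gamma_weight_bound k : exists K, forall t, gamma_weight k t <= K * expR (- (1 * `|t|)).
Proof.
exists (expR (2 * k.+1%:R ^+ 2 / (1 * 1 ^+ 2))) => t; rewrite -expRD ler_expR.
have := @gexp_bound R k.+1%:R 1 1 t (ltr0Sn _ _) ltr01 ltr01; rewrite !mul1r => /le_trans; apply.
rewrite lerD2l lerN2 ler_peMl// ler1n//.
Qed.

Lemma L1_gamma_weight k : mu.-integrable setT (EFin \o gamma_weight k).
Proof.
have [K hK] := gamma_weight_bound k.
have i1 : mu.-integrable setT (EFin \o (fun t => K * expR (- (1 * `|t|)))).
  by apply: L1Zl => //; exact: L1_expR_abs.
apply: L1_le i1 _ => //; first exact: measurable_gamma_weight.
by move=> t _; rewrite ger0_norm ?expR_ge0.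
Qed.

Lemma L1_gamma_weightM k (f : R -> R) : measurable_fun setT f -> (forall t, `|f t| <= 1) ->
  mu.-integrable setT (EFin \o (fun t => gamma_weight k t * f t)).
Proof.
move=> mf f1; apply: L1_le (L1_gamma_weight k) _ => //.
  by apply: measurable_funM => //; exact: measurable_gamma_weight.
by move=> t _; rewrite normrM ger0_norm ?expR_ge0// ler_piMr ?expR_ge0.
Qed.

Lemma L1_gammaC k : mu.-integrable setT (EFin \o (fun t => gamma_weight k t * cos (tau * t))).
Proof. by apply: L1_gamma_weightM; [meas|move=> t; exact: cos_max]. Qed.

Lemma L1_gammaS k : mu.-integrable setT (EFin \o (fun t => gamma_weight k t * sin (tau * t))).
Proof. by apply: L1_gamma_weightM; [meas|move=> t; exact: sin_max]. Qed.

(** Real part of [Gamma(s + 1) = s Gamma(s)] at [s = k + 1 + i tau]: the derivative of [F]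
    integrates to 0, since [F] vanishes at both ends. *)
Lemma gammaC_rec k : gammaC k.+1 = k.+1%:R * gammaC k - tau * gammaS k.
Proof.
pose F t := gamma_weight k t * cos (tau * t).
pose f t := k.+1%:R * (gamma_weight k t * cos (tau * t)) - gamma_weight k.+1 t * cos (tau * t)
  - tau * (gamma_weight k t * sin (tau * t)).
have dF (t : R) : is_derive t 1 F (f t).
  rewrite /F /f gamma_weightS /gamma_weight.
  by apply: is_derive_eq; rewrite /GRing.scale/=; ring.
have iC := L1Zl k.+1%:R measurableT (L1_gammaC k).
have iS := L1Zl tau measurableT (L1_gammaS k).
have iC1 := L1_gammaC k.+1.
have i1 := L1B measurableT iC iC1.
have [K hK] := gamma_weight_bound k.
have FK t : `|F t| <= K * expR (- (1 * `|t|)).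
  apply: le_trans (hK t); rewrite normrM ger0_norm ?expR_ge0// ler_piMr ?expR_ge0//; exact: cos_max.
have := @FTC_T R F f 0 0 dF _ (L1B measurableT i1 iS) (cvgy0_expR_abs ltr01 FK) (cvgNy0_expR_abs ltr01 FK).
rewrite /f RintegralB// RintegralB// RintegralZl//; last exact: L1_gammaC.
rewrite RintegralZl//; last exact: L1_gammaS.
rewrite -/(gammaC k) -/(gammaS k) -/(gammaC k.+1) subr0 => h.
have {h} := h _; rewrite /gamma_weight => h.
suff /h : continuous f by lra.
rewrite /f; apply: (@is_derive_continuous _ _ ('D_1 f)) => t; apply: DeriveDef => //.
Qed.

Lemma gammaS_rec k : gammaS k.+1 = k.+1%:R * gammaS k + tau * gammaC k.
Proof.
pose F t := gamma_weight k t * sin (tau * t).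
pose f t := k.+1%:R * (gamma_weight k t * sin (tau * t)) - gamma_weight k.+1 t * sin (tau * t)
  + tau * (gamma_weight k t * cos (tau * t)).
have dF (t : R) : is_derive t 1 F (f t).
  rewrite /F /f gamma_weightS /gamma_weight.
  by apply: is_derive_eq; rewrite /GRing.scale/=; ring.
have iC := L1Zl k.+1%:R measurableT (L1_gammaS k).
have iS := L1Zl tau measurableT (L1_gammaC k).
have iC1 := L1_gammaS k.+1.
have i1 := L1B measurableT iC iC1.
have [K hK] := gamma_weight_bound k.
have FK t : `|F t| <= K * expR (- (1 * `|t|)).
  apply: le_trans (hK t); rewrite normrM ger0_norm ?expR_ge0// ler_piMr ?expR_ge0//; exact: sin_max.
have := @FTC_T R F f 0 0 dF _ (L1D measurableT i1 iS) (cvgy0_expR_abs ltr01 FK) (cvgNy0_expR_abs ltr01 FK).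
rewrite /f RintegralD// RintegralB// RintegralZl//; last exact: L1_gammaS.
rewrite RintegralZl//; last exact: L1_gammaC.
rewrite -/(gammaC k) -/(gammaS k) -/(gammaS k.+1) subr0 => h.
have {h} := h _; rewrite /gamma_weight => h.
suff /h : continuous f by lra.
rewrite /f; apply: (@is_derive_continuous _ _ ('D_1 f)) => t; apply: DeriveDef => //.
Qed.

(** This is [|Gamma(k + 1 + i tau)|^2]. *)
Definition gamma_norm (k : nat) : R := gammaC k ^+ 2 + gammaS k ^+ 2.

Lemma gamma_normS k : gamma_norm k.+1 = (k.+1%:R ^+ 2 + tau ^+ 2) * gamma_norm k.
Proof. by rewrite /gamma_norm gammaC_rec gammaS_rec; ring. Qed.

End gamma.

Section gamma_moments.
Context (R : realType).
Local Notation mu := (@lebesgue_measure R).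

Lemma integral_gamma_weight k : \int[mu]_t (gamma_weight k t : R) = k`!%:R.
Proof.
elim: k => [|k IHk]; last first.
  have := gammaC_rec (0 : R) k; rewrite /gammaC mul0r subr0.
  under eq_Rintegral do rewrite mul0r cos0 mulr1.
  by under [in RHS]eq_Rintegral do rewrite mul0r cos0 mulr1; rewrite IHk factS natrM.
have dF (t : R) : is_derive t 1 (fun t => - expR (- expR t)) (gamma_weight 0 t).
  by apply: is_derive_eq; rewrite /GRing.scale/= /gamma_weight mul1r expRD; ring.
rewrite (_ : 0`!%:R = 0 - (- 1)); last by rewrite fact0; ring.
apply: (FTC_T dF).
- apply: (@is_derive_continuous _ _ ('D_1 (gamma_weight 0))) => t; apply: DeriveDef => //.
- exact: L1_gamma_weight.
- rewrite -oppr0; apply: cvgN.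
  apply: (@cvg_comp _ _ _ (fun x : R => expR x) (fun x => expR (- x)) _ +oo); last exact: cvgr_expR.
  apply/cvgryPge => A; near=> x.
  apply: (@le_trans _ _ (1 + x)); last exact: expR_ge1Dx.
  rewrite -lerBlDl; near: x; apply: nbhs_pinfty_ge; exact: num_real.
- apply: cvgN; rewrite -(expR0 R) -oppr0; apply: (cvg_comp (fun x => - expR x) expR); last exact: continuous_expR.
  apply: cvgN; apply/cvgNy_compNP; exact: cvgr_expR.
Unshelve. all: by end_near. Qed.

Variable tau : R.

(** Real part of [e^(-i tau v) Gamma(k + 1 + i tau)]. *)
Lemma gamma_rotated (k : nat) (v : R) :
  mu.-integrable setT (EFin \o (fun t => gamma_weight k t * cos (tau * (t - v)))) /\
  \int[mu]_t (gamma_weight k t * cos (tau * (t - v))) =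
  cos (tau * v) * gammaC tau k + sin (tau * v) * gammaS tau k.
Proof.
split; first by apply: L1_gamma_weightM; [meas|move=> t; exact: cos_max].
rewrite -RintegralZl//; last exact: L1_gammaC.
rewrite -RintegralZl//; last exact: L1_gammaS.
rewrite -RintegralD//; last 2 first.
- by apply: L1Zl => //; exact: L1_gammaC.
- by apply: L1Zl => //; exact: L1_gammaS.
by apply: eq_Rintegral => t _; rewrite mulrBr cosB; ring.
Qed.

Lemma gamma_rotated_sin (k : nat) (v : R) :
  mu.-integrable setT (EFin \o (fun t => gamma_weight k t * sin (tau * (t - v)))) /\
  \int[mu]_t (gamma_weight k t * sin (tau * (t - v))) =
  cos (tau * v) * gammaS tau k - sin (tau * v) * gammaC tau k.
Proof.
split; first by apply: L1_gamma_weightM; [meas|move=> t; exact: sin_max].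
rewrite -RintegralZl//; last exact: L1_gammaS.
rewrite -RintegralZl//; last exact: L1_gammaC.
rewrite -RintegralB//; last 2 first.
- by apply: L1Zl => //; exact: L1_gammaS.
- by apply: L1Zl => //; exact: L1_gammaC.
by apply: eq_Rintegral => t _; rewrite mulrBr sinB; ring.
Qed.

(* The weight t^N e^-t dt / N! concentrates near N, so that the phase of
   t^(i tau) is almost constant. *)
Lemma gamma_norm_large (m : nat) : 2 * tau ^+ 2 < m.+1%:R -> gamma_norm tau m.+1 != 0.
Proof.
move=> hm; rewrite /gamma_norm paddr_eq0 ?sqr_ge0// !sqrf_eq0; apply/negP => /andP[/eqP C0 /eqP S0].
pose N : R := m.+1%:R; have N0 : 0 < N by rewrite ltr0n.
have [i1 e1] := gamma_rotated m.+1 (ln N); rewrite C0 S0 !mulr0 addr0 in e1.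
(* With [d = t - ln N], the minorant of the cosine is [1 - 2 tau^2 (e^d - 2 + e^(-d))]. The factors
   [e^d] and [e^(-d)] only shift the index of the weight, so its integral is explicit:
   [m! (N - 2 tau^2)], which is positive. If Gamma vanished, the rotated integral above it would be
   0. *)
have i2 : mu.-integrable setT (EFin \o (fun t => gamma_weight m.+1 t -
    2 * tau ^+ 2 * (N^-1 * gamma_weight m.+2 t - 2 * gamma_weight m.+1 t + N * gamma_weight m t))).
  apply: L1B => //; first exact: L1_gamma_weight.
  apply: L1Zl => //; apply: L1D => //; last by apply: L1Zl => //; exact: L1_gamma_weight.
  by apply: L1B => //; apply: L1Zl => //; exact: L1_gamma_weight.
have : \int[mu]_t (gamma_weight m.+1 t -
    2 * tau ^+ 2 * (N^-1 * gamma_weight m.+2 t - 2 * gamma_weight m.+1 t + N * gamma_weight m t)) <=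
    \int[mu]_t (gamma_weight m.+1 t * cos (tau * (t - ln N))).
  apply: le_Rintegral => // t _.
  have -> : gamma_weight m.+2 t = N * expR (t - ln N) * gamma_weight m.+1 t.
    by rewrite gamma_weightS expRB lnK ?posrE//; field; rewrite gt_eqF.
  have -> : gamma_weight m t = N^-1 * expR (- (t - ln N)) * gamma_weight m.+1 t.
    rewrite gamma_weightS opprB expRB lnK ?posrE//; field.
    by do ?[apply/andP; split]; rewrite gt_eqF ?expR_gt0.
  set d := t - ln N; set w := gamma_weight _ _.
  have -> : w - 2 * tau ^+ 2 * (N^-1 * (N * expR d * w) - 2 * w + N * (N^-1 * expR (- d) * w)) =
     w * (1 - 2 * tau ^+ 2 * (expR d - 2 + expR (- d))) by field; rewrite gt_eqF.
  rewrite ler_wpM2l ?expR_ge0//; apply: le_trans (cos_ge_sqr _).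
  rewrite lerD2l lerN2 exprMn; have := sqr_le_coshB1 d.
  have := sqr_ge0 tau; set T := tau ^+ 2; set D := d ^+ 2; set E := (_ + _)%R; nra.
rewrite e1 RintegralB//; last 2 first.
- exact: L1_gamma_weight.
- apply: L1Zl => //; apply: L1D => //; last by apply: L1Zl => //; exact: L1_gamma_weight.
  by apply: L1B => //; apply: L1Zl => //; exact: L1_gamma_weight.
rewrite RintegralZl//; last first.
  apply: L1D => //; last by apply: L1Zl => //; exact: L1_gamma_weight.
  by apply: L1B => //; apply: L1Zl => //; exact: L1_gamma_weight.
rewrite RintegralD//; last 2 first.
- by apply: L1B => //; apply: L1Zl => //; exact: L1_gamma_weight.
- by apply: L1Zl => //; exact: L1_gamma_weight.
rewrite RintegralB//; [|by apply: L1Zl => //; exact: L1_gamma_weight..].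
rewrite !RintegralZl//; [|exact: L1_gamma_weight..].
rewrite !integral_gamma_weight !factS !natrM -/N.
have f0 : 0 < m`!%:R :> R by rewrite ltr0n fact_gt0.
rewrite (_ : m.+2%:R = N + 1); last by rewrite /N -natr1.
rewrite leNgt => /negP; apply.
rewrite (_ : _ - _ = m`!%:R * (N - 2 * tau ^+ 2)); last by field; rewrite gt_eqF.
by rewrite mulr_gt0// subr_gt0.
Qed.

(** Non-vanishing is known for large index and descends, because [gamma_norm] at [k + 1] is a
    multiple of its value at [k]. *)
Lemma gamma_norm_gt0 k : 0 < gamma_norm tau k.
Proof.
have ge0 j : 0 <= gamma_norm tau j by rewrite addr_ge0 ?sqr_ge0.
have [m hm] : exists m : nat, 2 * tau ^+ 2 < m.+1%:R.
  exists (Num.bound (2 * tau ^+ 2)).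
  have := archi_boundP (mulr_ge0 (ler0n _ 2) (sqr_ge0 tau)) => /lt_trans; apply.
  by rewrite ltr_nat.
have ind j i : gamma_norm tau (j + i) != 0 -> gamma_norm tau i != 0.
  elim: j => [//|j IH]; rewrite addSn (gamma_normS tau (j + i)) mulf_eq0 negb_or => /andP[_ h].
  exact: (IH h).
rewrite lt_def ge0 andbT; apply: (ind m.+1).
rewrite addSn; have [|] := leqP k 0.
  by rewrite leqn0 => /eqP ->; rewrite addn0; exact: gamma_norm_large.
move=> _; apply: gamma_norm_large; apply: lt_le_trans hm _.
by rewrite ler_nat ltnS leq_addr.
Qed.

(** Each step of the recursion multiplies by at least [(k + 1)^2]. Consequently
    [1 / Gamma(k + 1 + i tau)] is at most a constant over [k!], the decay used for the series of
    J. *)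
Lemma gamma_norm_ge k : (k`!%:R) ^+ 2 * gamma_norm tau 0 <= gamma_norm tau k.
Proof.
elim: k => [|k IH]; first by rewrite fact0 expr1n mul1r.
rewrite gamma_normS factS natrM exprMn -mulrA.
apply: ler_pM; [exact: sqr_ge0| |by rewrite lerDl sqr_ge0|exact: IH].
by rewrite mulr_ge0 ?sqr_ge0// ltW// gamma_norm_gt0.
Qed.

(* real and imaginary parts of 1 / Gamma(k + 1 + i tau) *)
Definition rgamma_re k : R := gammaC tau k / gamma_norm tau k.
Definition rgamma_im k : R := - gammaS tau k / gamma_norm tau k.

Definition rgamma_bound : R := (Num.sqrt (gamma_norm tau 0))^-1.

Lemma rgamma_bound_ge0 : 0 <= rgamma_bound.
Proof. by rewrite invr_ge0 sqrtr_ge0. Qed.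

Let rgamma_le (a : R) k : a ^+ 2 <= gamma_norm tau k ->
  `|a / gamma_norm tau k| <= rgamma_bound / k`!%:R.
Proof.
move=> ha; have N0 := gamma_norm_gt0 0; have Nk := gamma_norm_gt0 k.
have f0 : 0 < k`!%:R :> R by rewrite ltr0n fact_gt0.
have s0 : 0 < Num.sqrt (gamma_norm tau 0) by rewrite sqrtr_gt0.
rewrite -(@ler_pXn2r _ 2)// ?nnegrE ?divr_ge0 ?rgamma_bound_ge0//.
have -> : (rgamma_bound / k`!%:R) ^+ 2 = (gamma_norm tau 0 * k`!%:R ^+ 2)^-1.
  by rewrite /rgamma_bound -invfM exprVn exprMn sqr_sqrtr ?(ltW N0).
rewrite real_normK ?num_real// expr_div_n.
rewrite ler_pdivrMr ?exprn_gt0//.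
apply: le_trans ha _.
rewrite (expr2 (gamma_norm tau k)) mulrA ler_peMl ?(ltW Nk)//.
rewrite mulrC ler_pdivlMr ?mul1r; last by rewrite mulr_gt0// exprn_gt0.
by rewrite mulrC gamma_norm_ge.
Qed.

Lemma rgamma_re_le k : `|rgamma_re k| <= rgamma_bound / k`!%:R.
Proof. by apply: rgamma_le; rewrite lerDl sqr_ge0. Qed.

Lemma rgamma_im_le k : `|rgamma_im k| <= rgamma_bound / k`!%:R.
Proof. by apply: rgamma_le; rewrite sqrrN lerDr sqr_ge0. Qed.

(* real part of e^(i tau t) / Gamma(k + 1 + i tau) *)
Definition rgamma_phase k (t : R) : R := rgamma_re k * cos (tau * t) - rgamma_im k * sin (tau * t).

Lemma rgamma_phase_le k t : `|rgamma_phase k t| <= 2 * rgamma_bound / k`!%:R.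
Proof.
rewrite (le_trans (ler_normB _ _))// (_ : 2 * _ / _ = rgamma_bound / k`!%:R + rgamma_bound / k`!%:R); last by ring.
rewrite lerD// normrM.
- by apply: le_trans (rgamma_re_le k); rewrite ler_piMr// cos_max.
- by apply: le_trans (rgamma_im_le k); rewrite ler_piMr// sin_max.
Qed.

Lemma measurable_rgamma_phase k : measurable_fun setT (rgamma_phase k).
Proof. by rewrite /rgamma_phase; meas. Qed.

(** Translation by [v] turns the integral into the real part of [e^(-(k + 1) v) e^(-i tau v)] times
    [Gamma / Gamma]. This cancellation is what allows the series of J to be summed in closed
    form. *)
Lemma integral_rgamma_phase k v :
  \int[mu]_t (expR (k.+1%:R * t - expR (v + t)) * rgamma_phase k t) =
  expR (- (k.+1%:R * v)) * cos (tau * v).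
Proof.
have mf : measurable_fun setT (fun t : R => expR (k.+1%:R * t - expR (v + t)) * rgamma_phase k t).
  apply: measurable_funM; last exact: measurable_rgamma_phase.
  meas.
have [_ ->] := Rintegral_shift (- v) mf.
have [i1 e1] := gamma_rotated k v; have [i2 e2] := gamma_rotated_sin k v.
transitivity (\int[mu]_t (expR (- (k.+1%:R * v)) * (rgamma_re k * (gamma_weight k t * cos (tau * (t - v)))
    - rgamma_im k * (gamma_weight k t * sin (tau * (t - v)))))).
  apply: eq_Rintegral => t _; rewrite /rgamma_phase /gamma_weight.
  rewrite (_ : v + (t - v) = t); last by ring.
  rewrite (_ : k.+1%:R * (t - v) - expR t = - (k.+1%:R * v) + (k.+1%:R * t - expR t)); last by ring.
  by rewrite expRD; ring.
have j1 := L1Zl (rgamma_re k) measurableT i1.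
have j2 := L1Zl (rgamma_im k) measurableT i2.
rewrite RintegralZl//; last exact: L1B.
rewrite RintegralB// RintegralZl// RintegralZl// e1 e2; congr (_ * _).
rewrite /rgamma_re /rgamma_im.
transitivity (cos (tau * v) * (gammaC tau k ^+ 2 + gammaS tau k ^+ 2) / gamma_norm tau k); first by ring.
by rewrite -/(gamma_norm tau k) mulfK// gt_eqF// gamma_norm_gt0.
Qed.

End gamma_moments.

(** * The substitution [v = ln (1 + e^t)] *)

Section softplus.
Context (R : realType).
Local Notation mu := (@lebesgue_measure R).

(** Composed of three known substitutions: [y = e^t], the translation [z = 1 + y], and [z = e^v].
    Indicators carry the domain [z > 1] along. *)
Lemma Rintegral_softplus (H : R -> R) : measurable_fun setT H ->
  \int[mu]_t (H (ln (1 + expR t)) * (expR t / (1 + expR t))) = \int[mu]_(v in `]0, +oo[) H v.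
Proof.
move=> mH.
pose f (y : R) := H (ln (1 + y)) * (1 + y)^-1.
have mf : measurable_fun setT f.
  by rewrite /f; apply: measurable_funM; [apply: (measurableT_comp mH); meas|meas].
transitivity (\int[mu]_t (f (expR t) * expR t)).
  by apply: eq_Rintegral => t _; rewrite /f; ring.
have [_ <-] := Rintegral_expR mf.
rewrite Rintegral_mkcond.
have mI0 : measurable (`]0 : R, +oo[%classic : set (measurableTypeR R)) by exact: measurable_itv.
have mf0 : measurable_fun setT (f \_ `]0 : R, +oo[).
  by apply/(measurable_restrictT _ mI0); exact: measurable_funTS.
have [_ ->] := Rintegral_shift (- 1) mf0.
pose g (z : R) : R := if 1 < z then H (ln z) / z else 0.
have mg : measurable_fun setT g.
  rewrite /g; apply: measurable_fun_ifT => //; first exact: measurable_fun_ltr.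
  by apply: measurable_funM; [apply: (measurableT_comp mH); exact: measurable_ln|exact: measurable_inv].
transitivity (\int[mu]_(z in `]0, +oo[) g z).
  rewrite [RHS]Rintegral_mkcond; apply: eq_Rintegral => z _.
  rewrite !patchE !mem_setE !in_itv/= !andbT subr_gt0 /g /f.
  have [z1|z1] := ltP 1 z; last by case: ifP.
  rewrite (lt_trans ltr01 z1) (_ : 1 + (z - 1) = z)//; ring.
have [_ ->] := Rintegral_expR mg.
rewrite [RHS]Rintegral_mkcond; apply: eq_Rintegral => v _.
rewrite !patchE !mem_setE !in_itv/= !andbT /g expR_gt1.
by case: ifP => _; rewrite ?mul0r// expRK mulfVK// gt_eqF// expR_gt0.
Qed.

End softplus.

(** * Products of Bessel functions in the logarithmic variable *)

Section bessel_series.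
Context (R : realType) (tau : R).
Local Notation mu := (@lebesgue_measure R).

(** For nonnegative terms the sum of squares is at most the square of the sum. The exponent [2 w]
    must not be enlarged: it is cancelled later by the factor [e^(-2w)] of K. *)
Lemma sum_expR_sqr_le (w : R) (N : nat) : 0 <= w ->
  \sum_(0 <= k < N) (w ^+ k / k`!%:R) ^+ 2 <= expR (2 * w).
Proof.
move=> w0.
have pos k : 0 <= w ^+ k / k`!%:R by rewrite divr_ge0 ?exprn_ge0.
have h1 : \sum_(0 <= k < N) (w ^+ k / k`!%:R) <= expR w.
  rewrite /expR; apply: (@nondecreasing_cvgn_le _ (series (exp_coeff w))).
    apply/nondecreasing_seqP => n; rewrite /series/= big_nat_recr//= lerDl.
    by rewrite exp_coeffE mulrC pos.
  exact: is_cvg_series_exp_coeff.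
have h2 : \sum_(0 <= k < N) (w ^+ k / k`!%:R) ^+ 2 <= (\sum_(0 <= k < N) (w ^+ k / k`!%:R)) ^+ 2.
  elim: N {h1} => [|N IH]; first by rewrite !big_geq// expr0n.
  rewrite !big_nat_recr//= sqrrD.
  have s0 : 0 <= \sum_(0 <= i < N) (w ^+ i / i`!%:R) by apply: sumr_ge0.
  have := mulr_ge0 s0 (pos N); rewrite mulr2n; move: IH; lra.
apply: (le_trans h2); rewrite expRM_natl lerXn2r// ?nnegrE ?expR_ge0//.
exact: sumr_ge0.
Qed.

Let half_sqr (xi : R) k : expR (k%:R * xi) = (expR (xi / 2) ^+ k) ^+ 2.
Proof. by rewrite -exprM mulnC exprM -!expRM_natl; congr expR; field. Qed.

(* e^(k xi) = (w^2)^k with w = e^(xi/2) = z/2, so these are the coefficients of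
   J_(i tau)(z) = (z/2)^(i tau) (besselP + i besselQ). *)
Definition bessel_coeff (a : nat -> R) (xi : R) (k : nat) : R :=
  (- 1) ^+ k * expR (k%:R * xi) / k`!%:R * a k.

Definition bessel_lim (a : nat -> R) (xi : R) : R := limn (series (bessel_coeff a xi)).

Lemma bessel_coeff_sum (a : nat -> R) (C : R) (xi : R) N : 0 <= C -> (forall k, `|a k| <= C / k`!%:R) ->
  \sum_(0 <= k < N) `|bessel_coeff a xi k| <= C * expR (2 * expR (xi / 2)).
Proof.
move=> C0 ha; apply: (@le_trans _ _ (\sum_(0 <= k < N) C * (expR (xi / 2) ^+ k / k`!%:R) ^+ 2)).
  apply: ler_sum => k _; rewrite /bessel_coeff !normrM normfV.
  rewrite normrX normrN1 expr1n mul1r (ger0_norm (expR_ge0 _)) (ger0_norm (ler0n _ _)).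
  rewrite half_sqr expr_div_n.
  have f0 : 0 < k`!%:R :> R by rewrite ltr0n fact_gt0.
  have -> : C * ((expR (xi / 2) ^+ k) ^+ 2 / k`!%:R ^+ 2) = (expR (xi / 2) ^+ k) ^+ 2 / k`!%:R * (C / k`!%:R).
    by field; rewrite gt_eqF.
  by rewrite ler_wpM2l ?ha// divr_ge0// sqr_ge0.
by rewrite -mulr_sumr ler_wpM2l// sum_expR_sqr_le// expR_ge0.
Qed.

Lemma bessel_cvg (a : nat -> R) (C : R) (xi : R) : 0 <= C -> (forall k, `|a k| <= C / k`!%:R) ->
  series (bessel_coeff a xi) @ \oo --> bessel_lim a xi.
Proof.
move=> C0 ha; apply: normed_cvg; apply: nondecreasing_is_cvgn.
  by apply: nondecreasing_series => k *; exact: normr_ge0.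
exists (C * expR (2 * expR (xi / 2))) => _ [n _ <-]; exact: bessel_coeff_sum.
Qed.

Lemma series_bessel_le (a : nat -> R) (C : R) (xi : R) N : 0 <= C -> (forall k, `|a k| <= C / k`!%:R) ->
  `|series (bessel_coeff a xi) N| <= C * expR (2 * expR (xi / 2)).
Proof.
by move=> C0 ha; rewrite (le_trans (ler_norm_sum _ _ _))// bessel_coeff_sum.
Qed.

Lemma bessel_lim_le (a : nat -> R) (C : R) (xi : R) : 0 <= C -> (forall k, `|a k| <= C / k`!%:R) ->
  `|bessel_lim a xi| <= C * expR (2 * expR (xi / 2)).
Proof.
move=> C0 ha; have h := @bessel_cvg a C xi C0 ha.
rewrite -(cvg_lim _ (cvg_norm h))//; apply: limr_le; first by apply/cvg_ex; eexists; exact: cvg_norm h.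
by apply: nearW => N; exact: series_bessel_le.
Qed.

Lemma measurable_series_bessel (a : nat -> R) N : measurable_fun setT (fun xi => series (bessel_coeff a xi) N).
Proof.
rewrite /series/=; apply: measurable_sum => k; rewrite /bessel_coeff; meas.
Qed.

Lemma measurable_bessel_lim (a : nat -> R) (C : R) : 0 <= C -> (forall k, `|a k| <= C / k`!%:R) ->
  measurable_fun setT (bessel_lim a).
Proof.
move=> C0 ha; apply: (measurable_fun_cvg (measurable_series_bessel a)) => xi _; exact: (@bessel_cvg a C xi C0 ha).
Qed.

Definition besselP := bessel_lim (rgamma_re tau).
Definition besselQ := bessel_lim (rgamma_im tau).

(** Real part of [e^(i tau th) (besselP + i besselQ)]; at [th = xi / 2] it is the real part of
    [J_(i tau)(2 e^(xi/2))]. Leaving [th] free lets the phase follow the integration variable of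
    K. *)
Definition bessel_phase (xi th : R) : R := besselP xi * cos (tau * th) - besselQ xi * sin (tau * th).

Definition bessel_phaseN (N : nat) (xi th : R) : R :=
  series (bessel_coeff (rgamma_re tau) xi) N * cos (tau * th)
  - series (bessel_coeff (rgamma_im tau) xi) N * sin (tau * th).

Let C0 : R := rgamma_bound tau.

Lemma bessel_phaseN_cvg xi th : (fun N => bessel_phaseN N xi th) @ \oo --> bessel_phase xi th.
Proof.
apply: cvgB; apply: cvgMl; apply: bessel_cvg (rgamma_bound_ge0 tau) _ => k.
- exact: rgamma_re_le.
- exact: rgamma_im_le.
Qed.

Lemma bessel_phaseN_le N xi th : `|bessel_phaseN N xi th| <= 2 * C0 * expR (2 * expR (xi / 2)).
Proof.
rewrite (le_trans (ler_normB _ _))// -mulrA mulr_natl mulr2n lerD// normrM.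
- rewrite -[leRHS]mulr1 ler_pM ?cos_max// series_bessel_le ?rgamma_bound_ge0//; exact: rgamma_re_le.
- rewrite -[leRHS]mulr1 ler_pM ?sin_max// series_bessel_le ?rgamma_bound_ge0//; exact: rgamma_im_le.
Qed.

Lemma bessel_phase_le xi th : `|bessel_phase xi th| <= 2 * C0 * expR (2 * expR (xi / 2)).
Proof.
rewrite (le_trans (ler_normB _ _))// -mulrA mulr_natl mulr2n lerD// normrM.
- rewrite -[leRHS]mulr1 ler_pM ?cos_max// bessel_lim_le ?rgamma_bound_ge0//; exact: rgamma_re_le.
- rewrite -[leRHS]mulr1 ler_pM ?sin_max// bessel_lim_le ?rgamma_bound_ge0//; exact: rgamma_im_le.
Qed.

Lemma bessel_phaseNE N xi th :
  bessel_phaseN N xi th = \sum_(0 <= k < N) ((- 1) ^+ k * expR (k%:R * xi) / k`!%:R * rgamma_phase tau k th).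
Proof.
rewrite /bessel_phaseN /series/= !mulr_suml -sumrB; apply: eq_bigr => k _.
by rewrite /bessel_coeff /rgamma_phase; ring.
Qed.

Lemma measurable_besselP : measurable_fun setT besselP.
Proof. exact: measurable_bessel_lim (rgamma_bound_ge0 tau) (rgamma_re_le tau). Qed.

Lemma measurable_besselQ : measurable_fun setT besselQ.
Proof. exact: measurable_bessel_lim (rgamma_bound_ge0 tau) (rgamma_im_le tau). Qed.

(* exp (- z cosh t) with th = xi/2 + t, z = 2 e^(xi/2) *)
Definition bessel_gauss (xi th : R) : R := expR (- (expR th + expR (xi - th))).

Lemma expRN_expR_le (y : R) : expR (- expR y) <= expR (- (2^-1 * y)).
Proof.
rewrite ler_expR lerN2; have := expR_ge1Dx y; have := expR_ge0 y.
by have [y0|y0] := leP 0 y; lra.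
Qed.

(** The larger of the two exponentials in the exponent is [e^(xi/2 + |th - xi/2|)], and
    [e^(-e^y) <= e^(-y/2)]. *)
Lemma bessel_gauss_le (xi th : R) :
  bessel_gauss xi th <= expR (- (4^-1 * xi)) * expR (- (2^-1 * `|th - xi / 2|)).
Proof.
rewrite /bessel_gauss -expRD; set t := th - xi / 2.
have -> : - (4^-1 * xi) + - (2^-1 * `|t|) = - (2^-1 * (xi / 2 + `|t|)) by field.
apply: le_trans (expRN_expR_le _); rewrite ler_expR lerN2.
have := expR_ge0 th; have := expR_ge0 (xi - th).
have [t0|t0] := leP 0 t; rewrite ?(ger0_norm t0) ?(ltr0_norm t0).
  rewrite (_ : xi / 2 + t = th); last by rewrite /t; ring.
  lra.
rewrite (_ : xi / 2 + - t = xi - th); last by rewrite /t; field.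
lra.
Qed.

Lemma expR_half_id (xi th : R) : expR th + expR (xi - th) - 2 * expR (xi / 2) =
  expR (xi / 2) * (expR (th - xi / 2) - 2 + expR (- (th - xi / 2))).
Proof.
rewrite mulrDr mulrBr -!expRD.
rewrite (_ : xi / 2 + (th - xi / 2) = th); last by ring.
by rewrite (_ : xi / 2 + - (th - xi / 2) = xi - th); [ring|field].
Qed.

(** Growth of J against decay of K. With [w = e^(xi/2)] and [t = th - xi/2] the exponents combine to
    [-w (e^t - 2 + e^(-t))], nonpositive and integrable in [t] once [w >= 1]; for [xi <= 0] the
    growth factor is at most [e^2]. *)
Lemma bessel_gauss_le2 (xi th : R) :
  expR (2 * expR (xi / 2)) * bessel_gauss xi th <=
  expR 2 * (1 + expR (- (4^-1 * xi))) * expR (- (2^-1 * `|th - xi / 2|)).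
Proof.
have [x0|x0] := leP xi 0.
  rewrite -mulrA ler_pM ?expR_ge0//.
    by rewrite ler_expR -[leRHS]mulr1 ler_pM2l// expR_le1; lra.
  apply: le_trans (bessel_gauss_le _ _) _.
  by rewrite ler_wpM2r ?expR_ge0// lerDr.
rewrite /bessel_gauss -expRD.
apply: (@le_trans _ _ (expR 2 * expR (- (2^-1 * `|th - xi / 2|)))); last first.
  by rewrite ler_wpM2r ?expR_ge0// ler_peMr ?expR_ge0// lerDl expR_ge0.
have -> : 2 * expR (xi / 2) + - (expR th + expR (xi - th)) =
  - (expR (xi / 2) * (expR (th - xi / 2) - 2 + expR (- (th - xi / 2)))) by rewrite -expR_half_id; ring.
set t := th - xi / 2.
have p0 : 0 <= expR t - 2 + expR (- t) by have := sqr_le_coshB1 t; have := sqr_ge0 t; lra.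
have w1 : 1 <= expR (xi / 2) by rewrite -[leLHS]expR0 ler_expR; lra.
apply: (@le_trans _ _ (expR (2 - expR `|t|))); last first.
  by rewrite expRD ler_wpM2l ?expR_ge0// expRN_expR_le.
rewrite ler_expR.
apply: (@le_trans _ _ (- (expR t - 2 + expR (- t)))); first by rewrite lerN2 ler_peMl.
have := expR_ge0 t; have := expR_ge0 (- t).
by have [t0|t0] := leP 0 t; rewrite ?(ger0_norm t0) ?(ltr0_norm t0); lra.
Qed.

Lemma L1_expR_abs_shift (c : R) : mu.-integrable setT (EFin \o (fun th => expR (- (2^-1 * `|th - c|)))) /\
  \int[mu]_th expR (- (2^-1 * `|th - c|)) = \int[mu]_th expR (- (2^-1 * `|th|)).
Proof.
have h : (0 : R) < 2^-1 by [].
have mf : measurable_fun setT (fun th : R => expR (- (2^-1 * `|th|))) by meas.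
have [e1 e2] := Rintegral_shift (- c) mf.
by split; [apply: e1.1; exact: L1_expR_abs|rewrite [RHS]e2].
Qed.

Lemma measurable_bessel_gauss (xi : R) : measurable_fun setT (bessel_gauss xi).
Proof. by rewrite /bessel_gauss; meas. Qed.

Lemma L1_bessel_gaussM (xi : R) (f : R -> R) (K : R) : measurable_fun setT f -> (forall t, `|f t| <= K) ->
  mu.-integrable setT (EFin \o (fun th => f th * bessel_gauss xi th)).
Proof.
move=> mf fK; have [i1 _] := L1_expR_abs_shift (xi / 2).
have K0 : 0 <= K by apply: le_trans (fK 0).
have i2 := L1Zl (K * expR (- (4^-1 * xi))) measurableT i1.
apply: L1_le i2 _ => //; first by apply: measurable_funM => //; exact: measurable_bessel_gauss.
move=> th _; rewrite normrM (ger0_norm (expR_ge0 _)) -mulrA ler_pM ?expR_ge0//.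
exact: bessel_gauss_le.
Qed.

(** Twice the product of the real part of [J_(i tau)(z)] with [K_(i tau)(z)] at [z = 2 e^(xi/2)], as
    [bessel_prod_phase] shows. *)
Definition bessel_prod (xi : R) : R := \int[mu]_th (bessel_phase xi th * bessel_gauss xi th).

Lemma bessel_integrand_le xi th : `|bessel_phase xi th * bessel_gauss xi th| <=
  2 * C0 * expR 2 * (1 + expR (- (4^-1 * xi))) * expR (- (2^-1 * `|th - xi / 2|)).
Proof.
rewrite normrM (ger0_norm (expR_ge0 _)).
apply: (@le_trans _ _ (2 * C0 * expR (2 * expR (xi / 2)) * bessel_gauss xi th)).
  by rewrite ler_wpM2r ?expR_ge0// bessel_phase_le.
rewrite -2!mulrA -[leRHS]mulrA -[leRHS]mulrA -[leRHS]mulrA.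
rewrite ler_wpM2l ?ler_wpM2l ?rgamma_bound_ge0//.
by have := bessel_gauss_le2 xi th; rewrite -mulrA.
Qed.

Lemma measurable_bessel_phase2 : measurable_fun setT (fun z : R * R => bessel_phase z.1 z.2).
Proof.
have mP := measurable_besselP; have mQ := measurable_besselQ.
rewrite /bessel_phase; apply: measurable_funB; (apply: measurable_funM; last by meas).
- by apply: (measurableT_comp mP); meas.
- by apply: (measurableT_comp mQ); meas.
Qed.

End bessel_series.

(** * The Laplace transform of the product of J and K *)

Section laplace_bessel.
Context (R : realType) (tau : R).
Local Notation mu := (@lebesgue_measure R).
Local Notation C0 := (rgamma_bound tau).

(** Along the line [xi = t + th] the exponents of K and of the Laplace kernel combine to
    [-e^t - e^(v + th)] with [e^v = 1 + p e^t]. Each term of J integrates by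
    [integral_rgamma_phase], and what remains is the exponential series of [-e^(t - v)]. *)
Lemma sheared_bessel_integral (p t : R) : 0 < p ->
  \int[mu]_th (expR (t + th - p * expR (t + th)) * (bessel_phase tau (t + th) th * bessel_gauss (t + th) th)) =
  expR (t - ln (1 + p * expR t) - expR t - expR (t - ln (1 + p * expR t))) * cos (tau * ln (1 + p * expR t)).
Proof.
move=> p0; have zpos : 0 < 1 + p * expR t by rewrite ltr_wpDr// mulr_ge0 ?expR_ge0// ltW.
set v := ln _; have ev : expR v = 1 + p * expR t by rewrite lnK// posrE.
pose wt th := expR (t + th - p * expR (t + th)).
pose fN N th := wt th * (bessel_phaseN tau N (t + th) th * bessel_gauss (t + th) th).
(* Half of [e^th] pays for the growth of J: with [a = e^(t/2)] and [b = e^(th/2)],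
   [2ab <= 2a^2 + b^2 / 2], that is [(2a - b)^2 >= 0]. *)
pose G th := 2 * C0 * expR (t + expR t) * expR (1 * th - 2^-1 * expR (1 * th)).
have iG : mu.-integrable setT (EFin \o G) by apply: L1Zl => //; apply: L1_gexp.
pose fk k th := ((- 1) ^+ k / k`!%:R * expR (k.+1%:R * t - expR t)) *
   (expR (k.+1%:R * th - expR (v + th)) * rgamma_phase tau k th).
have ifk k : mu.-integrable setT (EFin \o fk k).
  apply: L1Zl => //.
  have i1 := L1Zl (2 * C0 / k`!%:R) measurableT (@L1_gexp R k.+1%:R (expR v) 1 (ltr0Sn _ _) (expR_gt0 _) ltr01).
  apply: L1_le i1 _ => //.
    by apply: measurable_funM; [meas|exact: measurable_rgamma_phase].
  move=> th _; rewrite normrM ger0_norm ?expR_ge0// mulrC mul1r -expRD.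
  by rewrite ler_wpM2r ?expR_ge0// rgamma_phase_le.
have fNE N th : fN N th = \sum_(0 <= k < N) fk k th.
  rewrite /fN bessel_phaseNE mulrCA mulr_suml; apply: eq_bigr => k _.
  rewrite /fk /wt /bessel_gauss (_ : t + th - th = t); last by ring.
  rewrite -[k.+1]addn1 natrD.
  have -> : expR ((k%:R + 1%:R) * t - expR t) = expR (k%:R * t) * expR t * expR (- expR t).
    by rewrite -!expRD; congr expR; ring.
  have -> : expR ((k%:R + 1%:R) * th - expR (v + th)) = expR (k%:R * th) * expR th * expR (- expR th) * expR (- (p * expR (t + th))).
    by rewrite -!expRD; congr expR; rewrite expRD ev [expR (t + th)]expRD; ring.
  have -> : expR (t + th - p * expR (t + th)) = expR t * expR th * expR (- (p * expR (t + th))).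
    by rewrite -!expRD; congr expR; ring.
  have -> : expR (- (expR th + expR t)) = expR (- expR th) * expR (- expR t).
    by rewrite -!expRD; congr expR; ring.
  have -> : expR (k%:R * (t + th)) = expR (k%:R * t) * expR (k%:R * th).
    by rewrite -!expRD; congr expR; ring.
  ring.
have mfN N : measurable_fun setT (fN N).
  have -> : fN N = (fun th => \sum_(0 <= k < N) fk k th) by apply/funext => th; rewrite fNE.
  by have [i1 _] := Rintegral_sum N measurableT ifk; exact: L1_measurable i1.
have [|||_ lim] := @Rdominated_cvg _ _ R mu setT fN
   (fun th => wt th * (bessel_phase tau (t + th) th * bessel_gauss (t + th) th)) G measurableT mfN.
- move=> th _; rewrite /fN; apply: cvgMr; apply: cvgMl; exact: bessel_phaseN_cvg.
- exact: iG.
- move=> N th _; rewrite /fN /wt /bessel_gauss normrM ger0_norm ?expR_ge0// normrM (ger0_norm (expR_ge0 (- _))).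
  apply: (@le_trans _ _ (expR (t + th) * (2 * C0 * expR (2 * expR ((t + th) / 2)) * expR (- (expR th + expR (t + th - th)))))).
    apply: ler_pM; [exact: expR_ge0|by rewrite mulr_ge0 ?expR_ge0| |].
      by rewrite ler_expR gerBl mulr_ge0 ?expR_ge0// ltW.
    by rewrite ler_wpM2r ?expR_ge0// bessel_phaseN_le.
  rewrite /G mul1r (_ : expR (t + th) * _ = 2 * C0 * (expR (t + th) *
    (expR (2 * expR ((t + th) / 2)) * expR (- (expR th + expR (t + th - th)))))); last by ring.
  rewrite -[leRHS]mulrA ler_wpM2l ?mulr_ge0 ?rgamma_bound_ge0// -!expRD ler_expR.
  rewrite (_ : t + th - th = t); last by ring.
  have -> : expR ((t + th) / 2) = expR (t / 2) * expR (th / 2) by rewrite -expRD; congr expR; ring.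
  have -> : expR t = expR (t / 2) ^+ 2 by rewrite -expRM_natl; congr expR; field.
  have -> : expR th = expR (th / 2) ^+ 2 by rewrite -expRM_natl; congr expR; field.
  have := sqr_ge0 (2 * expR (t / 2) - expR (th / 2)); set a := expR (t / 2); set b := expR (th / 2).
  by rewrite sqrrB; lra.
apply: (cvg_unique _ lim) => //.
have -> : (fun n => \int[mu]_x fN n x) =
   (fun N => (expR (t - v - expR t) * cos (tau * v)) * series (exp_coeff (- expR (t - v))) N).
  apply/funext => N; transitivity (\int[mu]_x \sum_(0 <= k < N) fk k x).
    by apply: eq_Rintegral => x _; rewrite fNE.
  have [_ ->] := Rintegral_sum N measurableT ifk.
  rewrite /series/= mulr_sumr; apply: eq_bigr => k _.
  rewrite /fk RintegralZl//; last first.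
    have i1 := L1Zl (2 * C0 / k`!%:R) measurableT (@L1_gexp R k.+1%:R (expR v) 1 (ltr0Sn _ _) (expR_gt0 _) ltr01).
    apply: L1_le i1 _ => //.
      by apply: measurable_funM; [meas|exact: measurable_rgamma_phase].
    move=> th _; rewrite normrM ger0_norm ?expR_ge0// mulrC mul1r -expRD.
    by rewrite ler_wpM2r ?expR_ge0// rgamma_phase_le.
  rewrite integral_rgamma_phase /exp_coeff/= (exprNn (expR (t - v))) -expRM_natl.
  have -> : expR (k.+1%:R * t - expR t) = expR (k%:R * (t - v)) * expR (k%:R * v) * expR (t - expR t).
    by rewrite -!expRD; congr expR; rewrite -natr1; ring.
  have -> : expR (- (k.+1%:R * v)) = expR (- (k%:R * v)) * expR (- v).
    by rewrite -!expRD; congr expR; rewrite -natr1; ring.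
  have -> : expR (t - v - expR t) = expR (t - expR t) * expR (- v).
    by rewrite -!expRD; congr expR; ring.
  have := expRxMexpNx_1 (k%:R * v); set a := expR (k%:R * v); set b := expR (- (k%:R * v)) => ab.
  transitivity ((- 1) ^+ k / k`!%:R * expR (k%:R * (t - v)) * expR (t - expR t) * expR (- v) * cos (tau * v) * (a * b)); first by ring.
  by rewrite ab; ring.
rewrite (_ : expR (t - v - expR t - expR (t - v)) * cos (tau * v) =
  expR (t - v - expR t) * cos (tau * v) * expR (- expR (t - v))); last by rewrite [in LHS]expRD; ring.
apply: cvgMr; exact: is_cvg_series_exp_coeff.
Qed.

(** After translation by [ln p] one has [e^v = 1 + e^t], and the exponent becomes [-(e^v - 1)(1 +
    e^(-v)) / p = -(e^v - e^(-v)) / p]. *)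
Lemma integral_sheared_softplus (p : R) : 0 < p ->
  \int[mu]_t (expR (t - ln (1 + p * expR t) - expR t - expR (t - ln (1 + p * expR t))) * cos (tau * ln (1 + p * expR t))) =
  \int[mu]_(v in `]0, +oo[) (p^-1 * (expR (- ((expR v - expR (- v)) / p)) * cos (tau * v))).
Proof.
move=> p0.
pose V t := ln (1 + p * expR t).
have zpos t : 0 < 1 + p * expR t by rewrite ltr_wpDr// mulr_ge0 ?expR_ge0// ltW.
have eV t : expR (V t) = 1 + p * expR t by rewrite lnK// posrE.
have mV : measurable_fun setT (fun t : R => expR (t - V t - expR t - expR (t - V t)) * cos (tau * V t)).
  by rewrite /V; meas.
have [_ ->] := Rintegral_shift (- ln p) mV.
pose H v := p^-1 * (expR (- ((expR v - expR (- v)) / p)) * cos (tau * v)).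
have mH : measurable_fun setT H by rewrite /H; meas.
rewrite -(Rintegral_softplus mH); apply: eq_Rintegral => t _.
have ep : expR (t + - ln p) = expR t / p by rewrite expRD expRN lnK ?posrE.
have EV : V (t + - ln p) = ln (1 + expR t) by rewrite /V ep mulrCA mulfV ?mulr1// gt_eqF.
have z1 : 0 < 1 + expR t by rewrite addr_gt0// expR_gt0.
rewrite EV /H; set v := ln (1 + expR t); have ev : expR v = 1 + expR t by rewrite lnK// posrE.
have eNv : expR (- v) = (1 + expR t)^-1 by rewrite expRN ev.
have -> : t + - ln p - v - expR (t + - ln p) - expR (t + - ln p - v) =
    (t + - ln p) + (- v) + (- ((expR v - expR (- v)) / p)).
  rewrite [expR (t + - ln p - v)]expRD ep eNv ev; field.
  by rewrite !gt_eqF.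
by rewrite 2!expRD ep eNv; field; rewrite !gt_eqF.
Qed.

Lemma laplace_bessel_prod (p : R) : 0 < p ->
  mu.-integrable setT (EFin \o (fun xi => expR (xi - p * expR xi) * bessel_prod tau xi)) /\
  \int[mu]_xi (expR (xi - p * expR xi) * bessel_prod tau xi) =
  \int[mu]_(v in `]0, +oo[) (p^-1 * (expR (- ((expR v - expR (- v)) / p)) * cos (tau * v))).
Proof.
move=> p0.
pose Phi xi th := expR (xi - p * expR xi) * (bessel_phase tau xi th * bessel_gauss xi th).
have mPhi : measurable_fun setT (fun z : R * R => Phi z.1 z.2).
  rewrite /Phi; apply: measurable_funM; first by meas.
  by apply: measurable_funM; [exact: measurable_bessel_phase2|rewrite /bessel_gauss; meas].
pose gx xi := expR (xi - p * expR xi) * (1 + expR (- (4^-1 * xi))).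
have igx : mu.-integrable setT (EFin \o gx).
  have i1 := @L1_gexp R 1 p 1 ltr01 p0 ltr01.
  have h34 : 0 < 3 / 4 :> R by lra.
  have i2 := @L1_gexp R (3 / 4) p 1 h34 p0 ltr01.
  have := L1D measurableT i1 i2; congr (_.-integrable _ _); apply/funext => t /=; congr EFin.
  by rewrite /gx mulrDr mulr1 !mul1r -expRD; congr (_ + expR _); field.
have gx0 xi : 0 <= gx xi by rewrite mulr_ge0 ?addr_ge0 ?expR_ge0.
pose K := 2 * C0 * expR 2.
have K0 : 0 <= K by rewrite !mulr_ge0 ?expR_ge0 ?rgamma_bound_ge0.
have Phi_le xi th : `|Phi xi th| <= K * gx xi * expR (- (2^-1 * `|th - xi / 2|)).
  rewrite /Phi normrM ger0_norm ?expR_ge0// /gx mulrCA -mulrA -mulrA ler_wpM2l ?expR_ge0//.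
  by have := bessel_integrand_le tau xi th; rewrite mulrA -/K.

have ih xi : mu.-integrable setT (EFin \o (fun th => K * gx xi * expR (- (2^-1 * `|th - xi / 2|)))).
  by have [i1 e1] := L1_expR_abs_shift (xi / 2); apply: L1Zl.
have eh xi : \int[mu]_th (K * gx xi * expR (- (2^-1 * `|th - xi / 2|))) =
    (K * \int[mu]_th expR (- (2^-1 * `|th|))) * gx xi.
  have [i1 e1] := L1_expR_abs_shift (xi / 2).
  by rewrite RintegralZl// e1; ring.
have igx' := L1Zl (K * \int[mu]_th expR (- (2^-1 * `|th|))) measurableT igx.
have m1 xi : measurable_fun setT (Phi xi) by exact: (measurable_fun_pair2 xi mPhi).
have m2 th : measurable_fun setT (Phi ^~ th) by exact: (measurable_fun_pair1 th mPhi).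
have mabs : measurable_fun setT (fun z : R * R => `|Phi z.1 z.2|).
  exact (measurableT_comp (@normr_measurable R setT) mPhi).
have [||||||j1 _ e12] := @RFubini_dom _ _ _ _ R mu mu setT setT Phi
    (fun xi th => K * gx xi * expR (- (2^-1 * `|th - xi / 2|)))
    (fun xi => K * \int[mu]_th expR (- (2^-1 * `|th|)) * gx xi) measurableT measurableT.
- by rewrite setXTT.
- move=> xi _; exact (m1 xi).
- move=> xi _; exact (ih xi).
- move=> xi th _ _; exact (Phi_le xi th).
- by move=> xi _; rewrite eh.
- exact igx'.
(* Fubini for the absolute value: it supplies the integrable majorant in [th] that the second
   exchange, in sheared coordinates, requires. *)
have [||||||_ jabs _] := @RFubini_dom _ _ _ _ R mu mu setT setT (fun xi th => `|Phi xi th|)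
    (fun xi th => K * gx xi * expR (- (2^-1 * `|th - xi / 2|)))
    (fun xi => K * \int[mu]_th expR (- (2^-1 * `|th|)) * gx xi) measurableT measurableT.
- by rewrite setXTT.
- move=> xi _; exact (measurableT_comp (@normr_measurable R setT) (m1 xi)).
- move=> xi _; exact (ih xi).
- by move=> xi th _ _; rewrite normr_id; exact: Phi_le.
- by move=> xi _; rewrite eh.
- exact igx'.
have iPG xi : mu.-integrable setT (EFin \o (fun th => bessel_phase tau xi th * bessel_gauss xi th)).
  have mph : measurable_fun setT (bessel_phase tau xi) by rewrite /bessel_phase; meas.
  exact (L1_bessel_gaussM xi mph (fun t => bessel_phase_le tau xi t)).
have iE xi : \int[mu]_th Phi xi th = expR (xi - p * expR xi) * bessel_prod tau xi.
  exact (RintegralZl _ measurableT (iPG xi)).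
have iExt : (fun xi => \int[mu]_th Phi xi th) = (fun xi => expR (xi - p * expR xi) * bessel_prod tau xi).
  by apply/funext => xi; rewrite iE.
split; first by rewrite -iExt.
rewrite -iExt e12.
(* The shear [xi = t + th] is a translation of the inner variable for each fixed [th]; it sits
   between two exchanges of the order of integration. *)
pose Psi th t := Phi (t + th) th.
have mPsi : measurable_fun setT (fun z : R * R => Psi z.1 z.2).
  have mg : measurable_fun setT (fun z : R * R => (z.2 + z.1, z.1)).
    by apply: measurable_fun_pair; meas.
  exact: (measurableT_comp mPhi mg).
have iabs th : mu.-integrable setT (EFin \o (fun xi => `|Phi xi th|)).
  have mm : measurable_fun setT (fun xi => `|Phi xi th|).
    exact (measurableT_comp (@normr_measurable R setT) (m2 th)).
  refine (@L1_le _ _ R mu setT _ _ measurableT mm (L1Zl K measurableT igx) _).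
  move=> xi _; rewrite normr_id; apply: le_trans (Phi_le xi th) _.
  apply: ler_piMr; first exact (mulr_ge0 K0 (gx0 xi)).
  rewrite expR_le1 oppr_le0; apply: mulr_ge0; last exact: normr_ge0.
  by rewrite invr_ge0 ler0n.
have mT : measurable_fun (setT `*` setT) (fun z : R * R => Psi z.1 z.2) by rewrite setXTT.
have mPth th : measurable_fun setT (Psi th) by exact (measurable_fun_pair2 th mPsi).
have iPth th : mu.-integrable setT (EFin \o (fun t => `|Phi (t + th) th|)).
  have [e _] := Rintegral_shift th (L1_measurable (iabs th)); exact (e.1 (iabs th)).
have ePth th : \int[mu]_t `|Phi (t + th) th| <= \int[mu]_xi `|Phi xi th|.
  have [_ e] := Rintegral_shift th (L1_measurable (iabs th)); by rewrite e lexx.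
have [_ _ e34] := @RFubini_dom _ _ _ _ R mu mu setT setT Psi
    (fun th t => `|Phi (t + th) th|) _ measurableT measurableT mT (fun th _ => mPth th)
    (fun th _ => iPth th) (fun th t _ _ => lexx _) (fun th _ => ePth th) jabs.
transitivity (\int[mu]_th \int[mu]_t Psi th t).
  by apply: eq_Rintegral => th _; have [_ ->] := Rintegral_shift th (m2 th).
rewrite e34 -(integral_sheared_softplus p0).
apply: eq_Rintegral => t _; exact (sheared_bessel_integral t p0).
Qed.

End laplace_bessel.

(** * Continuation of Laplace transforms *)

Section laplace_moments.
Context d (T : measurableType d) (R : realType) (m : {measure set T -> \bar R}).
Variables (D : set T) (g X : T -> R).
Hypotheses (mD : measurable D) (mg : measurable_fun D g) (mX : measurable_fun D X).
Hypothesis X_ge0 : forall z, D z -> 0 <= X z.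
Hypothesis L1g : forall e : R, 0 < e -> m.-integrable D (EFin \o (fun z => g z * expR (- (e * X z)))).

(** Up to the sign [(-1)^k], the k-th derivative of the Laplace transform of [g] in the variable
    [X]. *)
Definition laplace_moment (k : nat) (la : R) : R :=
  \int[m]_(z in D) (g z * X z ^+ k * expR (- (la * X z))).

Lemma expR_ge_monomial (y : R) k : 0 <= y -> y ^+ k <= k`!%:R * expR y.
Proof.
move=> y0; have f0 : 0 < k`!%:R :> R by rewrite ltr0n fact_gt0.
rewrite mulrC -ler_pdivrMr//; case: k f0 => [|k] f0.
  by rewrite expr0 fact0 divr1 -[leLHS]expR0 ler_expR.
by apply: le_trans (expR_ge1Dxn k y0); rewrite lerDr.
Qed.

Lemma monomial_expRN_le (a x : R) k : 0 < a -> 0 <= x -> x ^+ k * expR (- (a * x)) <= k`!%:R / a ^+ k.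
Proof.
move=> a0 x0; rewrite ler_pdivlMr ?exprn_gt0// mulrAC -exprMn (mulrC x).
rewrite expRN ler_pdivrMr ?expR_gt0//; apply: expR_ge_monomial.
by rewrite mulr_ge0// ltW.
Qed.

Lemma L1_laplace_moment k la : 0 < la ->
  m.-integrable D (EFin \o (fun z => g z * X z ^+ k * expR (- (la * X z)))).
Proof.
move=> la0; have e0 : 0 < la / 2 by rewrite divr_gt0.
have i1 := L1Zl (k`!%:R / (la / 2) ^+ k) mD (L1_norm mD (L1g e0)).
apply: L1_le i1 _ => //; first by meas.
move=> z Dz; rewrite !normrM (ger0_norm (expR_ge0 _)) (ger0_norm (expR_ge0 _)) normrX (ger0_norm (X_ge0 Dz)).
have -> : - (la * X z) = - (la / 2 * X z) + - (la / 2 * X z) by field.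
rewrite expRD.
have -> : `|g z| * X z ^+ k * (expR (- (la / 2 * X z)) * expR (- (la / 2 * X z))) =
  X z ^+ k * expR (- (la / 2 * X z)) * (`|g z| * expR (- (la / 2 * X z))) by ring.
by rewrite ler_wpM2r ?mulr_ge0 ?expR_ge0// monomial_expRN_le// X_ge0.
Qed.

Let diffE (k : nat) (la : R) (j : nat) z :
  j.+1%:R * (g z * X z ^+ k * expR (- (la * X z)) - g z * X z ^+ k * expR (- ((la + j.+1%:R^-1) * X z))) =
     g z * X z ^+ k * expR (- (la * X z)) * (j.+1%:R * (1 - expR (- (j.+1%:R^-1 * X z)))).
Proof. by rewrite (mulrDl la) opprD expRD; ring. Qed.

Lemma difference_quotient_bounds (x : R) (j : nat) : 0 <= x ->
  x - j.+1%:R^-1 * x ^+ 2 <= j.+1%:R * (1 - expR (- (j.+1%:R^-1 * x))) <= x.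
Proof.
move=> x0; have j0 : 0 < j.+1%:R :> R by [].
set y := j.+1%:R^-1 * x; have y0 : 0 <= y by rewrite mulr_ge0// invr_ge0.
have yE : x = j.+1%:R * y by rewrite /y mulrA mulfV ?mul1r// gt_eqF.
have -> : x - j.+1%:R^-1 * x ^+ 2 = j.+1%:R * (y - y ^+ 2) by rewrite yE; field; rewrite gt_eqF.
apply/andP; split; last first.
  by rewrite [leRHS]yE ler_pM2l//; have := expR_ge1Dx (- y); lra.
rewrite ler_pM2l//.
have h2 : 0 < 1 + y by rewrite ltr_wpDr.
have h1 : expR (- y) <= (1 + y)^-1.
  by rewrite expRN lef_pV2 ?posrE ?expR_gt0// expR_ge1Dx.
apply: (@le_trans _ _ (1 - (1 + y)^-1)); last by rewrite lerD2l lerN2.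
rewrite -(ler_pM2r h2) [leRHS]mulrBl mulVf ?gt_eqF// mul1r.
have : 0 <= y ^+ 3 by rewrite exprn_ge0.
by rewrite exprS expr2; nra.
Qed.

(** The next moment is a limit of difference quotients taken to the right of [la], so it is
    determined by the values of the present one there. Domination comes from [1 - e^(-y) <= y]. *)
Lemma cvg_laplace_moment_diff k la : 0 < la ->
  (fun j : nat => j.+1%:R * (laplace_moment k la - laplace_moment k (la + j.+1%:R^-1))) @ \oo -->
  laplace_moment k.+1 la.
Proof.
move=> la0.
have i0 := L1_laplace_moment k la0.
have i1 j : m.-integrable D (EFin \o (fun z => g z * X z ^+ k * expR (- ((la + j.+1%:R^-1) * X z)))).
  by apply: L1_laplace_moment; rewrite addr_gt0// invr_gt0.
have iB j := L1B mD i0 (i1 j).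
have [|||_ lim] := @Rdominated_cvg _ _ R m D
  (fun j z => j.+1%:R * (g z * X z ^+ k * expR (- (la * X z)) - g z * X z ^+ k * expR (- ((la + j.+1%:R^-1) * X z))))
  (fun z => g z * X z ^+ k.+1 * expR (- (la * X z)))
  (fun z => `|g z * X z ^+ k.+1 * expR (- (la * X z))|) mD (fun j => L1_measurable (L1Zl j.+1%:R mD (iB j))).
- move=> z Dz.
  under eq_fun do rewrite diffE.
  rewrite exprSr mulrA mulrAC; apply: cvgMr.
  apply: (@squeeze_cvgr _ _ _ _ (fun j : nat => X z - j.+1%:R^-1 * X z ^+ 2) (cst (X z))).
  + by apply: nearW => j; apply: difference_quotient_bounds; exact: X_ge0.
  + rewrite -[X in _ --> X]subr0 -[X in _ --> _ - X](mul0r (X z ^+ 2)).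
    by apply: cvgB; [exact: cvg_cst|apply: cvgMl; exact: cvg_harmonic].
  + exact: cvg_cst.
- exact: (L1_norm mD (L1_laplace_moment k.+1 la0)).
- move=> j z Dz /=.
  have -> : g z * X z ^+ k.+1 * expR (- (la * X z)) = g z * X z ^+ k * expR (- (la * X z)) * X z by rewrite exprSr; ring.
  rewrite diffE normrM [leRHS]normrM ler_wpM2l// (ger0_norm (X_ge0 Dz)).
  have /andP[_ h] := difference_quotient_bounds j (X_ge0 Dz).
  rewrite ger0_norm//; apply: mulr_ge0; first exact: ler0n.
  by rewrite subr_ge0 expR_le1 oppr_le0 mulr_ge0 ?X_ge0// invr_ge0.
rewrite (_ : (fun j : nat => _) = (fun j => \int[m]_(z in D) (j.+1%:R * (g z * X z ^+ k * expR (- (la * X z)) -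
     g z * X z ^+ k * expR (- ((la + j.+1%:R^-1) * X z)))))); first exact: lim.
by apply/funext => j; rewrite RintegralZl// RintegralB.
Qed.

(** Since [|c k| <= 1/k!], the partial sums of [phi (b X)] are at most [e^(|b| X)]; the factor
    [e^(-la X)] absorbs this precisely when [|b| < la]. *)
Lemma cvg_laplace_moment_series (c : nat -> R) (phi : R -> R) (b la : R) :
  (forall k, `|c k| <= k`!%:R^-1) -> (forall y, series (fun k => c k * y ^+ k) @ \oo --> phi y) ->
  `|b| < la ->
  (fun N => \sum_(0 <= k < N) c k * b ^+ k * laplace_moment k la) @ \oo -->
  \int[m]_(z in D) (g z * phi (b * X z) * expR (- (la * X z))).
Proof.
move=> hc hphi bla; have la0 : 0 < la by apply: le_lt_trans bla.
have e0 : 0 < la - `|b| by rewrite subr_gt0.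
have ik k : m.-integrable D (EFin \o (fun z => c k * b ^+ k * (g z * X z ^+ k * expR (- (la * X z))))).
  by apply: L1Zl => //; exact: L1_laplace_moment.
have [|||_ lim] := @Rdominated_cvg _ _ R m D
  (fun N z => \sum_(0 <= k < N) (c k * b ^+ k * (g z * X z ^+ k * expR (- (la * X z)))))
  (fun z => g z * phi (b * X z) * expR (- (la * X z)))
  (fun z => `|g z * expR (- ((la - `|b|) * X z))|) mD (fun N => L1_measurable (Rintegral_sum N mD ik).1).
- move=> z Dz.
  have E N : \sum_(0 <= k < N) (c k * b ^+ k * (g z * X z ^+ k * expR (- (la * X z)))) =
     g z * series (fun k => c k * (b * X z) ^+ k) N * expR (- (la * X z)).
    rewrite /series/= mulr_sumr mulr_suml; apply: eq_bigr => k _.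
    by rewrite exprMn; ring.
  by under eq_fun do rewrite E; apply: cvgMl; apply: cvgMr; exact: hphi.
- exact: (L1_norm mD (L1g e0)).
- move=> N z Dz; rewrite (le_trans (ler_norm_sum _ _ _))// normrM (ger0_norm (expR_ge0 _)).
  apply: (@le_trans _ _ (\sum_(0 <= k < N) `|g z| * expR (- (la * X z)) * exp_coeff (`|b| * X z) k)).
    apply: ler_sum => k _; rewrite !normrM (ger0_norm (expR_ge0 _)) !normrX (ger0_norm (X_ge0 Dz)).
    rewrite /exp_coeff/= exprMn.
    rewrite (_ : `|g z| * expR (- (la * X z)) * (`|b| ^+ k * X z ^+ k / k`!%:R) =
       k`!%:R^-1 * (`|b| ^+ k * (`|g z| * X z ^+ k * expR (- (la * X z))))); last by ring.
    rewrite -mulrA; apply: ler_wpM2r (hc k).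
    by rewrite !mulr_ge0 ?exprn_ge0 ?X_ge0 ?expR_ge0.
  rewrite -mulr_sumr -mulrA ler_wpM2l//.
  have -> : - ((la - `|b|) * X z) = - (la * X z) + `|b| * X z by ring.
  rewrite expRD ler_wpM2l ?expR_ge0//.
  apply: (@nondecreasing_cvgn_le _ (series (exp_coeff (`|b| * X z)))).
    by apply: nondecreasing_series => k *; rewrite exp_coeffE mulr_ge0 ?invr_ge0 ?exprn_ge0 ?mulr_ge0 ?X_ge0.
  exact: is_cvg_series_exp_coeff.
rewrite (_ : (fun N => _) = (fun N => \int[m]_(z in D) \sum_(0 <= k < N) (c k * b ^+ k * (g z * X z ^+ k * expR (- (la * X z)))))); first exact: lim.
apply/funext => N; rewrite (Rintegral_sum N mD ik).2; apply: eq_bigr => k _.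
by rewrite RintegralZl//; exact: L1_laplace_moment.
Qed.

End laplace_moments.

Section laplace_unique.
Context d1 d2 (T1 : measurableType d1) (T2 : measurableType d2) (R : realType).
Variables (m1 : {measure set T1 -> \bar R}) (m2 : {measure set T2 -> \bar R}).
Variables (D1 : set T1) (D2 : set T2) (X1 : T1 -> R) (X2 : T2 -> R).
Hypotheses (mD1 : measurable D1) (mD2 : measurable D2).
Hypotheses (mX1 : measurable_fun D1 X1) (mX2 : measurable_fun D2 X2).
Hypotheses (X1_ge0 : forall z, D1 z -> 0 <= X1 z) (X2_ge0 : forall z, D2 z -> 0 <= X2 z).

(* A Laplace transform on a real half-line determines it on the sector
   |arg| < pi/4: compare Taylor coefficients. *)
Lemma laplace_continuation (g1 : T1 -> R) (g2 : T2 -> R) (la0 : R) (c : nat -> R) (phi : R -> R) :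
  measurable_fun D1 g1 -> measurable_fun D2 g2 ->
  (forall e : R, 0 < e -> m1.-integrable D1 (EFin \o (fun z => g1 z * expR (- (e * X1 z))))) ->
  (forall e : R, 0 < e -> m2.-integrable D2 (EFin \o (fun z => g2 z * expR (- (e * X2 z))))) ->
  0 <= la0 ->
  (forall la, la0 < la -> \int[m1]_(z in D1) (g1 z * expR (- (la * X1 z))) =
                          \int[m2]_(z in D2) (g2 z * expR (- (la * X2 z)))) ->
  (forall k, `|c k| <= k`!%:R^-1) -> (forall y, series (fun k => c k * y ^+ k) @ \oo --> phi y) ->
  forall la b, la0 < la -> `|b| < la ->
  \int[m1]_(z in D1) (g1 z * phi (b * X1 z) * expR (- (la * X1 z))) =
  \int[m2]_(z in D2) (g2 z * phi (b * X2 z) * expR (- (la * X2 z))).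
Proof.
move=> mg1 mg2 L1 L2 la00 e0 hc hphi.
have mom k : forall la, la0 < la -> laplace_moment m1 D1 g1 X1 k la = laplace_moment m2 D2 g2 X2 k la.
  elim: k => [|k IH] la hla.
    rewrite /laplace_moment; under eq_Rintegral do rewrite expr0 mulr1.
    by under [RHS]eq_Rintegral do rewrite expr0 mulr1; exact: e0.
  have la_gt0 : 0 < la by apply: le_lt_trans hla.
  have c1 := cvg_laplace_moment_diff mD1 mg1 mX1 X1_ge0 L1 (k := k) la_gt0.
  have c2 := cvg_laplace_moment_diff mD2 mg2 mX2 X2_ge0 L2 (k := k) la_gt0.
  apply: (cvg_unique _ c1) => //.
  rewrite (_ : (fun j : nat => _) = (fun j : nat =>
     j.+1%:R * (laplace_moment m2 D2 g2 X2 k la - laplace_moment m2 D2 g2 X2 k (la + j.+1%:R^-1)))) //.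
  by apply/funext => j; rewrite !IH// (lt_trans hla)// ltrDl invr_gt0.
move=> la b hla hb.
have c1 := cvg_laplace_moment_series mD1 mg1 mX1 X1_ge0 L1 hc hphi hb.
have c2 := cvg_laplace_moment_series mD2 mg2 mX2 X2_ge0 L2 hc hphi hb.
apply: (cvg_unique _ c1) => //.
rewrite (_ : (fun N : nat => _) = (fun N : nat =>
   \sum_(0 <= k < N) c k * b ^+ k * laplace_moment m2 D2 g2 X2 k la)) //.
by apply/funext => N; apply: eq_bigr => k _; rewrite mom.
Qed.

Let L1_cos d (T : measurableType d) (m : {measure set T -> \bar R}) (D : set T) (g X : T -> R) (b : R) : measurable D ->
    measurable_fun D g -> measurable_fun D X ->
    (forall e : R, 0 < e -> m.-integrable D (EFin \o (fun z => g z * expR (- (e * X z))))) ->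
    (forall e : R, 0 < e -> m.-integrable D (EFin \o (fun z => g z * cos (b * X z) * expR (- (e * X z))))).
Proof.
move=> mD mg mX L e e_gt0; apply: L1_le (L1_norm mD (L e e_gt0)) _ => //; first by meas.
by move=> z _; rewrite mulrAC normrM ler_piMr// cos_max.
Qed.

Let double_sin d (T : measurableType d) (m : {measure set T -> \bar R}) (D : set T) (g X : T -> R) (p : R) : 0 < p ->
   measurable D -> measurable_fun D g -> measurable_fun D X ->
    (forall e : R, 0 < e -> m.-integrable D (EFin \o (fun z => g z * expR (- (e * X z))))) ->
   \int[m]_(z in D) (g z * (expR (- (p * X z)) * sin (p * X z))) =
   2 * \int[m]_(z in D) (g z * cos (p / 2 * X z) * sin (p / 2 * X z) * expR (- (p * X z))).
Proof.
move=> p0 mD mg mX L; rewrite -RintegralZl//.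
  apply: eq_Rintegral => z _.
  have -> : sin (p * X z) = sin ((p / 2 * X z) *+ 2) by congr sin; rewrite mulr2n; field.
  by rewrite sin_mulr2n; ring.
apply: L1_le (L1_norm mD (L p p0)) _ => //; first by meas.
move=> z _; rewrite (_ : g z * cos (p / 2 * X z) * sin (p / 2 * X z) * expR (- (p * X z)) =
   g z * expR (- (p * X z)) * (cos (p / 2 * X z) * sin (p / 2 * X z))); last by ring.
by rewrite normrM ler_piMr// normrM mulr_ile1// ?cos_max// sin_max.
Qed.

(* Two continuation steps reach the ray arg = pi/4. *)
Lemma laplace_continuation_diag (g1 : T1 -> R) (g2 : T2 -> R) :
  measurable_fun D1 g1 -> measurable_fun D2 g2 ->
  (forall e : R, 0 < e -> m1.-integrable D1 (EFin \o (fun z => g1 z * expR (- (e * X1 z))))) ->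
  (forall e : R, 0 < e -> m2.-integrable D2 (EFin \o (fun z => g2 z * expR (- (e * X2 z))))) ->
  (forall la, 0 < la -> \int[m1]_(z in D1) (g1 z * expR (- (la * X1 z))) =
                        \int[m2]_(z in D2) (g2 z * expR (- (la * X2 z)))) ->
  forall p, 0 < p ->
  \int[m1]_(z in D1) (g1 z * (expR (- (p * X1 z)) * sin (p * X1 z))) =
  \int[m2]_(z in D2) (g2 z * (expR (- (p * X2 z)) * sin (p * X2 z))).
Proof.
move=> mg1 mg2 L1 L2 e0 p p0.
pose cc n : R := (~~ odd n)%:R * (- 1) ^+ n./2 * (n`!%:R)^-1.
pose cs n : R := (odd n)%:R * (- 1) ^+ n.-1./2 * (n`!%:R)^-1.
have bnd (b : bool) j n : `|b%:R * (- 1) ^+ j * (n`!%:R)^-1| <= n`!%:R^-1 :> R.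
  rewrite !normrM normrX normrN1 expr1n mulr1 normfV !ger0_norm//.
  by rewrite ler_piMl ?invr_ge0//; case: b.
have hcc y : series (fun k => cc k * y ^+ k) @ \oo --> cos y.
  by have := @is_cvg_series_cos_coeff R y; rewrite cosE cos_coeffE.
have hcs y : series (fun k => cs k * y ^+ k) @ \oo --> sin y.
  by have := @is_cvg_series_sin_coeff R y; rewrite sinE sin_coeffE.
(* One step at [b = la = p] would violate [|b| < la]. Instead the cosine of [p X / 2] is inserted
   for all [la > p/2], then the sine of [p X / 2] at [la = p], and twice their product is
   [sin (p X)]. The first step explains the threshold [la0] in [laplace_continuation]. *)
pose b := p / 2; have b0 : 0 < b by rewrite divr_gt0.
have step1 la : b < la -> \int[m1]_(z in D1) (g1 z * cos (b * X1 z) * expR (- (la * X1 z))) =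
    \int[m2]_(z in D2) (g2 z * cos (b * X2 z) * expR (- (la * X2 z))).
  move=> bla; apply: (laplace_continuation mg1 mg2 L1 L2 (lexx 0) e0 (fun k => bnd _ _ _) hcc).
    exact: lt_trans bla.
  by rewrite gtr0_norm.
have mc1 : measurable_fun D1 (fun z => g1 z * cos (b * X1 z)) by meas.
have mc2 : measurable_fun D2 (fun z => g2 z * cos (b * X2 z)) by meas.
have step2 := @laplace_continuation _ _ _ _ _ mc1 mc2 (L1_cos b mD1 mg1 mX1 L1)
  (L1_cos b mD2 mg2 mX2 L2) (ltW b0) step1 (fun k => bnd _ _ _) hcs p b.
rewrite (double_sin p0 mD1 mg1 mX1 L1) (double_sin p0 mD2 mg2 mX2 L2) -/b step2//.
- by rewrite /b; lra.
- by rewrite gtr0_norm// /b; lra.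
Qed.

End laplace_unique.

(** * The index integral *)

Section macdonald.
Context (R : realType).
Local Notation mu := (@lebesgue_measure R).

(* z cosh q for z = 2 e^(xi/2) *)
Definition macX (xi q : R) : R := expR (xi / 2 + q) + expR (xi / 2 - q).

Lemma macX_gt0 xi q : 0 < macX xi q. Proof. by rewrite addr_gt0// expR_gt0. Qed.

Lemma measurable_macX2 : measurable_fun setT (fun z : R * R => macX z.1 z.2).
Proof. by rewrite /macX; meas. Qed.

Lemma measurable_macX xi : measurable_fun setT (macX xi).
Proof. by rewrite /macX; meas. Qed.

(** Equal to [(la / 2)^(-1/2)] for positive [la]. *)
Definition mac_const (la : R) : R := expR (- (2^-1 * ln (la / 2))).

(** The dominant exponential [la e^(xi/2 + |q|)] is split in halves: one keeps the double
    exponential decay in [xi], the other gives decay in [q] through [e^(-e^y) <= e^(-y/2)]. *)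
Lemma expR_macX_le (la xi q : R) : 0 < la -> 
  expR (- (la * macX xi `|q|)) <=
  mac_const la * expR (- (4^-1 * xi) - la / 2 * expR (2^-1 * xi)) * expR (- (2^-1 * `|q|)).
Proof.
move=> la0; have l2 : 0 < la / 2 by rewrite divr_gt0.
apply: (@le_trans _ _ (expR (- (la / 2 * expR (2^-1 * xi))) * expR (- expR (ln (la / 2) + (2^-1 * xi + `|q|))))).
  rewrite -expRD ler_expR (expRD (ln _)) lnK ?posrE// /macX mulrDr opprD.
  have h1 : expR (2^-1 * xi) <= expR (2^-1 * xi + `|q|) by rewrite ler_expR lerDl.
  have h2 := expR_ge0 (xi / 2 - `|q|).
  rewrite (_ : xi / 2 = 2^-1 * xi) in h2 *; last by rewrite mulrC.
  have h3 := ler_wpM2l (ltW l2) h1; have h4 := mulr_ge0 (ltW la0) h2.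
  by move: h3 h4; set a := expR _; set b := expR _; set c := expR _; nra.
apply: (@le_trans _ _ (expR (- (la / 2 * expR (2^-1 * xi))) * expR (- (2^-1 * (ln (la / 2) + (2^-1 * xi + `|q|)))))).
  by rewrite ler_wpM2l ?expR_ge0// expRN_expR_le.
by rewrite /mac_const -!expRD ler_expR le_eqVlt; apply/orP; left; apply/eqP; field.
Qed.

Lemma macXN xi q : macX xi (- q) = macX xi q.
Proof. by rewrite /macX opprK addrC. Qed.

Lemma L1_expR_macX (la xi : R) : 0 < la ->
  mu.-integrable setT (EFin \o (fun q => expR (- (la * macX xi q)))).
Proof.
move=> la0; have h : 0 < 2^-1 :> R by [].
have i1 := L1Zl (mac_const la * expR (- (4^-1 * xi) - la / 2 * expR (2^-1 * xi))) measurableT (L1_expR_abs h).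
apply: L1_le i1 _ => //; first by rewrite /macX; meas.
move=> q _; rewrite ger0_norm ?expR_ge0//; apply: le_trans (expR_macX_le xi q la0).
by case: (leP 0 q) => q0; rewrite ?(ger0_norm q0) ?(ltr0_norm q0)// macXN.
Qed.

Lemma L1_expR_macX_cy (la xi : R) : 0 < la ->
  mu.-integrable `[0, +oo[ (EFin \o (fun q => expR (- (la * macX xi q)))).
Proof. by move=> la0; apply: integrableS (L1_expR_macX xi la0). Qed.

(** This is [K_0(la z)] at [z = 2 e^(xi/2)]. *)
Definition mac0 (la xi : R) : R := \int[mu]_(q in `[0, +oo[) expR (- (la * macX xi q)).

Definition mac_tail : R := \int[mu]_(q in `[0, +oo[) expR (- (2^-1 * q)).

Lemma mac0_le (la xi : R) : 0 < la ->
  mac0 la xi <= mac_const la * mac_tail * expR (- (4^-1 * xi) - la / 2 * expR (2^-1 * xi)).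
Proof.
move=> la0; have h : 0 < 2^-1 :> R by [].
have mI : measurable (`[0 : R, +oo[%classic : set (measurableTypeR R)) by exact: measurable_itv.
have i1 := L1Zl (mac_const la * expR (- (4^-1 * xi) - la / 2 * expR (2^-1 * xi))) mI (L1_expRN_cy h).
apply: (@le_trans _ _ (\int[mu]_(q in `[0, +oo[) (mac_const la * expR (- (4^-1 * xi) - la / 2 * expR (2^-1 * xi)) * expR (- (2^-1 * q))))).
  apply: le_Rintegral => //; first exact: L1_expR_macX_cy.
  by move=> q; rewrite /= in_itv/= andbT => q0; have := expR_macX_le xi q la0; rewrite ger0_norm.
by rewrite RintegralZl//; [rewrite /mac_tail; lra|exact: L1_expRN_cy].
Qed.

(** As a function of [y = e^xi] this is a multiple of [e^(-p y)] with [p = 2 e^(-om)]. Integrating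
    over [om] thus writes [K_0] as a superposition of Laplace kernels. *)
Definition mac_gauss (la xi om : R) : R := expR (- (2 * expR (xi - om)) - la ^+ 2 / 2 * expR om).

Lemma L1_mac_gauss (la xi : R) : 0 < la ->
  mu.-integrable setT (EFin \o mac_gauss la xi) /\ \int[mu]_om mac_gauss la xi om = 2 * mac0 la xi.
Proof.
(* Chosen so that the two exponentials in [la * macX] become [la^2 / 2 * e^om] and
   [2 e^(xi - om)]. *)
move=> la0; pose c := xi / 2 + ln 2 - ln la.
have mE : measurable_fun setT (fun q => expR (- (la * macX xi q))) by rewrite /macX; meas.
have [e1 e2] := Rintegral_shift (- c) mE.
have EE om : expR (- (la * macX xi (om + - c))) = mac_gauss la xi om.
  rewrite /mac_gauss /macX; congr expR.
  have -> : expR (xi / 2 + (om + - c)) = la / 2 * expR om.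
    rewrite (_ : xi / 2 + (om + - c) = ln la + - ln 2 + om); last by rewrite /c; ring.
    by rewrite !expRD expRN !lnK ?posrE.
  have -> : expR (xi / 2 - (om + - c)) = 2 / la * expR (xi - om).
    rewrite (_ : xi / 2 - (om + - c) = ln 2 + - ln la + (xi - om)); last by rewrite /c; field.
    by rewrite expRD [expR (ln 2 + _)]expRD expRN !lnK ?posrE.
  by field; rewrite gt_eqF.
have Ef : (fun om => expR (- (la * macX xi (om + - c)))) = mac_gauss la xi by apply/funext.
have [i0 e0] := Rintegral_even mE (fun q => congr1 (fun y => expR (- (la * y))) (macXN xi q)) (L1_expR_macX_cy xi la0).
rewrite -Ef; split; first exact: e1.1.
by rewrite -e2 e0.
Qed.

Lemma integral_gumbel (B : R) : 0 < B ->
  mu.-integrable setT (EFin \o (fun om => expR (om - B * expR om))) /\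
  \int[mu]_om expR (om - B * expR om) = B^-1.
Proof.
move=> B0.
have i1 := @L1_gexp R 1 B 1 ltr01 B0 ltr01.
have E : (fun om : R => expR (1 * om - B * expR (1 * om))) = (fun om => expR (om - B * expR om)).
  by apply/funext => t; rewrite !mul1r.
rewrite E in i1; split => //.
have [_ ->] := Rintegral_shift (- ln B) (L1_measurable i1).
transitivity (\int[mu]_t (B^-1 * gamma_weight 0 t)).
  apply: eq_Rintegral => t _; rewrite /gamma_weight mul1r.
  have -> : expR (t + - ln B) = expR t / B by rewrite expRD expRN lnK ?posrE.
  rewrite mulrCA mulfV ?gt_eqF// mulr1 (_ : t + - ln B - expR t = (t - expR t) + - ln B); last by ring.
  by rewrite expRD expRN lnK ?posrE// mulrC.
by rewrite RintegralZl//; [rewrite integral_gamma_weight fact0 mulr1|exact: L1_gamma_weight].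
Qed.

End macdonald.

(** * The integral of the product of J and K against [K_0] with real parameter *)

Section bessel_macdonald.
Context (R : realType) (tau : R).
Local Notation mu := (@lebesgue_measure R).
Local Notation b := (bessel_prod tau).

Definition bprod_bound : R := 2 * rgamma_bound tau * expR 2 * \int[mu]_th expR (- (2^-1 * `|th|)).

Lemma bprod_bound_ge0 : 0 <= bprod_bound.
Proof.
rewrite mulr_ge0 ?mulr_ge0 ?expR_ge0 ?rgamma_bound_ge0//.
by apply: Rintegral_ge0 => x _; exact: expR_ge0.
Qed.

Lemma bessel_prod_le xi : `|b xi| <= bprod_bound * (1 + expR (- (4^-1 * xi))).
Proof.
have [i1 e1] := L1_expR_abs_shift (xi / 2).
have i2 := L1Zl (2 * rgamma_bound tau * expR 2 * (1 + expR (- (4^-1 * xi)))) measurableT i1.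
have mph : measurable_fun setT (fun th => bessel_phase tau xi th * bessel_gauss xi th).
  by rewrite /bessel_phase /bessel_gauss; meas.
have := @Rintegral_le_bound _ _ R mu setT _ _ measurableT mph i2 (fun th _ => bessel_integrand_le tau xi th).
by rewrite RintegralZl// e1 /bprod_bound; lra.
Qed.

(** Read off from the integrable Laplace integrand at [p = 1] by dividing by its exponential
    factor. *)
Lemma measurable_bessel_prod : measurable_fun setT b.
Proof.
have [i1 _] := @laplace_bessel_prod R tau 1 ltr01.
have m1 := L1_measurable i1.
have -> : b = (fun xi => expR (- (xi - 1 * expR xi)) * (expR (xi - 1 * expR xi) * b xi)).
  by apply/funext => xi; rewrite mulrA (mulrC (expR (- _))) expRxMexpNx_1 mul1r.
by apply: measurable_funM => //; meas.
Qed.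

Definition bmac_dom (la xi : R) : R :=
  bprod_bound * (mac_const la * mac_tail R) *
  (expR (3 / 4 * xi - la / 2 * expR (2^-1 * xi)) + expR (2^-1 * xi - la / 2 * expR (2^-1 * xi))).

Lemma L1_bmac_dom la : 0 < la -> mu.-integrable setT (EFin \o bmac_dom la).
Proof.
move=> la0; have l2 : 0 < la / 2 by rewrite divr_gt0.
have h34 : 0 < 3 / 4 :> R by lra.
have h2 : 0 < 2^-1 :> R by [].
exact: (L1Zl _ measurableT (L1D measurableT (L1_gexp h34 l2 h2) (L1_gexp h2 l2 h2))).
Qed.

Lemma bmac_le la xi : 0 < la ->
  bprod_bound * (expR xi * (1 + expR (- (4^-1 * xi)))) * mac0 la xi <= bmac_dom la xi.
Proof.
move=> la0; have K0 := bprod_bound_ge0.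
have p0 : 0 <= bprod_bound * (expR xi * (1 + expR (- (4^-1 * xi)))).
  by rewrite mulr_ge0// mulr_ge0 ?addr_ge0 ?expR_ge0.
apply: le_trans (ler_wpM2l p0 (mac0_le xi la0)) _.
rewrite /bmac_dom le_eqVlt; apply/orP; left; apply/eqP.
have -> : expR (3 / 4 * xi - la / 2 * expR (2^-1 * xi)) = expR xi * expR (- (4^-1 * xi) - la / 2 * expR (2^-1 * xi)).
  by rewrite -expRD; congr expR; field.
have -> : expR (2^-1 * xi - la / 2 * expR (2^-1 * xi)) = expR xi * expR (- (4^-1 * xi)) * expR (- (4^-1 * xi) - la / 2 * expR (2^-1 * xi)).
  by rewrite -!expRD; congr expR; field.
ring.
Qed.

Lemma sinhE (v : R) : sinh v = (expR v - expR (- v)) / 2. Proof. by []. Qed.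

Lemma sinh_ge0 (v : R) : 0 <= v -> 0 <= sinh v.
Proof. by move=> v0; rewrite divr_ge0// subr_ge0 ler_expR; lra. Qed.

(** With [n = min m 1/2]: [m + sinh v >= n + n (e^v - 1) = n e^v], as [e^(-v) <= 1]. *)
Lemma inv_sinhD_le (m v : R) : 0 < m -> 0 <= v -> (m + sinh v)^-1 <= (Num.min m 2^-1)^-1 * expR (- v).
Proof.
move=> m0 v0; set n := Num.min m 2^-1.
have n0 : 0 < n by rewrite lt_min m0 invr_gt0 ltr0n.
have nm : n <= m by rewrite ge_min lexx.
have n2 : n <= 2^-1 by rewrite ge_min lexx orbT.
have s0 := sinh_ge0 v0.
rewrite expRN -invfM lef_pV2 ?posrE ?mulr_gt0 ?expR_gt0//; last by rewrite ltr_wpDr.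
rewrite sinhE; have e1 : 1 <= expR v by rewrite -[leLHS]expR0 ler_expR.
have e2 : expR (- v) <= 1 by rewrite expR_le1 oppr_le0.
have : n * (expR v - 1) <= 2^-1 * (expR v - 1) by rewrite ler_wpM2r// subr_ge0.
lra.
Qed.

Lemma L1_expRN_oy (p : R) : 0 < p -> mu.-integrable `]0, +oo[ (EFin \o (fun v => expR (- (p * v)))).
Proof.
move=> p0; apply: integrableS (L1_expRN_cy p0) => // v /=.
by rewrite !in_itv/= !andbT => /ltW.
Qed.

Let L1_sinh_cos (p : R) : 0 < p ->
  mu.-integrable `]0, +oo[ (EFin \o (fun v => p^-1 * (expR (- ((expR v - expR (- v)) / p)) * cos (tau * v)))).
Proof.
move=> p0; have q0 : 0 < p^-1 by rewrite invr_gt0.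
apply: L1Zl => //; apply: (@L1_le _ _ R mu _ _ (fun v => expR (- (p^-1 * v)))) => //; first by meas.
  apply: integrableS (L1_expRN_cy q0) => // v /=.
  by rewrite !in_itv/= !andbT => /ltW.
move=> v; rewrite /= in_itv/= andbT => v0.
rewrite normrM ger0_norm ?expR_ge0//; apply: (@le_trans _ _ (expR (- ((expR v - expR (- v)) / p)))).
  by rewrite ler_piMr ?expR_ge0// cos_max.
rewrite ler_expR lerN2 (mulrC p^-1) ler_pM2r//.
have := expR_ge1Dx v; have : expR (- v) <= 1 by rewrite expR_le1; lra.
lra.
Qed.

Let integral_mac_gauss (la xi r : R) : 0 < la ->
  \int[mu]_om (r * mac_gauss la xi om) = r * (2 * mac0 la xi).
Proof.
by move=> la0; rewrite RintegralZl//; [rewrite (L1_mac_gauss xi la0).2|exact: (L1_mac_gauss xi la0).1].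
Qed.

Let integral_gumbelZ (B r : R) : 0 < B -> \int[mu]_om (r * expR (om - B * expR om)) = r / B.
Proof.
by move=> B0; rewrite RintegralZl//; [rewrite (integral_gumbel B0).2|exact: (integral_gumbel B0).1].
Qed.

Let integral_bessel_sinh (p r : R) : 0 < p ->
  \int[mu]_xi (r * (expR (xi - p * expR xi) * b xi)) =
  \int[mu]_(v in `]0, +oo[) (r * (p^-1 * (expR (- ((expR v - expR (- v)) / p)) * cos (tau * v)))).
Proof.
move=> p0; have [i3 e3] := laplace_bessel_prod tau p0.
by rewrite RintegralZl// e3 RintegralZl//; exact: L1_sinh_cos.
Qed.

(** Write [K_0] by [mac_gauss], exchange, apply the Laplace transform of [bessel_prod] at
    [p = 2 e^(-om)], exchange again. The remaining integral over [om] is [integral_gumbel] with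
    [B = la^2 / 2 + sinh v]. *)
Lemma laplace_mac_bessel (la : R) : 0 < la ->
  \int[mu]_xi (expR xi * b xi * mac0 la xi) =
  \int[mu]_(v in `]0, +oo[) (4^-1 * cos (tau * v) / (la ^+ 2 / 2 + sinh v)).
Proof.
move=> la0.
have B0 (v : R) : 0 <= v -> 0 < la ^+ 2 / 2 + sinh v.
  by move=> v0; rewrite ltr_wpDr ?sinh_ge0// divr_gt0// exprn_gt0.
have mb := measurable_bessel_prod.
have mI : measurable (`]0 : R, +oo[%classic : set (measurableTypeR R)) by exact: measurable_itv.
have P0 (om : R) : 0 < 2 * expR (- om) by rewrite mulr_gt0// expR_gt0.
have c2 : 0 <= 2^-1 :> R by rewrite invr_ge0 ler0n.
pose f xi om := 2^-1 * (expR xi * b xi) * mac_gauss la xi om.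
have mbf : measurable_fun setT (fun z : R * R => b z.1) by apply: (measurableT_comp mb); meas.
have mf : measurable_fun (setT `*` setT) (fun z : R * R => f z.1 z.2).
  by rewrite setXTT /f /mac_gauss; meas.
have mfx xi : setT xi -> measurable_fun setT (f xi).
  by move=> _; rewrite /f /mac_gauss; meas.
pose h xi om := bprod_bound * (expR xi * (1 + expR (- (4^-1 * xi)))) * 2^-1 * mac_gauss la xi om.
have ih xi : setT xi -> mu.-integrable setT (EFin \o h xi).
  by move=> _; exact: (L1Zl _ measurableT (L1_mac_gauss xi la0).1).
have fh xi om : setT xi -> setT om -> `|f xi om| <= h xi om.
  move=> _ _; rewrite /f /h !normrM (ger0_norm (expR_ge0 (- _ - _))).
  apply: ler_wpM2r; first exact (expR_ge0 _).
  rewrite [leRHS]mulrC (ger0_norm c2); apply: ler_wpM2l; first exact c2.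
  rewrite mulrCA (ger0_norm (expR_ge0 _)); apply: ler_wpM2l; first exact (expR_ge0 _).
  exact (bessel_prod_le xi).
have hg xi : setT xi -> \int[mu]_om h xi om <= bmac_dom la xi.
  move=> _; rewrite /h (integral_mac_gauss _ _ la0); apply: le_trans (bmac_le xi la0).
  by rewrite le_eqVlt; apply/orP; left; apply/eqP; field.
have [_ _ e1] := @RFubini_dom _ _ _ _ R mu mu setT setT f h _ measurableT measurableT mf mfx ih fh hg (L1_bmac_dom la0).
transitivity (\int[mu]_xi \int[mu]_om f xi om).
  apply: eq_Rintegral => xi _; rewrite /f (integral_mac_gauss _ _ la0).
  by field.
rewrite e1.
have c4 : 0 <= 4^-1 :> R by rewrite invr_ge0 ler0n.
pose f2 v om := 4^-1 * cos (tau * v) * expR (om - (la ^+ 2 / 2 + sinh v) * expR om).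
pose h2 v om := 4^-1 * expR (om - (la ^+ 2 / 2 + sinh v) * expR om).
have mf2 : measurable_fun (`]0 : R, +oo[ `*` setT) (fun z : R * R => f2 z.1 z.2).
  by apply: measurable_funTS; rewrite /f2 /sinh; meas.
have mf2x v : `]0 : R, +oo[%classic v -> measurable_fun setT (f2 v).
  by move=> _; rewrite /f2; meas.
have pos (v : R) : `]0 : R, +oo[%classic v -> 0 <= v by rewrite /= in_itv/= andbT => /ltW.
have ih2 v : `]0 : R, +oo[%classic v -> mu.-integrable setT (EFin \o h2 v).
  by move=> /pos v0; exact: (L1Zl _ measurableT (integral_gumbel (B0 v v0)).1).
have fh2 v om : `]0 : R, +oo[%classic v -> setT om -> `|f2 v om| <= h2 v om.
  move=> _ _; rewrite /f2 /h2 normrM (ger0_norm (expR_ge0 _)).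
  apply: ler_wpM2r; first exact (expR_ge0 _).
  by rewrite normrM (ger0_norm c4); apply: ler_piMr; [exact c4|exact (cos_max _)].
pose g2 (v : R) := 4^-1 * (Num.min (la ^+ 2 / 2) 2^-1)^-1 * expR (- (1 * v)).
have hg2 v : `]0 : R, +oo[%classic v -> \int[mu]_om h2 v om <= g2 v.
  move=> /pos v0; rewrite /h2 (integral_gumbelZ _ (B0 v v0)) /g2 -mulrA mul1r.
  have l2 : 0 < la ^+ 2 / 2 by apply: divr_gt0; [exact: exprn_gt0|exact: ltr0n].
  by apply: ler_wpM2l (inv_sinhD_le l2 v0); rewrite invr_ge0 ler0n.
have ig2 : mu.-integrable `]0, +oo[ (EFin \o g2).
  exact (L1Zl _ mI (L1_expRN_oy ltr01)).
have [_ _ e2] := @RFubini_dom _ _ _ _ R mu mu `]0, +oo[ setT f2 h2 g2 mI measurableT mf2 mf2x ih2 fh2 hg2 ig2.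
transitivity (\int[mu]_(v in `]0, +oo[) \int[mu]_om f2 v om); last first.
  by apply: Rintegral_eq => v /pos v0; rewrite /f2 (integral_gumbelZ _ (B0 v v0)).
rewrite e2; apply: eq_Rintegral => om _.
have p0 := P0 om.
transitivity (\int[mu]_xi (2^-1 * expR (- (la ^+ 2 / 2 * expR om)) * (expR (xi - 2 * expR (- om) * expR xi) * b xi))).
  apply: eq_Rintegral => xi _; rewrite /f /mac_gauss.
  have -> : expR (- (2 * expR (xi - om)) - la ^+ 2 / 2 * expR om) =
    expR (- (2 * expR (- om) * expR xi)) * expR (- (la ^+ 2 / 2 * expR om)).
    by rewrite -expRD; congr expR; rewrite [expR (xi - om)]expRD; ring.
  by rewrite [expR (xi - _)]expRD; ring.
rewrite (integral_bessel_sinh _ p0).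
apply: eq_Rintegral => v _; rewrite /f2 /sinh (expRN om) invfM invrK.
have -> : expR (om - (la ^+ 2 / 2 + (expR v - expR (- v)) / 2) * expR om) =
   expR om * expR (- (la ^+ 2 / 2 * expR om)) * expR (- ((expR v - expR (- v)) * (2^-1 * expR om))).
  by rewrite -!expRD; congr expR; ring.
by field.
Qed.

End bessel_macdonald.

(** * Both sides as Laplace transforms in [la], and their values on the diagonal ray *)

Section continuation.
Context (R : realType) (tau : R).
Local Notation mu := (@lebesgue_measure R).
Local Notation b := (bessel_prod tau).
Local Notation Icy := (`[0 : R, +oo[%classic : set (measurableTypeR R)).
Local Notation Ioy := (`]0 : R, +oo[%classic : set (measurableTypeR R)).

Let mIcy : measurable Icy. Proof. exact: measurable_itv. Qed.
Let mIoy : measurable Ioy. Proof. exact: measurable_itv. Qed.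

(** Minus the imaginary part of [K_0((1 + i) p z)] at [z = 2 e^(xi/2)], since [(1 + i) p] lies on
    the ray [arg = pi/4]. *)
Definition macD (p xi : R) : R := \int[mu]_(q in Icy) (expR (- (p * macX xi q)) * sin (p * macX xi q)).

Let mbf : measurable_fun setT (fun z : R * R => b z.1).
Proof. by have mb := measurable_bessel_prod tau; apply: (measurableT_comp mb); meas. Qed.

Let mg1 D : measurable_fun D (fun z : R * R => expR z.1 * b z.1).
Proof. by apply: measurable_funTS; meas. Qed.

(** One majorant serves the real exponential and its version with a sine factor; [space2] does the
    same for the other side. *)
Let space1 (f : R -> R -> R) (e : R) : 0 < e ->
  measurable_fun (setT `*` Icy) (fun z : R * R => f z.1 z.2) ->
  (forall xi, measurable_fun Icy (f xi)) ->
  (forall xi q, `|f xi q| <= `|expR xi * b xi * expR (- (e * macX xi q))|) ->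
  (mu \x mu)%E.-integrable (setT `*` Icy) (EFin \o (fun z => f z.1 z.2)).
Proof.
move=> e0 mf mfx fb.
apply: (@L1_prod_dom _ _ _ _ R mu mu setT Icy f
  (fun xi q => bprod_bound tau * (expR xi * (1 + expR (- (4^-1 * xi)))) * expR (- (e * macX xi q)))
  (bmac_dom tau e)) => //.
- by move=> xi _; apply: L1Zl => //; exact: L1_expR_macX_cy.
- move=> xi q _ _; apply: le_trans (fb xi q) _.
  rewrite normrM (ger0_norm (expR_ge0 (- _))) ler_wpM2r ?expR_ge0//.
  by rewrite normrM (ger0_norm (expR_ge0 _)) [leRHS]mulrCA ler_wpM2l ?expR_ge0// bessel_prod_le.
- move=> xi _; rewrite RintegralZl//; last exact: L1_expR_macX_cy.
  exact: bmac_le.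
- exact: L1_bmac_dom.
Qed.

Let X1_ge0 (z : R * R) : 0 <= macX z.1 z.2. Proof. exact/ltW/macX_gt0. Qed.

Let mX1 D : measurable_fun D (fun z : R * R => macX z.1 z.2).
Proof. by apply: measurable_funTS; exact: measurable_macX2. Qed.

Let L1_space1 (e : R) : 0 < e -> (mu \x mu)%E.-integrable (setT `*` Icy)
  (EFin \o (fun z : R * R => expR z.1 * b z.1 * expR (- (e * macX z.1 z.2)))).
Proof.
move=> e0; apply: (@space1 (fun xi q => expR xi * b xi * expR (- (e * macX xi q))) e e0) => //.
- by apply: measurable_funM; [exact: mg1|apply: measurable_funTS; rewrite /macX; meas].
- by move=> xi; have h := measurable_macX xi; apply: measurable_funTS; meas.
Qed.

Let L1_space1_sin (p : R) : 0 < p -> (mu \x mu)%E.-integrable (setT `*` Icy)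
  (EFin \o (fun z : R * R => expR z.1 * b z.1 * (expR (- (p * macX z.1 z.2)) * sin (p * macX z.1 z.2)))).
Proof.
move=> p0; apply: (@space1 (fun xi q => expR xi * b xi * (expR (- (p * macX xi q)) * sin (p * macX xi q))) p p0) => //.
- by apply: measurable_funM; [exact: mg1|apply: measurable_funTS; rewrite /macX; meas].
- by move=> xi; have h := measurable_macX xi; apply: measurable_funTS; meas.
- by move=> xi q; rewrite mulrA normrM ler_piMr// sin_max.
Qed.

Lemma L1_expsin_macX (p xi : R) : 0 < p -> 
  mu.-integrable Icy (EFin \o (fun q => expR (- (p * macX xi q)) * sin (p * macX xi q))).
Proof.
move=> p0; apply: L1_le (L1_expR_macX_cy xi p0) _ => //.
  by have h := measurable_macX xi; apply: measurable_funTS; meas.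
by move=> q _; rewrite normrM ger0_norm ?expR_ge0// ler_piMr ?expR_ge0// sin_max.
Qed.

Let int_space1 (la : R) : 0 < la ->
  \int[(mu \x mu)%E]_(z in setT `*` Icy) (expR z.1 * b z.1 * expR (- (la * macX z.1 z.2))) =
  \int[mu]_xi (expR xi * b xi * mac0 la xi).
Proof.
move=> la0.
have [_ _ -> _] := @Rintegral_prod _ _ _ _ R mu mu setT Icy (fun xi q => expR xi * b xi * expR (- (la * macX xi q))) measurableT mIcy (L1_space1 la0).
by apply: eq_Rintegral => xi _; rewrite RintegralZl//; exact: L1_expR_macX_cy.
Qed.

Lemma int_space1_sin (p : R) : 0 < p ->
  mu.-integrable setT (EFin \o (fun xi => expR xi * b xi * macD p xi)) /\
  \int[(mu \x mu)%E]_(z in setT `*` Icy) (expR z.1 * b z.1 * (expR (- (p * macX z.1 z.2)) * sin (p * macX z.1 z.2))) =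
  \int[mu]_xi (expR xi * b xi * macD p xi).
Proof.
move=> p0.
have [i1 _ e1 _] := @Rintegral_prod _ _ _ _ R mu mu setT Icy (fun xi q => expR xi * b xi * (expR (- (p * macX xi q)) * sin (p * macX xi q))) measurableT mIcy (L1_space1_sin p0).
have E : (fun xi => \int[mu]_(q in Icy) (expR xi * b xi * (expR (- (p * macX xi q)) * sin (p * macX xi q)))) =
   (fun xi => expR xi * b xi * macD p xi).
  by apply/funext => xi; rewrite RintegralZl//; exact: L1_expsin_macX.
by rewrite e1 E in i1 *.
Qed.

(** With [a^2 = 2 sinh v], [1 / (la^2 / 2 + sinh v) = 2 / (la^2 + a^2)] is [2 / a] times the
    integral of [e^(-la t) sin (a t)]. This exhibits the right-hand side as a Laplace transform in
    [la], with [t] as its variable and [lapg] as its density. *)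
Definition lapa (v : R) : R := Num.sqrt (2 * sinh v).

Definition lapg (v t : R) : R := 4^-1 * cos (tau * v) * (2 / lapa v * sin (lapa v * t)).

Lemma sinh_gt0 (v : R) : 0 < v -> 0 < sinh v.
Proof. by move=> v0; rewrite divr_gt0// subr_gt0 ltr_expR; lra. Qed.

Lemma lapa_gt0 v : 0 < v -> 0 < lapa v.
Proof. by move=> v0; rewrite sqrtr_gt0 mulr_gt0// sinh_gt0. Qed.

Lemma lapa_sqr v : 0 < v -> lapa v ^+ 2 = 2 * sinh v.
Proof. by move=> v0; rewrite sqr_sqrtr// mulr_ge0// ltW// sinh_gt0. Qed.

Let measurable_lapg D : measurable_fun D (fun z : R * R => lapg z.1 z.2).
Proof. by apply: measurable_funTS; rewrite /lapg /lapa /sinh; meas. Qed.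

Let measurable_lapgx D v : measurable_fun D (lapg v).
Proof. by apply: measurable_funTS; rewrite /lapg; meas. Qed.

(** Combine [|sin (a t) / a| <= t], good near [v = 0], with [|sin (a t)| <= 1], good for large [v]:
    together they give [(1 + t) / (1 + a)], and [(1 + a)^2 >= 1 + 2 sinh v >= e^v]. *)
Lemma sin_lapa_le v t : 0 < v -> 0 <= t -> `|(lapa v)^-1 * sin (lapa v * t)| <= (1 + t) * expR (- (2^-1 * v)).
Proof.
move=> v0 t0; have a0 := lapa_gt0 v0; set a := lapa v in a0 *.
have h : expR (2^-1 * v) <= 1 + a.
  have e1 : 0 <= 1 + a by rewrite addr_ge0// ltW.
  rewrite -(ler_pXn2r (ltn0Sn 1)) ?nnegrE ?expR_ge0// -expRM_natl.
  rewrite (_ : 2%:R * (2^-1 * v) = v); last by field.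
  rewrite sqrrD expr1n mul1r /a lapa_sqr// sinhE.
  have : expR (- v) <= 1 by rewrite expR_le1 oppr_le0 ltW.
  by have := ltW a0; rewrite mulr2n /a; lra.
rewrite expRN ler_pdivlMr ?expR_gt0//.
apply: (@le_trans _ _ (`|a^-1 * sin (a * t)| * (1 + a))); first by rewrite ler_wpM2l.
rewrite normrM normfV (gtr0_norm a0) mulrDr mulr1 addrC lerD//.
  by rewrite mulrAC mulVf ?gt_eqF// mul1r sin_max.
rewrite ler_pdivrMl//; apply: le_trans (ler_norm_sin _) _.
by rewrite ger0_norm// mulr_ge0// ltW.
Qed.

Let space2 (f : R -> R -> R) (e : R) : 0 < e ->
  measurable_fun (Ioy `*` Icy) (fun z : R * R => f z.1 z.2) ->
  (forall v, measurable_fun Icy (f v)) ->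
  (forall v t, 0 < v -> 0 <= t -> `|f v t| <= `|lapg v t * expR (- (e * t))|) ->
  (mu \x mu)%E.-integrable (Ioy `*` Icy) (EFin \o (fun z => f z.1 z.2)).
Proof.
move=> e0 mf mfx fb; have e2 : 0 < e / 2 by rewrite divr_gt0.
have h2 : 0 < 2^-1 :> R by [].
have c0 : 0 <= 1 + (e / 2)^-1 by rewrite addr_ge0// invr_ge0 ltW.
apply: (@L1_prod_dom _ _ _ _ R mu mu Ioy Icy f
  (fun v t => 2^-1 * expR (- (2^-1 * v)) * (1 + (e / 2)^-1) * expR (- (e / 2 * t)))
  (fun v => (2^-1 * (1 + (e / 2)^-1) * \int[mu]_(t in Icy) expR (- (e / 2 * t))) * expR (- (2^-1 * v)))) => //.
- by move=> v _; apply: L1Zl => //; exact: L1_expRN_cy.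
- move=> v t; rewrite /= !in_itv/= !andbT => v0 t0; apply: le_trans (fb v t v0 t0) _.
  rewrite /lapg (_ : 4^-1 * cos (tau * v) * (2 / lapa v * sin (lapa v * t)) * expR (- (e * t)) = 2^-1 * cos (tau * v) * ((lapa v)^-1 * sin (lapa v * t)) * expR (- (e * t))); last by field; rewrite gt_eqF// lapa_gt0.
  rewrite normrM (ger0_norm (expR_ge0 _)) normrM.
  apply: (@le_trans _ _ (2^-1 * ((1 + t) * expR (- (2^-1 * v))) * expR (- (e * t)))).
    rewrite ler_wpM2r ?expR_ge0// ler_pM ?sin_lapa_le//.
    by rewrite normrM ger0_norm// ler_piMr// cos_max.
  have : (1 + t) * expR (- (e * t)) <= (1 + (e / 2)^-1) * expR (- (e / 2 * t)).
    have -> : - (e * t) = - (e / 2 * t) + - (e / 2 * t) by field.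
    rewrite expRD mulrA ler_wpM2r ?expR_ge0// mulrDl mul1r lerD//.
      by rewrite expR_le1 oppr_le0 mulr_ge0// ltW.
    by have := @monomial_expRN_le R (e / 2) t 1 e2 t0; rewrite !expr1 div1r.
  have q0 : 0 <= 2^-1 * expR (- (2^-1 * v)) by rewrite mulr_ge0// expR_ge0.
  move/(ler_wpM2l q0); set x1 := expR _; set x2 := expR (- (e * t)); set x3 := expR _; set x4 := (e / 2)^-1; move: x4 x3 x2 x1 => x4 x3 x2 x1; lra.
- move=> v _; rewrite RintegralZl//; last exact: L1_expRN_cy.
  by rewrite le_eqVlt; apply/orP; left; apply/eqP; ring.
- by apply: L1Zl => //; exact: L1_expRN_oy.
Qed.

Let L1_space2 (e : R) : 0 < e -> (mu \x mu)%E.-integrable (Ioy `*` Icy)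
  (EFin \o (fun z : R * R => lapg z.1 z.2 * expR (- (e * z.2)))).
Proof.
move=> e0; apply: (@space2 (fun v t => lapg v t * expR (- (e * t))) e e0) => //.
- by apply: measurable_funM; [exact: measurable_lapg|apply: measurable_funTS; meas].
- by move=> v; apply: measurable_funM; [exact: measurable_lapgx|apply: measurable_funTS; meas].
Qed.

Let L1_space2_sin (p : R) : 0 < p -> (mu \x mu)%E.-integrable (Ioy `*` Icy)
  (EFin \o (fun z : R * R => lapg z.1 z.2 * (expR (- (p * z.2)) * sin (p * z.2)))).
Proof.
move=> p0; apply: (@space2 (fun v t => lapg v t * (expR (- (p * t)) * sin (p * t))) p p0) => //.
- by apply: measurable_funM; [exact: measurable_lapg|apply: measurable_funTS; meas].
- by move=> v; apply: measurable_funM; [exact: measurable_lapgx|apply: measurable_funTS; meas].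
- by move=> v t _ _; rewrite mulrA normrM ler_piMr// sin_max.
Qed.

Let int_space2 (la : R) : 0 < la ->
  \int[(mu \x mu)%E]_(z in Ioy `*` Icy) (lapg z.1 z.2 * expR (- (la * z.2))) =
  \int[mu]_(v in Ioy) (4^-1 * cos (tau * v) / (la ^+ 2 / 2 + sinh v)).
Proof.
move=> la0.
have [_ _ -> _] := @Rintegral_prod _ _ _ _ R mu mu Ioy Icy (fun v t => lapg v t * expR (- (la * t))) mIoy mIcy (L1_space2 la0).
apply: Rintegral_eq => v; rewrite /= in_itv/= andbT => v0.
have a0 := lapa_gt0 v0; have aE := lapa_sqr v0; have s0 := sinh_gt0 v0.
transitivity (\int[mu]_(t in Icy) (4^-1 * cos (tau * v) * (2 / lapa v) * (expR (- (la * t)) * sin (lapa v * t)))).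
  by apply: eq_Rintegral => t _; rewrite /lapg; ring.
rewrite RintegralZl//; last exact: L1_expsin.
have l2 : 0 < la ^+ 2 by rewrite exprn_gt0.
have n1 : lapa v != 0 by rewrite gt_eqF.
have n2 : la ^+ 2 + sinh v * 2 != 0 by rewrite gt_eqF//; lra.
have n3 : la ^+ 2 / 2 + sinh v != 0 by rewrite gt_eqF//; lra.
rewrite integral_expsin// aE; field.
by rewrite ?n1 ?n2 ?n3.
Qed.

Let int_space2_sin (p : R) : 0 < p ->
  \int[(mu \x mu)%E]_(z in Ioy `*` Icy) (lapg z.1 z.2 * (expR (- (p * z.2)) * sin (p * z.2))) =
  \int[mu]_(v in Ioy) (4^-1 * (cos (tau * v) * (p ^+ 2 / (p ^+ 4 + sinh v ^+ 2)))).
Proof.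
move=> p0.
have [_ _ -> _] := @Rintegral_prod _ _ _ _ R mu mu Ioy Icy (fun v t => lapg v t * (expR (- (p * t)) * sin (p * t))) mIoy mIcy (L1_space2_sin p0).
apply: Rintegral_eq => v; rewrite /= in_itv/= andbT => v0.
have a0 := lapa_gt0 v0; have aE := lapa_sqr v0; have s0 := sinh_gt0 v0.
transitivity (\int[mu]_(t in Icy) (4^-1 * cos (tau * v) / lapa v * (expR (- (p * t)) * cos ((lapa v - p) * t)
    - expR (- (p * t)) * cos ((lapa v + p) * t)))).
  apply: eq_Rintegral => t _; rewrite /lapg (mulrBl t (lapa v) p) (mulrDl (lapa v) p t) (cosB (lapa v * t)) (cosD (lapa v * t)); field.
  by rewrite gt_eqF.
have i1 : mu.-integrable Icy (EFin \o (fun t => expR (- (p * t)) * cos ((lapa v - p) * t))) by exact: L1_expcos.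
have i2 : mu.-integrable Icy (EFin \o (fun t => expR (- (p * t)) * cos ((lapa v + p) * t))) by exact: L1_expcos.
rewrite RintegralZl//; last exact: L1B.
rewrite RintegralB// !integral_expcos//.
have -> : sinh v = lapa v ^+ 2 / 2 by rewrite aE; field.
set a := lapa v in a0 *.
have q1 : 0 < p ^+ 2 + (a - p) ^+ 2 by rewrite ltr_pwDl ?exprn_gt0// sqr_ge0.
have q2 : 0 < p ^+ 2 + (a + p) ^+ 2 by rewrite ltr_pwDl ?exprn_gt0// sqr_ge0.
have q3 : 0 < p ^+ 4 + (a ^+ 2 / 2) ^+ 2 by rewrite ltr_pwDl ?exprn_gt0// sqr_ge0.
(* Sophie Germain's factorization of [a^4 + 4 p^4]; the factors are the denominators of the two
   cosine transforms. *)
have E : p ^+ 4 + (a ^+ 2 / 2) ^+ 2 = (p ^+ 2 + (a - p) ^+ 2) * (p ^+ 2 + (a + p) ^+ 2) / 4 by field.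
rewrite E; field.
by rewrite !gt_eqF.
Qed.

(** Continuation between two plane measures: [(xi, q)] with variable [macX], and [(v, t)] with
    variable [t]. With [p^2 = cosh u] the kernel on the right is the one of the index integral. *)
Lemma bessel_macD_integral (p : R) : 0 < p ->
  \int[mu]_xi (expR xi * b xi * macD p xi) =
  \int[mu]_(v in Ioy) (4^-1 * (cos (tau * v) * (p ^+ 2 / (p ^+ 4 + sinh v ^+ 2)))).
Proof.
move=> p0; rewrite -(int_space1_sin p0).2 -(int_space2_sin p0).
apply: (@laplace_continuation_diag _ _ _ _ R (mu \x mu)%E (mu \x mu)%E (setT `*` Icy) (Ioy `*` Icy)
   (fun z : R * R => macX z.1 z.2) (fun z : R * R => z.2) _ _ _ _ _ _
   (fun z : R * R => expR z.1 * b z.1) (fun z : R * R => lapg z.1 z.2)) => //.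
- by apply: measurableX.
- by apply: measurableX.
- exact: mX1.
- exact: (measurable_funTS (@measurable_snd _ _ R R)).
- by move=> z [_]; rewrite /= in_itv/= andbT.
- exact: mg1.
- exact: measurable_lapg.
- by move=> la la0; rewrite int_space1// int_space2// laplace_mac_bessel.
Qed.

End continuation.

(** * Fourier series of Lipschitz functions *)

Section fourier.
Context (R : realType).
Local Notation mu := (@lebesgue_measure R).
Local Notation I := (`[- pi, pi]%classic : set (measurableTypeR R)).

Let mI : measurable I. Proof. exact: measurable_itv. Qed.

Let L1_cst (c : R) : mu.-integrable I (EFin \o (fun=> c)).
Proof.
apply: (@measurable_bounded_integrable _ _ R mu (fun=> c) I) => //.
- rewrite /= lebesgue_measure_itv/= lte_fin ifT ?ltry//.
  by have := @pi_gt0 R; lra.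
- by exists `|c|; split; [exact: num_real|move=> M /= cM x _; exact: ltW].
Qed.

Lemma Rintegral_cst_pi (c : R) : \int[mu]_(v in I) c = 2 * pi * c.
Proof.
have d (x : R) : is_derive x 1 (fun t : R => c * t) c.
  by apply: is_derive_eq; rewrite /GRing.scale/=; ring.
have p0 := @pi_gt0 R.
rewrite (@FTC_seg _ (fun t => c * t) (fun=> c))//; last exact: cst_continuous.
- by ring.
- by lra.
Qed.

Definition bmf (f : R -> R) := measurable_fun setT f /\ exists M, forall v, I v -> `|f v| <= M.

Lemma bmf_L1 f : bmf f -> mu.-integrable I (EFin \o f).
Proof.
move=> [mf [M fM]]; apply: (L1_le mI _ (L1_cst M) fM).
exact: measurable_funTS.
Qed.

Lemma bmf_cst c : bmf (fun=> c).
Proof. by split; [exact: measurable_cst|exists `|c|]. Qed.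

Lemma bmfM f g : bmf f -> bmf g -> bmf (fun v => f v * g v).
Proof.
move=> [mf [M fM]] [mg [N gN]]; split; first exact: measurable_funM.
by exists (M * N) => v Iv; rewrite normrM ler_pM ?fM ?gN.
Qed.

Lemma bmfD f g : bmf f -> bmf g -> bmf (fun v => f v + g v).
Proof.
move=> [mf [M fM]] [mg [N gN]]; split; first exact: measurable_funD.
by exists (M + N) => v Iv; apply: le_trans (ler_normD _ _) _; rewrite lerD ?fM ?gN.
Qed.

Lemma bmfZ c f : bmf f -> bmf (fun v => c * f v).
Proof. exact/bmfM/bmf_cst. Qed.

Lemma bmfB f g : bmf f -> bmf g -> bmf (fun v => f v - g v).
Proof.
move=> [mf [M fM]] [mg [N gN]]; split; first exact: measurable_funB.
by exists (M + N) => v Iv; apply: le_trans (ler_normB _ _) _; rewrite lerD ?fM ?gN.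
Qed.

Lemma bmf_cos (a : R) : bmf (fun v => cos (a * v)).
Proof. by split; [meas|exists 1 => v _; exact: cos_max]. Qed.

Lemma bmf_sin (a : R) : bmf (fun v => sin (a * v)).
Proof. by split; [meas|exists 1 => v _; exact: sin_max]. Qed.

(* Bessel's inequality; the residuals G_N = F - sum_(k < N) c_k e_k / (2 pi) lose c_N^2 / (2 pi) of
   energy at each step. *)
Lemma bessel_inequality_cvg0 (e : nat -> R -> R) (F : R -> R) : bmf F ->
  (forall k, measurable_fun setT (e k)) -> (forall k v, `|e k v| <= 1) ->
  (forall j k, (j < k)%N -> \int[mu]_(v in I) (e j v * e k v) = 0) ->
  (fun k => \int[mu]_(v in I) (F v * e k v)) @ \oo --> 0.
Proof.
move=> bF me e1 eo; pose c k := \int[mu]_(v in I) (F v * e k v).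
have p0 := @pi_gt0 R; pose t : R := (2 * pi)^-1.
have t0 : 0 < t by rewrite invr_gt0 mulr_gt0.
have be k : bmf (e k) by split=> //; exists 1 => v _.
pose G := fix G N := if N is N'.+1 then (fun v => G N' v - t * c N' * e N' v) else F.
have bG N : bmf (G N) by elim: N => // N IH; apply: bmfB => //; exact: bmfZ.
have Ge N : forall j, (N <= j)%N -> \int[mu]_(v in I) (G N v * e j v) = c j.
  elim: N => [//|N IH] j Nj.
  transitivity (\int[mu]_(v in I) (G N v * e j v - t * c N * (e N v * e j v))).
    by apply: eq_Rintegral => v _ /=; ring.
  rewrite RintegralB//; [|exact: (bmf_L1 (bmfM (bG N) (be j)))|exact: (bmf_L1 (bmfZ _ (bmfM (be N) (be j))))].
  rewrite RintegralZl//; last exact: (bmf_L1 (bmfM (be N) (be j))).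
  by rewrite eo// mulr0 subr0 IH// ltnW.
have ee k : \int[mu]_(v in I) (e k v * e k v) <= 2 * pi.
  rewrite -[leRHS]mulr1 -Rintegral_cst_pi; apply: le_Rintegral; [exact: mI|..].
  - exact: (bmf_L1 (bmfM (be k) (be k))).
  - exact: L1_cst.
  - move=> v _; apply: le_trans (ler_norm _) _; rewrite normrM -[leRHS]mulr1.
    by rewrite ler_pM// e1.
have G2 N : \int[mu]_(v in I) (G N v * G N v) <= \int[mu]_(v in I) (F v * F v) - t * \sum_(0 <= k < N) c k ^+ 2.
  elim: N => [|N IH]; first by rewrite big_geq// mulr0 subr0.
  have -> : \int[mu]_(v in I) (G N.+1 v * G N.+1 v) =
     \int[mu]_(v in I) (G N v * G N v) - 2 * t * c N * \int[mu]_(v in I) (G N v * e N v) + (t * c N) ^+ 2 * \int[mu]_(v in I) (e N v * e N v).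
    transitivity (\int[mu]_(v in I) (G N v * G N v - 2 * t * c N * (G N v * e N v) + (t * c N) ^+ 2 * (e N v * e N v))).
      by apply: eq_Rintegral => v _ /=; ring.
    have b1 := bmfM (bG N) (bG N); have b2 := bmfM (bG N) (be N); have b3 := bmfM (be N) (be N).
    rewrite RintegralD//; [|exact: (bmf_L1 (bmfB b1 (bmfZ _ b2)))|exact: (bmf_L1 (bmfZ _ b3))].
    rewrite RintegralB//; [|exact: (bmf_L1 b1)|exact: (bmf_L1 (bmfZ _ b2))].
    by rewrite !RintegralZl//; exact: bmf_L1.
  rewrite Ge// big_nat_recr//=.
  have : (t * c N) ^+ 2 * \int[mu]_(v in I) (e N v * e N v) <= t * c N ^+ 2.
    apply: le_trans (ler_wpM2l (sqr_ge0 _) (ee N)) _.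
    have tp : t * (2 * pi) = 1 by rewrite mulVf// gt_eqF// mulr_gt0.
    rewrite le_eqVlt; apply/orP; left; apply/eqP.
    by transitivity (t * c N ^+ 2 * (t * (2 * pi))); [ring|rewrite tp mulr1].
  by move: IH; lra.
have bd N : \sum_(0 <= k < N) c k ^+ 2 <= 2 * pi * \int[mu]_(v in I) (F v * F v).
  have : 0 <= \int[mu]_(v in I) (G N v * G N v) by apply: Rintegral_ge0 => v _; rewrite -expr2 sqr_ge0.
  move/le_trans => /(_ _ (G2 N)); rewrite subr_ge0 => H.
  have tp : 2 * pi * t = 1 by rewrite mulfV// gt_eqF// mulr_gt0.
  have p2 : 0 <= 2 * pi :> R by rewrite mulr_ge0// ltW.
  by apply: le_trans (ler_wpM2l p2 H); rewrite mulrA tp mul1r.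
have c2 : (fun k => c k ^+ 2) @ \oo --> 0.
  apply: cvg_series_cvg_0; apply: nondecreasing_is_cvgn.
    by apply/nondecreasing_seqP => N; rewrite /series/= big_nat_recr//= lerDl sqr_ge0.
  by exists (2 * pi * \int[mu]_(v in I) (F v * F v)) => _ [N _ <-]; exact: bd.
have : (fun k => Num.sqrt (c k ^+ 2)) @ \oo --> Num.sqrt (0 : R).
  by apply: cvg_comp c2 _; exact: sqrt_continuous.
rewrite sqrtr0 => c3; apply/norm_cvg0P.
by apply: cvg_trans c3; apply: near_eq_cvg; near=> k; rewrite sqrtr_sqr.
Unshelve. all: by end_near. Qed.

Lemma sin_natpi (k : nat) : sin (k%:R * pi) = 0 :> R.
Proof.
elim: k => [|k IH]; first by rewrite mul0r sin0.
by rewrite -natr1 mulrDl mul1r sinDpi IH oppr0.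
Qed.

Lemma integral_cos_nat (k : nat) : (0 < k)%N -> \int[mu]_(v in I) cos (k%:R * v) = 0.
Proof.
move=> k0; have k1 : k%:R != 0 :> R by rewrite pnatr_eq0 -lt0n.
have d (x : R) : is_derive x 1 (fun t : R => sin (k%:R * t) / k%:R) (cos (k%:R * x)).
  by apply: is_derive_eq; rewrite /GRing.scale/=; field.
have p0 := @pi_gt0 R.
rewrite (@FTC_seg _ (fun t => sin (k%:R * t) / k%:R) (fun v => cos (k%:R * v)))//.
- by rewrite mulrN sinN sin_natpi; ring.
- by lra.
- have dc (x : R) : is_derive x 1 (fun v : R => cos (k%:R * v)) (- (k%:R * sin (k%:R * x))).
    by apply: is_derive_eq; rewrite /GRing.scale/=; ring.
  exact: (is_derive_continuous dc).
Qed.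

Lemma cos_natB (j k : nat) (v : R) : (j < k)%N -> cos (j%:R * v - k%:R * v) = cos ((k - j)%:R * v).
Proof. by move=> jk; rewrite -mulrBl -cosN -mulNr opprB natrB// ltnW. Qed.

Lemma riemann_lebesgue_cos F : bmf F -> (fun k => \int[mu]_(v in I) (F v * cos (k%:R * v))) @ \oo --> 0.
Proof.
move=> bF; apply: (@bessel_inequality_cvg0 (fun k v => cos (k%:R * v))) => //.
- by move=> k; meas.
- by move=> k v; exact: cos_max.
move=> j k jk.
transitivity (\int[mu]_(v in I) (2^-1 * (cos ((k - j)%:R * v) + cos ((j + k)%:R * v)))).
  by apply: eq_Rintegral => v _; rewrite -cos_natB// natrD mulrDl cosB cosD; field.
have b1 := bmf_cos (k - j)%:R; have b2 := bmf_cos (j + k)%:R.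
rewrite RintegralZl//; last exact: (bmf_L1 (bmfD b1 b2)).
rewrite RintegralD//; [|exact: (bmf_L1 b1)|exact: (bmf_L1 b2)].
by rewrite !integral_cos_nat ?subn_gt0// ?addr0 ?mulr0// addn_gt0 (leq_trans _ jk) ?orbT.
Qed.

Lemma riemann_lebesgue_sin F : bmf F -> (fun k => \int[mu]_(v in I) (F v * sin (k%:R * v))) @ \oo --> 0.
Proof.
move=> bF; apply: (@bessel_inequality_cvg0 (fun k v => sin (k%:R * v))) => //.
- by move=> k; meas.
- by move=> k v; exact: sin_max.
move=> j k jk.
transitivity (\int[mu]_(v in I) (2^-1 * (cos ((k - j)%:R * v) - cos ((j + k)%:R * v)))).
  by apply: eq_Rintegral => v _; rewrite -cos_natB// natrD mulrDl cosB cosD; field.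
have b1 := bmf_cos (k - j)%:R; have b2 := bmf_cos (j + k)%:R.
rewrite RintegralZl//; last exact: (bmf_L1 (bmfB b1 b2)).
rewrite RintegralB//; [|exact: (bmf_L1 b1)|exact: (bmf_L1 b2)].
by rewrite !integral_cos_nat ?subn_gt0// ?subr0 ?mulr0// addn_gt0 (leq_trans _ jk) ?orbT.
Qed.

Definition dirichlet (N : nat) (t : R) : R := 2^-1 + \sum_(1 <= k < N.+1) cos (k%:R * t).

Lemma dirichletS N t : dirichlet N.+1 t = dirichlet N t + cos (N.+1%:R * t).
Proof. by rewrite /dirichlet big_nat_recr//= addrA. Qed.

(** Telescoping: [2 sin(t/2) cos(k t)] is a difference of consecutive sines. The product form stays
    valid where [sin(t/2) = 0]. *)
Lemma dirichletM N t : dirichlet N t * (2 * sin (t / 2)) = sin (N%:R * t + t / 2).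
Proof.
elim: N => [|N IH]; first by rewrite /dirichlet big_geq// mul0r add0r; field.
rewrite dirichletS mulrDl IH.
have -> : N%:R * t + t / 2 = N.+1%:R * t - t / 2 by rewrite -natr1; field.
by rewrite sinB sinD; ring.
Qed.

(** A crude constant suffices. On [[0, 1]] one has [sin y >= y / 2] and [cos y >= 1 / 2]; the
    doubling formula at [y = x / 4], which is at most 1, gives [x / 8]. *)
Lemma sin_half_ge (x : R) : 0 <= x <= pi -> x / 8 <= sin (x / 2).
Proof.
move=> /andP[x0 xpi]; have pi2 := @pihalf_lt2 R.
have c1 (y : R) : 0 <= y <= 1 -> 2^-1 <= cos y.
  move=> /andP[y0 y1]; have := @cos_ge_sqr R y; have : y ^+ 2 <= 1 by rewrite expr_le1.
  lra.
have s1 (y : R) : 0 <= y <= 1 -> y / 2 <= sin y.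
  move=> /andP[y0 y1]; pose F (t : R) := sin t - t / 2.
  have dF (t : R) : is_derive t 1 F (cos t - 2^-1).
    by apply: is_derive_eq; rewrite /GRing.scale/=; ring.
  have : F 0 <= F y.
    apply: (@ger0_derive1_le_cc R F 0 1) => //.
    - move=> t; rewrite in_itv/= => /andP[t0 t1]; rewrite derive1E; case: (dF t) => _ ->.
      by rewrite subr_ge0 c1// !ltW.
    - by apply: continuous_subspaceT; exact: (is_derive_continuous dF).
    - by rewrite in_itv/= lexx ler01.
    - by rewrite in_itv/= y0 y1.
  by rewrite /F sin0 mul0r subr0 subr_ge0.
have h : 0 <= x / 4 <= 1 by apply/andP; lra.
have -> : x / 2 = x / 4 *+ 2 by rewrite mulr2n; field.
rewrite sin_mulr2n.
have := s1 _ h; have := c1 _ h; have : 0 <= x / 4 by case/andP: h.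
by nra.
Qed.

Lemma integral_sin_nat (k : nat) : \int[mu]_(v in I) sin (k%:R * v) = 0.
Proof.
case: k => [|k]; first by under eq_Rintegral do rewrite mul0r sin0; rewrite Rintegral_cst_pi mulr0.
have k1 : k.+1%:R != 0 :> R by rewrite pnatr_eq0.
have d (x : R) : is_derive x 1 (fun t : R => - (cos (k.+1%:R * t) / k.+1%:R)) (sin (k.+1%:R * x)).
  by apply: is_derive_eq; rewrite /GRing.scale/=; field; rewrite addrC natr1.
have p0 := @pi_gt0 R.
rewrite (@FTC_seg _ (fun t => - (cos (k.+1%:R * t) / k.+1%:R)) (fun v => sin (k.+1%:R * v)))//.
- by rewrite mulrN cosN; ring.
- by lra.
- have dc (x : R) : is_derive x 1 (fun v : R => sin (k.+1%:R * v)) (k.+1%:R * cos (k.+1%:R * x)).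
    by apply: is_derive_eq; rewrite /GRing.scale/=; ring.
  exact: (is_derive_continuous dc).
Qed.

Definition fcos (g : R -> R) (k : nat) : R := \int[mu]_(v in I) (g v * cos (k%:R * v)).
Definition fsin (g : R -> R) (k : nat) : R := \int[mu]_(v in I) (g v * sin (k%:R * v)).

Definition fourier_sum (g : R -> R) (N : nat) (u : R) : R :=
  pi^-1 * (2^-1 * fcos g 0 + \sum_(1 <= k < N.+1) (fcos g k * cos (k%:R * u) + fsin g k * sin (k%:R * u))).

Lemma bmf_dirichlet N u : bmf (fun v => dirichlet N (u - v)).
Proof.
elim: N => [|N IH].
  have -> : (fun v => dirichlet 0 (u - v)) = (fun=> 2^-1); last exact: bmf_cst.
  by apply/funext => v; rewrite /dirichlet big_geq// addr0.
have -> : (fun v => dirichlet N.+1 (u - v)) = (fun v => dirichlet N (u - v) + cos (N.+1%:R * (u - v))).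
  by apply/funext => v; rewrite dirichletS.
by apply: bmfD => //; split; [meas|exists 1 => v _; exact: cos_max].
Qed.

Lemma fourier_sumE g N u : bmf g ->
  fourier_sum g N u = pi^-1 * \int[mu]_(v in I) (g v * dirichlet N (u - v)).
Proof.
move=> bg; congr (_ * _); elim: N => [|N IH].
  rewrite big_geq// addr0 /fcos -RintegralZl//; last exact: (bmf_L1 (bmfM bg (bmf_cos _))).
  by apply: eq_Rintegral => v _; rewrite /dirichlet big_geq// addr0 mul0r cos0; ring.
rewrite big_nat_recr//= addrA IH.
have b1 := bmfM bg (bmf_cos N.+1%:R); have b2 := bmfM bg (bmf_sin N.+1%:R).
have bD := bmfM bg (bmf_dirichlet N u).
rewrite /fcos /fsin (mulrC _ (cos _)) (mulrC _ (sin _)) -!RintegralZl//; try exact: bmf_L1.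
rewrite -!RintegralD//; try (apply: bmf_L1).
- apply: eq_Rintegral => v _; rewrite dirichletS (mulrBr N.+1%:R) cosB; ring.
- exact: bD.
- by apply: bmfD; exact: bmfZ.
- exact: bmfZ.
- exact: bmfZ.
Qed.

(** The Dirichlet kernel has total mass [pi]; this permits [g u] to be moved under the integral in
    [fourier_sum_sub]. *)
Lemma fourier_sum1 N u : fourier_sum (fun=> 1) N u = 1.
Proof.
rewrite /fourier_sum big1_seq ?addr0 => [|k].
  rewrite /fcos; under eq_Rintegral do rewrite mul0r cos0 mulr1.
  by rewrite Rintegral_cst_pi mulr1 mulKf ?mulVf// gt_eqF// pi_gt0.
rewrite mem_index_iota => /andP[_ /andP[k0 _]].
rewrite /fcos /fsin; under eq_Rintegral do rewrite mul1r.
rewrite integral_cos_nat// mul0r add0r.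
by under eq_Rintegral do rewrite mul1r; rewrite integral_sin_nat mul0r.
Qed.

Section lipschitz.
Variables (g : R -> R) (C : R).
Hypotheses (C0 : 0 <= C) (gL : forall u v, `|g u - g v| <= C * `|u - v|) (gpi : g (- pi) = g pi).

Lemma lipschitz_continuous : continuous g.
Proof.
move=> x; apply/cvgrPdist_le => /= e e0.
have C1 : 0 < C + 1 by rewrite ltr_wpDl.
exists (e / (C + 1)); first by rewrite /= divr_gt0.
move=> y /= xy; apply: le_trans (gL _ _) _.
apply: (@le_trans _ _ ((C + 1) * `|x - y|)); first by rewrite ler_wpM2r// lerDl.
by rewrite mulrC -ler_pdivlMr// ltW.
Qed.

Lemma lipschitz_measurable : measurable_fun setT g.
Proof. by apply: continuous_measurable_fun; exact: lipschitz_continuous. Qed.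

Lemma lipschitz_bmf : bmf g.
Proof.
split; first exact: lipschitz_measurable.
exists (`|g 0| + C * pi) => v; rewrite /= in_itv/= => /andP[v0 v1].
rewrite -[g v](subrK (g 0)) addrC; apply: le_trans (ler_normD _ _) _; rewrite lerD//.
by apply: le_trans (gL _ _) _; rewrite subr0 ler_wpM2l// ler_norml v0 v1.
Qed.

(** Difference quotient with respect to the circle; it takes the value 0 wherever the sine
    vanishes. *)
Definition dini (u v : R) : R := (g v - g u) / sin ((u - v) / 2).

Let sin_half_abs (d : R) : `|d| <= pi -> `|d| / 8 <= `|sin (d / 2)|.
Proof.
move=> h; have := @sin_half_ge `|d|; rewrite normr_ge0 h => /(_ isT) H; apply: le_trans H _.
by case: (ger0P d) => d0; rewrite ?ler_norm// mulNr sinN -[leRHS]normrN ler_norm.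
Qed.

(* d is the distance from u to v on the circle *)
Lemma circle_dist u v : I u -> I v ->
  exists d, [/\ 0 <= d, `|g v - g u| <= C * d & d / 8 <= `|sin ((u - v) / 2)|].
Proof.
rewrite /= !in_itv/= => /andP[u0 u1] /andP[v0 v1]; have p0 := @pi_gt0 R.
have [h|h] := leP `|u - v| pi.
  by exists `|u - v|; split; [exact: normr_ge0|rewrite distrC gL|exact: sin_half_abs].
have h2 : `|u - v| <= 2 * pi by rewrite ler_norml; apply/andP; lra.
exists (2 * pi - `|u - v|); split.
- by rewrite subr_ge0.
- move: h; case: (ger0P (u - v)) => w h.
    have -> : g v - g u = (g v - g (- pi)) + (g pi - g u) by rewrite gpi; ring.
    apply: le_trans (ler_normD _ _) _; apply: le_trans (lerD (gL _ _) (gL _ _)) _.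
    by rewrite !ger0_norm; lra.
  have -> : g v - g u = (g v - g pi) + (g (- pi) - g u) by rewrite gpi; ring.
  apply: le_trans (ler_normD _ _) _; apply: le_trans (lerD (gL _ _) (gL _ _)) _.
  by rewrite !ler0_norm; lra.
- have h3 : `|2 * pi - `|u - v| | <= pi by rewrite ger0_norm ?subr_ge0//; lra.
  have := sin_half_abs h3; rewrite {1}ger0_norm ?subr_ge0// => H; apply: le_trans H _.
  rewrite (_ : (2 * pi - `|u - v|) / 2 = pi - `|u - v| / 2); last by field.
  rewrite sinB sinpi mul0r sub0r cospi mulN1r opprK.
  by case: (ger0P (u - v)) => w //; rewrite mulNr sinN normrN.
Qed.

Lemma dini_le u v : I u -> I v -> `|dini u v| <= 8 * C.
Proof.
move=> Iu Iv; have [d [d0 h1 h2]] := circle_dist Iu Iv.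
have [s0|s0] := eqVneq (sin ((u - v) / 2)) 0; first by rewrite /dini s0 invr0 mulr0 normr0 mulr_ge0.
have s1 : 0 < `|sin ((u - v) / 2)| by rewrite normr_gt0.
rewrite normrM normfV ler_pdivrMr//; apply: le_trans h1 _.
by have := ler_wpM2l C0 h2; lra.
Qed.

(** Holds at zeros of the sine as well: the distance on the circle is 0 there, so [g v = g u]. This
    covers [v = u] and the pair of endpoints. *)
Lemma diniK u v : I u -> I v -> dini u v * sin ((u - v) / 2) = g v - g u.
Proof.
move=> Iu Iv; have [d [d0 h1 h2]] := circle_dist Iu Iv.
have [s0|s0] := eqVneq (sin ((u - v) / 2)) 0; last by rewrite /dini divfK.
rewrite s0 mulr0; apply/esym/eqP; rewrite -normr_le0.
by move: h2; rewrite s0 normr0 => h2; have -> : 0 = C * d by rewrite (_ : d = 0) ?mulr0//; lra.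
Qed.

Lemma bmf_dini u : I u -> bmf (dini u).
Proof.
move=> Iu; have mg := lipschitz_measurable; split; first by rewrite /dini; meas.
by exists (8 * C) => v; exact: dini_le.
Qed.

Lemma fourier_sum_sub N u : I u -> fourier_sum g N u - g u =
  pi^-1 * \int[mu]_(v in I) (2^-1 * (dini u v * sin (N%:R * (u - v) + (u - v) / 2))).
Proof.
move=> Iu; have bg := lipschitz_bmf; have bD := bmf_dirichlet N u.
have -> : g u = g u * fourier_sum (fun=> 1) N u by rewrite fourier_sum1 mulr1.
rewrite !fourier_sumE//; last exact: bmf_cst.
rewrite mulrCA -mulrBr -RintegralZl//; last exact: (bmf_L1 (bmfM (bmf_cst 1) bD)).
rewrite -RintegralB//; [|exact: (bmf_L1 (bmfM bg bD))|exact: (bmf_L1 (bmfZ _ (bmfM (bmf_cst 1) bD)))].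
congr (_ * _); apply: Rintegral_eq => v Iv.
rewrite -dirichletM mul1r -mulrBl -diniK//.
by move: (dini u v) (sin _) (dirichlet _ _) => x y z; field.
Qed.

(** The quotient is at most [8 C], the sine at most 1, and the length [2 pi] cancels [1 / (2 pi)]. A
    bound uniform in [N] is what dominated convergence against the kernel demands. *)
Lemma fourier_sum_bound N u : I u -> `|fourier_sum g N u - g u| <= 8 * C.
Proof.
move=> Iu; rewrite fourier_sum_sub// normrM.
have p0 := @pi_gt0 R.
rewrite ger0_norm ?invr_ge0 ?pi_ge0// ler_pdivrMl//.
have -> : pi * (8 * C) = \int[mu]_(v in I) (4 * C) by rewrite Rintegral_cst_pi; ring.
have [md _] := bmf_dini Iu.
apply: Rintegral_le_bound => //.
- by apply: measurable_funTS; meas.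
- move=> v Iv; rewrite normrM normrM (@ger0_norm _ 2^-1)//.
  have h1 := dini_le Iu Iv; have h2 := sin_max (N%:R * (u - v) + (u - v) / 2).
  apply: (@le_trans _ _ (2^-1 * (8 * C * 1))); last by lra.
  by rewrite ler_wpM2l// ler_pM.
Qed.

Let cvg0_mul (f h : nat -> R) : (forall n, `|h n| <= 1) -> f @ \oo --> 0 -> (fun n => h n * f n) @ \oo --> 0.
Proof.
move=> h1 /cvgrPdist_lt f0; apply/cvgrPdist_lt => e e0; move: (f0 e e0); apply: filterS => n.
by rewrite !sub0r !normrN normrM; apply: le_lt_trans; rewrite ler_piMl.
Qed.

(** Separating [sin (N (u - v) + (u - v) / 2)] leaves four Fourier coefficients of fixed bounded
    functions, multiplied by factors bounded by 1; Riemann-Lebesgue applies to each. *)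
Lemma cvg_fourier_sum u : I u -> (fun N => fourier_sum g N u) @ \oo --> g u.
Proof.
move=> Iu; have bd := bmf_dini Iu.
have bs : bmf (fun v => 2^-1 * (dini u v * sin ((u - v) / 2))).
  by apply/bmfZ/bmfM => //; split; [meas|exists 1 => v _; exact: sin_max].
have bc : bmf (fun v => 2^-1 * (dini u v * cos ((u - v) / 2))).
  by apply/bmfZ/bmfM => //; split; [meas|exists 1 => v _; exact: cos_max].
pose Ac N := \int[mu]_(v in I) (2^-1 * (dini u v * cos ((u - v) / 2)) * cos (N%:R * v)).
pose As N := \int[mu]_(v in I) (2^-1 * (dini u v * cos ((u - v) / 2)) * sin (N%:R * v)).
pose Bc N := \int[mu]_(v in I) (2^-1 * (dini u v * sin ((u - v) / 2)) * cos (N%:R * v)).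
pose Bs N := \int[mu]_(v in I) (2^-1 * (dini u v * sin ((u - v) / 2)) * sin (N%:R * v)).
have E N : fourier_sum g N u = g u + pi^-1 * ((sin (N%:R * u) * Ac N + - cos (N%:R * u) * As N) +
    (cos (N%:R * u) * Bc N + sin (N%:R * u) * Bs N)).
  rewrite -[LHS](subrK (g u)) addrC fourier_sum_sub//; congr (_ + _ * _).
  have b1 := bmfM bc (bmf_cos N%:R); have b2 := bmfM bc (bmf_sin N%:R).
  have b3 := bmfM bs (bmf_cos N%:R); have b4 := bmfM bs (bmf_sin N%:R).
  rewrite -!RintegralZl//; try exact: bmf_L1.
  rewrite -!RintegralD//; try by apply: bmf_L1; repeat first [exact: b1|exact: b2|exact: b3|exact: b4|apply: bmfD|apply: bmfZ].
  by apply: eq_Rintegral => v _; rewrite sinD mulrBr sinB cosB; ring.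
have -> : (fun N => fourier_sum g N u) = (fun N => g u + pi^-1 * ((sin (N%:R * u) * Ac N + - cos (N%:R * u) * As N) +
    (cos (N%:R * u) * Bc N + sin (N%:R * u) * Bs N))) by apply/funext.
rewrite -[X in _ --> X]addr0; apply: cvgD; first exact: cvg_cst.
rewrite -(mulr0 pi^-1); apply: cvgMr.
rewrite -[X in _ --> X]addr0 -[X in _ --> X + _]addr0 -[X in _ --> _ + X]addr0.
apply: cvgD; apply: cvgD; apply: cvg0_mul.
- by move=> n; exact: sin_max.
- exact: riemann_lebesgue_cos.
- by move=> n; rewrite normrN; exact: cos_max.
- exact: riemann_lebesgue_sin.
- by move=> n; exact: cos_max.
- exact: riemann_lebesgue_cos.
- by move=> n; exact: sin_max.
- exact: riemann_lebesgue_sin.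
Qed.

End lipschitz.
End fourier.

(** * A hyperbolic cosine integral *)

Section sech.
Context (R : realType).
Local Notation mu := (@lebesgue_measure R).
Local Notation I := (`[- pi, pi]%classic : set (measurableTypeR R)).
Local Notation Icy := (`[0 : R, +oo[%classic : set (measurableTypeR R)).
Local Notation Ioy := (`]0 : R, +oo[%classic : set (measurableTypeR R)).

Let mIcy : measurable Icy. Proof. exact: measurable_itv. Qed.
Let mIoy : measurable Ioy. Proof. exact: measurable_itv. Qed.

(** Equal to [(1 - tanh v) / 2], the version of the hyperbolic tangent that decays at [+oo]; its
    derivative is [- sech2 / 2]. *)
Definition fermi (v : R) : R := (expR (2 * v) + 1)^-1.

Let den_gt0 (v : R) : 0 < expR (2 * v) + 1. Proof. by rewrite addr_gt0// expR_gt0. Qed.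

Lemma is_derive_fermi (v : R) : is_derive v 1 fermi (- (2 * expR (2 * v) * fermi v ^+ 2)).
Proof.
have n0 : expR (2 * v) + 1 != 0 by rewrite gt_eqF.
have d : is_derive v 1 (fun v : R => expR (2 * v) + 1) (2 * expR (2 * v)).
  by apply: is_derive_eq; rewrite /GRing.scale/=; ring.
have [h1 h2] := @is_deriveV R (fun v : R => expR (2 * v) + 1) v _ 1 n0 d.
apply: DeriveDef; [exact: h1|rewrite h2].
by rewrite /fermi /GRing.scale/=; field.
Qed.
Local Existing Instance is_derive_fermi.

Lemma fermi_ge0 v : 0 <= fermi v. Proof. by rewrite invr_ge0 ltW. Qed.

Lemma fermi_le v : fermi v <= expR (- (2 * v)).
Proof. by rewrite expRN lef_pV2 ?posrE ?expR_gt0// lerDl. Qed.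

Lemma cvgy_fermi : fermi x @[x --> +oo] --> 0.
Proof.
have p2 : 0 < 2 :> R by [].
have /cvgrPdist_lt h := cvg_expRN p2; apply/cvgrPdist_lt => e e0; move: (h e e0); apply: filterS => x.
by rewrite !sub0r !normrN !ger0_norm ?expR_ge0 ?fermi_ge0//; apply/le_lt_trans/fermi_le.
Qed.

Lemma fermiN v : fermi (- v) = 1 - fermi v.
Proof.
rewrite /fermi mulrN expRN; field.
by rewrite !gt_eqF ?expR_gt0//= addrC.
Qed.

Lemma measurable_fermi : measurable_fun setT fermi.
Proof. by rewrite /fermi; meas. Qed.

Lemma L1_fermi : mu.-integrable Icy (EFin \o fermi).
Proof.
have p2 : 0 < 2 :> R by [].
apply: (@L1_le _ _ R mu Icy _ _ mIcy _ (L1_expRN_cy p2)).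
  by apply: measurable_funTS; exact: measurable_fermi.
by move=> v _; rewrite ger0_norm ?fermi_ge0// fermi_le.
Qed.

Definition sech2 (v : R) : R := 4 * expR (2 * v) * fermi v ^+ 2.

Lemma sech2_ge0 v : 0 <= sech2 v.
Proof. by rewrite /sech2 mulr_ge0 ?sqr_ge0// mulr_ge0// expR_ge0. Qed.

Lemma sech2N v : sech2 (- v) = sech2 v.
Proof.
rewrite /sech2 fermiN mulrN expRN /fermi; field.
by rewrite !gt_eqF ?expR_gt0.
Qed.

Lemma sech2_le v : sech2 v <= 4 * expR (- (2 * `|v|)).
Proof.
have h (t : R) : sech2 t <= 4 * expR (- (2 * t)).
  rewrite /sech2 -mulrA ler_wpM2l// expr2 mulrA.
  rewrite -[leRHS]mul1r; apply: ler_pM; rewrite ?mulr_ge0 ?expR_ge0 ?fermi_ge0 ?fermi_le//.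
  by rewrite ler_pdivrMr// mul1r lerDl.
by case: (ger0P v) => _ //; rewrite -sech2N.
Qed.

Lemma measurable_sech2 : measurable_fun setT sech2.
Proof. by have mf := measurable_fermi; rewrite /sech2; meas. Qed.

Lemma L1_sech2 : mu.-integrable setT (EFin \o sech2).
Proof.
have p2 : 0 < 2 :> R by [].
apply: (@L1_le _ _ R mu setT _ _ measurableT measurable_sech2 (L1Zl 4 measurableT (L1_expR_abs p2))).
by move=> v _; rewrite ger0_norm ?sech2_ge0// sech2_le.
Qed.

Let L1_mulsech (f : R -> R) D : measurable_fun setT f -> (forall x, `|f x| <= 1) -> measurable D ->
  mu.-integrable D (EFin \o (fun v => f v * sech2 v)).
Proof.
move=> mf f1 mD; apply: (@L1_le _ _ R mu D _ sech2) => //.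
- by have ms := measurable_sech2; apply: measurable_funTS; meas.
- exact: integrableS L1_sech2.
- by move=> v _; rewrite normrM (ger0_norm (sech2_ge0 v)) ler_piMl// sech2_ge0.
Qed.

(** Integration by parts; the constant 1 is [2 * fermi 0]. *)
Lemma integral_sech2_fermi (tau : R) :
  \int[mu]_(v in Icy) (cos (tau * v) * sech2 v) = 1 - 2 * tau * \int[mu]_(v in Icy) (sin (tau * v) * fermi v).
Proof.
have mc : measurable_fun setT (fun v => cos (tau * v)) by meas.
have i1 : mu.-integrable Icy (EFin \o (fun v => cos (tau * v) * sech2 v)).
  by apply: L1_mulsech => // x; exact: cos_max.
have i2 : mu.-integrable Icy (EFin \o (fun v => sin (tau * v) * fermi v)).
  apply: (@L1_le _ _ R mu Icy _ fermi) => //; last 2 first.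
  - exact: L1_fermi.
  - by move=> v _; rewrite normrM (ger0_norm (fermi_ge0 v)) ler_piMl ?fermi_ge0// sin_max.
  - by have mf := measurable_fermi; apply: measurable_funTS; meas.
have i3 := L1Zl (2 * tau) mIcy i2.
have d (x : R) : is_derive x 1 (fun v : R => - 2 * cos (tau * v) * fermi v) (cos (tau * x) * sech2 x + 2 * tau * (sin (tau * x) * fermi x)).
  by apply: is_derive_eq; rewrite /GRing.scale/= /sech2; ring.
have E : \int[mu]_(v in Icy) (cos (tau * v) * sech2 v + 2 * tau * (sin (tau * v) * fermi v)) = 1.
  rewrite (@FTC_cy _ (fun v => - 2 * cos (tau * v) * fermi v) (fun v => cos (tau * v) * sech2 v + 2 * tau * (sin (tau * v) * fermi v)) 0 0) //.
  - by rewrite /fermi !mulr0 cos0 expR0; field.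
  - pose f (v : R) := cos (tau * v) * sech2 v + 2 * tau * (sin (tau * v) * fermi v).
    apply: (@is_derive_continuous _ f ('D_1 f)) => t; rewrite /f /sech2; apply: DeriveDef => //.
  - exact: L1D.
  - apply: (cvg_trans _ (@cvgy0_mul_bounded _ fermi (fun v => - 2 * cos (tau * v)) 2 cvgy_fermi _)).
      by apply: near_eq_cvg; near=> x; rewrite mulrC.
    by move=> x; rewrite normrM normrN (@ger0_norm _ 2)// -[leRHS]mulr1 ler_wpM2l// cos_max.
move/eqP: E; rewrite RintegralD// RintegralZl// -subr_eq0 => /eqP; lra.
Unshelve. all: by end_near. Qed.

Lemma cos_natpi (k : nat) : cos (k%:R * pi) = (- 1) ^+ k :> R.
Proof.
elim: k => [|k IH]; first by rewrite mul0r cos0.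
by rewrite -natr1 mulrDl mul1r cosDpi IH exprS mulN1r.
Qed.

Lemma fermi_partial_sum (N : nat) (v : R) :
  \sum_(0 <= k < N) (- 1) ^+ k * expR (- (2 * k.+1%:R * v)) = fermi v * (1 - (- expR (- (2 * v))) ^+ N).
Proof.
elim: N => [|N IH]; first by rewrite big_geq// expr0 subrr mulr0.
rewrite big_nat_recr//= IH.
have -> : expR (- (2 * N.+1%:R * v)) = expR (- (2 * v)) ^+ N.+1.
  by rewrite -expRM_natl; congr expR; ring.
rewrite /fermi; set q := expR (- (2 * v)).
have -> : expR (2 * v) = q^-1 by rewrite /q expRN invrK.
have q0 : 0 < q by exact: expR_gt0.
rewrite !(exprNn q) !exprS; field.
by rewrite !gt_eqF//; lra.
Qed.

(** For [v > 0], [fermi] is a geometric series in [- e^(-2v)], with partial sums at most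
    [2 * fermi v]. *)
Lemma integral_sin_fermi (tau : R) :
  (fun N => \sum_(0 <= k < N) (- 1) ^+ k * (tau / ((2 * k.+1%:R) ^+ 2 + tau ^+ 2))) @ \oo -->
  \int[mu]_(v in Icy) (sin (tau * v) * fermi v).
Proof.
have e0 (k : nat) : 0 < 2 * k.+1%:R :> R by rewrite mulr_gt0// ltr0n.
pose f (N : nat) (v : R) := sin (tau * v) * \sum_(0 <= k < N) (- 1) ^+ k * expR (- (2 * k.+1%:R * v)).
have mf N : measurable_fun Icy (f N).
  have mfe := measurable_fermi; apply: measurable_funTS.
  have -> : f N = (fun v => sin (tau * v) * (fermi v * (1 - (- expR (- (2 * v))) ^+ N))); last by meas.
  by apply/funext => v; rewrite /f fermi_partial_sum.
have fE N : \int[mu]_(v in Icy) f N v = \sum_(0 <= k < N) (- 1) ^+ k * (tau / ((2 * k.+1%:R) ^+ 2 + tau ^+ 2)).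
  transitivity (\int[mu]_(v in Icy) \sum_(0 <= k < N) ((- 1) ^+ k * (expR (- (2 * k.+1%:R * v)) * sin (tau * v)))).
    by apply: eq_Rintegral => v _; rewrite /f mulr_sumr; apply: eq_bigr => k _; ring.
  have i1 (k : nat) := L1Zl ((- 1) ^+ k) mIcy (L1_expsin tau (e0 k)).
  rewrite (Rintegral_sum N mIcy i1).2; apply: eq_bigr => k _.
  by rewrite RintegralZl//; [rewrite integral_expsin|exact: L1_expsin].
under eq_fun do rewrite -fE.
apply: (@Rdominated_cvg _ _ R mu Icy f _ (fun v => 2 * fermi v) mIcy mf _ _ _).2.
(* At [v = 0] the geometric series diverges, but the factor [sin (tau * v)] vanishes. *)
- move=> v; rewrite /= in_itv/= andbT le_eqVlt => /orP[/eqP <-|v0].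
    by rewrite /f mulr0 sin0 mul0r; under eq_fun do rewrite mul0r; exact: cvg_cst.
  apply: cvgMr; under eq_fun do rewrite fermi_partial_sum.
  have h : (fun N => (- expR (- (2 * v))) ^+ N) @ \oo --> (0 : R).
    by apply: cvg_expr; rewrite normrN ger0_norm ?expR_ge0// expR_lt1 oppr_lt0 mulr_gt0.
  have : (fun N => fermi v * (1 - (- expR (- (2 * v))) ^+ N)) @ \oo --> fermi v * (1 - 0).
    by apply: cvgMr; apply: cvgB h; exact: cvg_cst.
  by rewrite subr0 mulr1.
- exact: L1Zl L1_fermi.
- move=> N v; rewrite /= in_itv/= andbT => v0.
  rewrite /f fermi_partial_sum normrM -[leRHS]mul1r ler_pM ?sin_max// mulrC normrM (ger0_norm (fermi_ge0 v)).
  rewrite ler_wpM2r ?fermi_ge0//; apply: le_trans (ler_normB _ _) _.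
  rewrite normr1 normrX normrN ger0_norm ?expR_ge0// lerD2l exprn_ile1 ?expR_ge0//.
  by rewrite expR_le1 oppr_le0 mulr_ge0.
Qed.

(** Composition with this 1-Lipschitz retraction extends a function that is Lipschitz on [[-pi, pi]]
    to one that is Lipschitz on the line. *)
Definition clamp (x : R) : R := Num.max (- pi) (Num.min x pi).

Lemma clamp_id x : I x -> clamp x = x.
Proof. by rewrite /= in_itv/= => /andP[x0 x1]; rewrite /clamp (min_idPl x1) (max_idPr x0). Qed.

Lemma clamp_itv x : I (clamp x).
Proof.
have p0 := @pi_gt0 R.
by rewrite /= in_itv/= /clamp le_max lexx/= ge_max ge_min lexx orbT andbT; lra.
Qed.

Lemma clamp_lipschitz u v : `|clamp u - clamp v| <= `|u - v|.
Proof.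
have p0 := @pi_gt0 R.
have P x : [\/ clamp x = - pi /\ x <= - pi, clamp x = x /\ - pi <= x <= pi | clamp x = pi /\ pi <= x].
  case: (leP x (- pi)) => h1; [apply: Or31|case: (leP x pi) => h2; [apply: Or32|apply: Or33]].
  - by split => //; rewrite /clamp; apply/max_idPl; rewrite ge_min h1.
  - by split; [apply: clamp_id; rewrite /= in_itv/= h2 ltW|rewrite (ltW h1)].
  - by split; [rewrite /clamp (min_idPr (ltW h2)); apply/max_idPr; lra|exact: ltW].
have h := ler_norm (u - v); have h' := ler_norm (v - u); rewrite distrC in h'.
rewrite ler_norml.
by case: (P u) => -[-> h1]; case: (P v) => -[-> h2]; apply/andP; split; lra.
Qed.

Lemma expR_lipschitz (M a b : R) : a <= M -> b <= M -> `|expR a - expR b| <= expR M * `|a - b|.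
Proof.
wlog ab : a b / b <= a.
  by move=> H aM bM; case: (leP b a) => [/H|/ltW /H]; [exact|rewrite distrC (distrC a); exact].
move=> aM bM; rewrite !ger0_norm ?subr_ge0 ?ler_expR//.
have h1 : expR b = expR a * expR (b - a) by rewrite -expRD addrC subrK.
have h2 := expR_ge1Dx (b - a); have h3 := expR_gt0 a.
have h4 : expR a <= expR M by rewrite ler_expR.
have : expR a * (1 + (b - a)) <= expR b by rewrite h1 ler_wpM2l// ltW.
have : expR a * (a - b) <= expR M * (a - b) by rewrite ler_wpM2r// subr_ge0.
lra.
Qed.

Lemma cosh_lipschitz (M a b : R) : `|a| <= M -> `|b| <= M -> `|cosh a - cosh b| <= expR M * `|a - b|.
Proof.
move=> /ler_normlP[a0 a1] /ler_normlP[b0 b1].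
have h1 := expR_lipschitz a1 b1; have h2 := expR_lipschitz a0 b0.
have -> : cosh a - cosh b = 2^-1 * (expR a - expR b) + 2^-1 * (expR (- a) - expR (- b)) by rewrite /cosh; field.
apply: le_trans (ler_normD _ _) _; rewrite !normrM (@ger0_norm _ 2^-1)//.
have : `|- a - - b| = `|a - b| by rewrite -opprD normrN.
move=> e; rewrite e in h2; lra.
Qed.

Lemma sinhN (x : R) : sinh (- x) = - sinh x.
Proof. by rewrite /sinh opprK; field. Qed.

Lemma coshN (x : R) : cosh (- x) = cosh x.
Proof. by rewrite /cosh opprK addrC. Qed.

Lemma integral_cosh_cos (tau : R) (k : nat) : 0 < tau ->
  \int[mu]_(v in I) (cosh (tau / 2 * v) * cos (k%:R * v)) =
  4 * tau * sinh (tau / 2 * pi) * (- 1) ^+ k / (tau ^+ 2 + (2 * k%:R) ^+ 2).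
Proof.
move=> t0; pose D := tau ^+ 2 / 4 + k%:R ^+ 2.
have t2 : 0 < tau ^+ 2 by rewrite exprn_gt0.
have D0 : 0 < D by rewrite ltr_pwDl ?sqr_ge0// divr_gt0.
have D1 : D != 0 by rewrite gt_eqF.
have D2 : tau ^+ 2 + (2 * k%:R) ^+ 2 = 4 * D by rewrite /D; field.
pose F (v : R) := (tau / 2 * sinh (tau / 2 * v) * cos (k%:R * v) + k%:R * cosh (tau / 2 * v) * sin (k%:R * v)) / D.
have d (x : R) : is_derive x 1 F (cosh (tau / 2 * x) * cos (k%:R * x)).
  rewrite /F /cosh /sinh; apply: is_derive_eq; rewrite /GRing.scale/= /D; field.
  by move: D1; rewrite /D => h; apply: contra h => /eqP h; apply/eqP; rewrite -(mulr0 4^-1) -h; field.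
have p0 := @pi_gt0 R.
rewrite (@FTC_seg _ F)//; last 2 first.
- by lra.
- pose f (v : R) := cosh (tau / 2 * v) * cos (k%:R * v).
  by apply: (@is_derive_continuous _ f ('D_1 f)) => t; rewrite /f /cosh; apply: DeriveDef.
rewrite /F !mulrN !sinN !cosN sinhN coshN sin_natpi cos_natpi D2; field.
exact: D1.
Qed.

(** The Fourier series of [cosh (tau v / 2)] at 0 and the series for the integral of
    [sin (tau v) fermi v] contain the same alternating sum; the argument [tau / 2] makes the
    denominators [(2k)^2 + tau^2] agree. *)
Lemma kappa_half (tau : R) : 0 < tau ->
  \int[mu]_(v in Icy) (cos (tau * v) * sech2 v) = pi * tau / (2 * sinh (tau / 2 * pi)).
Proof.
move=> t0; have p0 := @pi_gt0 R; set S := sinh _.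
have S0 : 0 < S by rewrite sinh_gt0// mulr_gt0// divr_gt0.
pose g v := cosh (tau / 2 * clamp v).
have t2 : 0 < tau / 2 by rewrite divr_gt0.
pose C := expR (tau / 2 * pi) * (tau / 2).
have C0 : 0 <= C by rewrite mulr_ge0 ?expR_ge0// ltW.
have gL u v : `|g u - g v| <= C * `|u - v|.
  have b (x : R) : `|tau / 2 * clamp x| <= tau / 2 * pi.
    rewrite normrM gtr0_norm// ler_wpM2l ?(ltW t2)//.
    by rewrite ler_norml; have := clamp_itv x; rewrite /= in_itv.
  apply: le_trans (cosh_lipschitz (b u) (b v)) _.
  rewrite /C -(mulrA (expR _)) ler_wpM2l ?expR_ge0// -mulrBr normrM gtr0_norm// ler_wpM2l ?(ltW t2)//.
  exact: clamp_lipschitz.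
have Ipi : I pi by rewrite /= in_itv/=; lra.
have INpi : I (- pi) by rewrite /= in_itv/=; lra.
have I0 : I 0 by rewrite /= in_itv/=; lra.
have gpi : g (- pi) = g pi by rewrite /g !clamp_id// mulrN coshN.
have := cvg_fourier_sum C0 gL gpi I0.
have -> : g 0 = 1 by rewrite /g clamp_id// mulr0 /cosh oppr0 expR0; field.
have fE k : fcos g k = 4 * tau * S * (- 1) ^+ k / (tau ^+ 2 + (2 * k%:R) ^+ 2).
  rewrite -integral_cosh_cos//; apply: Rintegral_eq => v Iv.
  by rewrite /g clamp_id.
have sE N : fourier_sum g N 0 = pi^-1 * (S * (2 / tau - 4 * \sum_(0 <= k < N) (- 1) ^+ k * (tau / ((2 * k.+1%:R) ^+ 2 + tau ^+ 2)))).
  congr (_ * _); rewrite mulrBr; congr (_ + _).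
    by rewrite fE expr0 mulr0 expr0n/= addr0; field; rewrite gt_eqF.
  rewrite big_add1/= mulr_sumr mulr_sumr -sumrN; apply: eq_bigr => k _.
  rewrite fE mulr0 cos0 sin0 mulr0 addr0 mulr1 exprS (addrC (tau ^+ 2)) mulN1r !mulrN mulNr; congr (- _); ring.
under eq_fun do rewrite sE.
move=> H; have H2 : (fun N => pi^-1 * (S * (2 / tau - 4 * \sum_(0 <= k < N) (- 1) ^+ k * (tau / ((2 * k.+1%:R) ^+ 2 + tau ^+ 2))))) @ \oo -->
   pi^-1 * (S * (2 / tau - 4 * \int[mu]_(v in Icy) (sin (tau * v) * fermi v))).
  apply: cvgMr; apply: cvgMr; apply: cvgB; first exact: cvg_cst.
  by apply: cvgMr; exact: integral_sin_fermi.
have := cvg_unique (@norm_hausdorff _ _) H H2; rewrite integral_sech2_fermi.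
set J := \int[mu]_(v in _) _ => E.
have -> : J = (2 / tau - pi / S) / 4.
  have -> : pi / S = pi / S * (pi^-1 * (S * (2 / tau - 4 * J))) by rewrite -E mulr1.
  by move: (@pi R) p0 => q q0; field; rewrite !gt_eqF.
by move: (@pi R) => q; field; rewrite !gt_eqF.
Qed.

Lemma integral_cos_sech2 (tau : R) : 0 < tau ->
  \int[mu]_v (cos (tau * v) * sech2 v) = pi * tau / sinh (tau / 2 * pi).
Proof.
move=> t0; have ms := measurable_sech2.
have mf : measurable_fun setT (fun v => cos (tau * v) * sech2 v) by meas.
have ev (v : R) : cos (tau * - v) * sech2 (- v) = cos (tau * v) * sech2 v by rewrite mulrN cosN sech2N.
have i1 : mu.-integrable Icy (EFin \o (fun v => cos (tau * v) * sech2 v)).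
  by apply: L1_mulsech => //; [meas|move=> x; exact: cos_max].
rewrite (Rintegral_even mf ev i1).2 kappa_half//; field.
by rewrite gt_eqF// sinh_gt0// mulr_gt0 ?pi_gt0// divr_gt0.
Qed.

Lemma integral_sin_sech2 (tau : R) : \int[mu]_v (sin (tau * v) * sech2 v) = 0.
Proof.
have ms := measurable_sech2.
have mf : measurable_fun setT (fun v => sin (tau * v) * sech2 v) by meas.
have i1 : mu.-integrable setT (EFin \o (fun v => sin (tau * v) * sech2 v)).
  by apply: L1_mulsech => //; [meas|move=> x; exact: sin_max].
have := (Rintegral_opp mf).2.
have -> : \int[mu]_t (sin (tau * - t) * sech2 (- t)) = - 1 * \int[mu]_t (sin (tau * t) * sech2 t).
  by rewrite -RintegralZl//; apply: eq_Rintegral => v _; rewrite mulrN sinN sech2N; ring.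
lra.
Qed.

Lemma integral_sin_sech2_shift (tau u : R) : 0 < tau ->
  mu.-integrable setT (EFin \o (fun v => sin (tau * v) * sech2 (v - u))) /\
  \int[mu]_v (sin (tau * v) * sech2 (v - u)) = sin (tau * u) * (pi * tau / sinh (tau / 2 * pi)).
Proof.
move=> t0; have ms := measurable_sech2.
have ms2 : measurable_fun setT (fun v : R => sech2 (v - u)) by apply: (measurableT_comp ms); meas.
have mf : measurable_fun setT (fun v => sin (tau * v) * sech2 (v - u)) by meas.
have [E1 ->] := Rintegral_shift u mf.
have E : (fun t => sin (tau * (t + u)) * sech2 (t + u - u)) =
  (fun t => cos (tau * u) * (sin (tau * t) * sech2 t) + sin (tau * u) * (cos (tau * t) * sech2 t)).
  by apply/funext => t; rewrite addrK mulrDr sinD; ring.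
have i1 : mu.-integrable setT (EFin \o (fun v => sin (tau * v) * sech2 v)).
  by apply: L1_mulsech => //; [meas|move=> x; exact: sin_max].
have i2 : mu.-integrable setT (EFin \o (fun v => cos (tau * v) * sech2 v)).
  by apply: L1_mulsech => //; [meas|move=> x; exact: cos_max].
have i3 := L1Zl (cos (tau * u)) measurableT i1; have i4 := L1Zl (sin (tau * u)) measurableT i2.
split; first by apply/E1; rewrite E; exact: L1D.
by rewrite E RintegralD// !RintegralZl// integral_sin_sech2 integral_cos_sech2// mulr0 add0r.
Qed.

Lemma sech2_cosh v : sech2 v = (cosh v ^+ 2)^-1.
Proof.
rewrite /sech2 /fermi /cosh expRN -[2 * v]/(2 * v) (_ : 2 * v = v + v) ?expRD; last by ring.
have e0 := expR_gt0 v; field.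
by rewrite !gt_eqF// addr_gt0// mulr_gt0.
Qed.

Lemma cosh2E (v : R) : cosh v ^+ 2 = 1 + sinh v ^+ 2.
Proof. by have e0 := expR_gt0 v; rewrite /cosh /sinh expRN; field; rewrite gt_eqF. Qed.

(** Half the difference [tanh (v + u) - tanh (v - u)], in a form whose two terms are translates of
    [fermi]. *)
Lemma fermi_diff u v : fermi (v - u) - fermi (v + u) = sinh u * (cosh u / (cosh u ^+ 2 + sinh v ^+ 2)).
Proof.
have e0 := expR_gt0 u; have f0 := expR_gt0 v.
rewrite /fermi /cosh /sinh !mulrBr !mulrDr !(expRD, expRN) ![expR (2 * _)]expRM_natl.
set E := expR u in e0 *; set F := expR v in f0 *.
field.
have E2 : 0 < E ^+ 2 by rewrite exprn_gt0.
have F2 : 0 < F ^+ 2 by rewrite exprn_gt0.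
have P (a b : R) : 0 < a -> 0 <= b -> a + b != 0 by move=> a0 b0; rewrite gt_eqF// ltr_pwDl.
apply/and5P; split.
- by rewrite gt_eqF.
- by rewrite gt_eqF.
- by apply: P; [rewrite exprn_gt0// mulr_gt0// ltr_wpDl// mulr_ge0// ltW|exact: sqr_ge0].
- by rewrite addrC P ?sqr_ge0.
- exact: P (ltW E2).
Qed.

Lemma is_derive_fermiD (c v : R) :
  is_derive v 1 (fun t => fermi (t + c)) (- (2 * expR (2 * (v + c)) * fermi (v + c) ^+ 2)).
Proof.
have d1 : is_derive v 1 (fun t : R => t + c) 1 by apply: is_derive_eq; rewrite addr0.
have [h1 h2] := @is_derive1_comp R fermi (fun t => t + c) v _ _ (is_derive_fermi (v + c)) d1.
by apply: DeriveDef; [exact: h1|rewrite h2 mulr1].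
Qed.
Local Existing Instance is_derive_fermiD.

(** The denominator is at least [1 + sinh^2 v = cosh^2 v], so the kernel is dominated by the square
    of the hyperbolic secant. *)
Lemma sinh_kernel_le (u v : R) : `|cosh u / (cosh u ^+ 2 + sinh v ^+ 2)| <= `|cosh u| * (4 * expR (- (2 * `|v|))).
Proof.
rewrite normrM ler_wpM2l//.
have c1 : 1 <= cosh u ^+ 2 by rewrite cosh2E lerDl sqr_ge0.
have s0 := sqr_ge0 (sinh v).
apply: le_trans (sech2_le v); rewrite sech2_cosh (cosh2E v) ger0_norm ?invr_ge0; last by lra.
by rewrite lef_pV2 ?posrE; lra.
Qed.

Lemma L1_sinh_kernel (u : R) (f : R -> R) : measurable_fun setT f -> (forall x, `|f x| <= 1) ->
  mu.-integrable setT (EFin \o (fun v => f v * (cosh u / (cosh u ^+ 2 + sinh v ^+ 2)))).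
Proof.
move=> mf f1; have p2 : 0 < 2 :> R by [].
apply: (@L1_le _ _ R mu setT _ _ measurableT _ (L1Zl `|cosh u| measurableT (L1Zl 4 measurableT (L1_expR_abs p2)))).
  by rewrite /sinh; meas.
by move=> v _; rewrite normrM; apply: le_trans (sinh_kernel_le u v); rewrite ler_piMl.
Qed.

Lemma integral_cos_sinh (tau u : R) : 0 < tau ->
  sinh u * \int[mu]_(v in Ioy) (cos (tau * v) * (cosh u / (cosh u ^+ 2 + sinh v ^+ 2))) =
  pi / 2 * sin (tau * u) / sinh (tau / 2 * pi).
Proof.
move=> t0; pose k (v : R) := cosh u / (cosh u ^+ 2 + sinh v ^+ 2).
have mc : measurable_fun setT (fun v => cos (tau * v)) by meas.
have iD : mu.-integrable setT (EFin \o (fun v => cos (tau * v) * k v)).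
  by apply: L1_sinh_kernel => // x; exact: cos_max.
have iDy : mu.-integrable Icy (EFin \o (fun v => cos (tau * v) * k v)) by exact: integrableS iD.
have iDo : mu.-integrable Ioy (EFin \o (fun v => cos (tau * v) * k v)) by exact: integrableS iD.
have ev (v : R) : cos (tau * - v) * k (- v) = cos (tau * v) * k v.
  by rewrite mulrN cosN /k sinhN sqrrN.
rewrite Rintegral_itv_obnd_cbnd//.
have e2 := (Rintegral_even (L1_measurable iD) ev iDy).2.
have [i3 e3] := integral_sin_sech2_shift u t0.
have [i4 e4] := integral_sin_sech2_shift (- u) t0.
have i5 := L1Zl (- 2^-1) measurableT i3; have i6 := L1Zl 2^-1 measurableT i4.
have i7 := L1Zl (tau * sinh u) measurableT iD.
(* [F] vanishes at both ends, so its derivative integrates to 0; this trades the wanted cosine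
   integral for two translated integrals of [sech2]. *)
pose F (v : R) := sin (tau * v) * (fermi (v + - u) - fermi (v + u)).
pose f (v : R) := tau * sinh u * (cos (tau * v) * k v) + - 2^-1 * (sin (tau * v) * sech2 (v - u)) + 2^-1 * (sin (tau * v) * sech2 (v - - u)).
have fE (v : R) : f v = tau * (cos (tau * v) * (fermi (v + - u) - fermi (v + u))) + - 2^-1 * (sin (tau * v) * sech2 (v + - u)) + 2^-1 * (sin (tau * v) * sech2 (v + u)).
  by rewrite /f /k opprK fermi_diff; ring.
have dF (x : R) : is_derive x 1 F (f x).
  by rewrite /F; apply: is_derive_eq; rewrite fE /GRing.scale/= /sech2; field.
have cf : continuous f.
  have -> : f = (fun v => tau * (cos (tau * v) * (fermi (v + - u) - fermi (v + u))) + - 2^-1 * (sin (tau * v) * sech2 (v + - u)) + 2^-1 * (sin (tau * v) * sech2 (v + u))).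
    exact/funext.
  pose h (v : R) := tau * (cos (tau * v) * (fermi (v + - u) - fermi (v + u))) + - 2^-1 * (sin (tau * v) * sech2 (v + - u)) + 2^-1 * (sin (tau * v) * sech2 (v + u)).
  by apply: (@is_derive_continuous _ h ('D_1 h)) => t; rewrite /h /sech2; apply: DeriveDef.
have Fb (x : R) : `|F x| <= `|sinh u| * `|cosh u| * 4 * expR (- (2 * `|x|)).
  rewrite /F fermi_diff normrM normrM; apply: le_trans (ler_piMl _ _) _ => //.
    exact: sin_max.
  by rewrite -!mulrA ler_wpM2l// mulrA; have := sinh_kernel_le u x; rewrite normrM mulrA.
have p2 : 0 < 2 :> R by [].
have := @FTC_T _ F f 0 0 dF cf (L1D measurableT (L1D measurableT i7 i5) i6) (cvgy0_expR_abs p2 Fb) (cvgNy0_expR_abs p2 Fb).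
rewrite /f RintegralD//; last exact: L1D.
rewrite RintegralD// !RintegralZl// e3 e4 e2 mulrN sinN subr0.
set S := sinh (tau / 2 * pi); set J := \int[mu]_(x in _) _ => E.
have S0 : 0 < S by rewrite sinh_gt0// mulr_gt0 ?pi_gt0// divr_gt0.
have -> : sinh u * J = (tau * sinh u * (2 * J)) / tau / 2 by field; rewrite gt_eqF.
have -> : tau * sinh u * (2 * J) = sin (tau * u) * (pi * tau / S) by lra.
by field; rewrite !gt_eqF.
Qed.

End sech.

(** * Expansion of the kernel *)

Section parametric.
Context d1 d2 (T1 : measurableType d1) (T2 : measurableType d2) (R : realType).
Variable m2 : {sigma_finite_measure set T2 -> \bar R}.

Lemma measurable_Rintegral_param (D : set T2) (f : T1 -> T2 -> R) : measurable D ->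
  measurable_fun setT (fun z : T1 * T2 => f z.1 z.2) ->
  measurable_fun setT (fun x => \int[m2]_(y in D) f x y).
Proof.
move=> mD mf.
(* The values [s = 1] and [s = -1] give the positive and the negative part. Tonelli makes both
   integrals measurable in [x], so no integrability is involved. *)
have mp (s : R) : measurable_fun setT (fun x => \int[m2]_(y in D) (Num.max (s * f x y) 0)%:E)%E.
  pose F (z : T1 * T2) : \bar R := (Num.max (s * f z.1 z.2) 0 * \1_D z.2)%:E.
  have mF : measurable_fun setT F.
    apply/measurable_EFinP; apply: measurable_funM.
      by apply: measurable_maxr; [apply: measurable_funM|]; rewrite //; exact: measurable_cst.
    by apply: (measurableT_comp (measurable_indic mD)).
  have F0 z : (0 <= F z)%E by rewrite lee_fin mulr_ge0// le_max lexx orbT.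
  have := @measurable_fun_fubini_tonelli_F _ _ T1 T2 R m2 F mF F0.
  congr (measurable_fun _ _); apply/funext => x; rewrite /fubini_F /F.
  rewrite [RHS]integral_mkcond; apply: eq_integral => y _.
  by rewrite patchE indicE; case: (y \in D); rewrite ?mulr1 ?mulr0.
have E x : \int[m2]_(y in D) f x y = fine (\int[m2]_(y in D) (Num.max (1 * f x y) 0)%:E - \int[m2]_(y in D) (Num.max (-1 * f x y) 0)%:E)%E.
  rewrite /Rintegral integralE; congr (fine (_ - _)%E); apply: eq_integral => y _.
    by rewrite funeposE/= mul1r EFin_max.
  by rewrite funenegE/= mulN1r EFin_max.
under eq_fun do rewrite E.
by apply: measurableT_comp => //; apply: emeasurable_funB.
Qed.

End parametric.

(** * Recovering the product of J and K from the line integral *)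

Section product_formula.
Context (R : realType) (tau : R).
Local Notation mu := (@lebesgue_measure R).
Local Notation Icy := (`[0 : R, +oo[%classic : set (measurableTypeR R)).

Lemma bessel_gauss_center (xi t : R) : bessel_gauss xi (t + xi / 2) = expR (- macX xi t).
Proof.
rewrite /bessel_gauss /macX (_ : xi - (t + xi / 2) = xi / 2 - t); last by field.
by rewrite (addrC t).
Qed.

(** Centred at [th = xi / 2], the exponential is even in [t]. The sine part of the phase therefore
    integrates to 0, and the cosine part gives twice the half-line integral of K. *)
Lemma bessel_prod_phase (xi : R) :
  2^-1 * bessel_prod tau xi = bessel_phase tau xi (xi / 2) * \int[mu]_(t in Icy) (expR (- macX xi t) * cos (tau * t)).
Proof.
have mX := measurable_macX xi.
have i0 := L1_expR_macX xi ltr01.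
have e1 (t : R) : expR (- (1 * macX xi t)) = expR (- macX xi t) by rewrite mul1r.
have ib (f : R -> R) : measurable_fun setT f -> (forall x, `|f x| <= 1) ->
    mu.-integrable setT (EFin \o (fun t => expR (- macX xi t) * f t)).
  move=> mf f1; apply: (@L1_le _ _ R mu setT _ _ measurableT _ i0); first by meas.
  by move=> t _; rewrite normrM ger0_norm ?expR_ge0// e1 ler_piMr// expR_ge0.
have mc : measurable_fun setT (fun t : R => cos (tau * t)) by meas.
have ms : measurable_fun setT (fun t : R => sin (tau * t)) by meas.
have ic := ib _ mc (fun x => cos_max _); have isn := ib _ ms (fun x => sin_max _).
have s0 : \int[mu]_t (expR (- macX xi t) * sin (tau * t)) = 0.
  have := (Rintegral_opp (L1_measurable isn)).2.
  have -> : \int[mu]_t (expR (- macX xi (- t)) * sin (tau * - t)) = - 1 * \int[mu]_t (expR (- macX xi t) * sin (tau * t)).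
    by rewrite -RintegralZl//; apply: eq_Rintegral => t _; rewrite macXN mulrN sinN; ring.
  lra.
have ev (t : R) : expR (- macX xi (- t)) * cos (tau * - t) = expR (- macX xi t) * cos (tau * t).
  by rewrite macXN mulrN cosN.
have icy : mu.-integrable Icy (EFin \o (fun t => expR (- macX xi t) * cos (tau * t))).
  by apply: integrableS ic => //; exact: measurable_itv.
have e2 := (Rintegral_even (L1_measurable ic) ev icy).2.
have mph : measurable_fun setT (fun th => bessel_phase tau xi th * bessel_gauss xi th).
  by rewrite /bessel_phase /bessel_gauss; meas.
rewrite /bessel_prod (Rintegral_shift (xi / 2) mph).2.
pose A := bessel_phase tau xi (xi / 2).
pose B := - (besselP tau xi * sin (tau * (xi / 2)) + besselQ tau xi * cos (tau * (xi / 2))).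
have -> : \int[mu]_t (bessel_phase tau xi (t + xi / 2) * bessel_gauss xi (t + xi / 2)) =
   \int[mu]_t (A * (expR (- macX xi t) * cos (tau * t)) + B * (expR (- macX xi t) * sin (tau * t))).
  apply: eq_Rintegral => t _; rewrite bessel_gauss_center /A /B /bessel_phase (mulrDr tau) cosD sinD; ring.
have i3 := L1Zl A measurableT ic; have i4 := L1Zl B measurableT isn.
by rewrite RintegralD// !RintegralZl// s0 e2 mulr0 addr0 -/A; field.
Qed.

End product_formula.

(** * The kernel on [[-pi, pi]]: index integral, coefficients and series *)

Section kernel.
Context (R : realType).
Local Notation mu := (@lebesgue_measure R).
Local Notation I := (`[- pi, pi]%classic : set (measurableTypeR R)).
Local Notation Icy := (`[0 : R, +oo[%classic : set (measurableTypeR R)).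
Local Notation Ioy := (`]0 : R, +oo[%classic : set (measurableTypeR R)).

Let mI : measurable I. Proof. exact: measurable_itv. Qed.
Let mIcy : measurable Icy. Proof. exact: measurable_itv. Qed.

(** At [xi = ln (2 x)] this is minus [sinh u] times the imaginary part of [K_0] in the theorem; it
    is odd in [u]. *)
Definition kerS (xi u : R) : R := sinh u * macD (Num.sqrt (cosh u)) xi.

Lemma cosh_ge1 (u : R) : 1 <= cosh u.
Proof.
have h := expR_gt0 u; rewrite /cosh expRN ler_pdivlMr// mul1r.
rewrite -subr_ge0 (_ : _ - _ = (expR u - 1) ^+ 2 / expR u); last by field; rewrite gt_eqF.
by rewrite divr_ge0 ?sqr_ge0// ltW.
Qed.

Lemma kerSN xi u : kerS xi (- u) = - kerS xi u.
Proof. by rewrite /kerS sinhN coshN mulNr. Qed.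

Lemma measurable_kerS2 : measurable_fun setT (fun z : R * R => kerS z.1 z.2).
Proof.
apply: measurable_funM; first by rewrite /sinh; meas.
apply: (@measurable_Rintegral_param _ _ _ _ R mu Icy (fun (z : R * R) q =>
  expR (- (Num.sqrt (cosh z.2) * macX z.1 q)) * sin (Num.sqrt (cosh z.2) * macX z.1 q)) mIcy).
have h1 : measurable_fun setT (fun z : (R * R) * R => z.1.1) by apply: measurableT_comp.
have h2 : measurable_fun setT (fun z : (R * R) * R => z.1.2) by apply: measurableT_comp.
by rewrite /macX /cosh; meas.
Qed.

Lemma measurable_kerS xi : measurable_fun setT (kerS xi).
Proof. by apply: (measurableT_comp measurable_kerS2 (pair1_measurable xi)). Qed.

Lemma macD_le (p xi : R) : 1 <= p -> `|macD p xi| <= mac0 1 xi.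
Proof.
move=> p1; have mX := measurable_macX xi; apply: Rintegral_le_bound => //.
- by apply: measurable_funTS; meas.
- exact: L1_expR_macX_cy.
- move=> q _; rewrite normrM ger0_norm ?expR_ge0//.
  have X0 := macX_gt0 xi q.
  apply: (@le_trans _ _ (expR (- (p * macX xi q)))); first by rewrite ler_piMr ?expR_ge0// sin_max.
  by rewrite ler_expR lerN2 ler_wpM2r// ltW.
Qed.

Lemma mac0_ge0 (p xi : R) : 0 <= mac0 p xi.
Proof. by apply: Rintegral_ge0 => q _; exact: expR_ge0. Qed.

Lemma kerS_le xi u : I u -> `|kerS xi u| <= expR pi * mac0 1 xi.
Proof.
rewrite /= in_itv/= => /andP[u0 u1]; rewrite normrM ler_pM//.
  have h1 : expR u <= expR pi by rewrite ler_expR.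
  have h2 : expR (- u) <= expR pi by rewrite ler_expR; lra.
  have h3 := expR_gt0 u; have h4 := expR_gt0 (- u).
  by rewrite /sinh ler_norml; apply/andP; split; lra.
by apply: macD_le; rewrite -sqrtr1 ler_wsqrtr// cosh_ge1.
Qed.

Lemma bmf_kerS xi : bmf (kerS xi).
Proof. by split; [exact: measurable_kerS|exists (expR pi * mac0 1 xi) => u /kerS_le]. Qed.

(** The continued identity at [p^2 = cosh u], multiplied by [sinh u], followed by
    [integral_cos_sinh]; the factors [1/4] and [pi/2] make [pi/8]. *)
Lemma integral_bessel_kerS (n : nat) (u : R) : (0 < n)%N ->
  \int[mu]_xi (expR xi * bessel_prod n%:R xi * kerS xi u) =
  pi / 8 * sin (n%:R * u) / sinh (n%:R / 2 * pi).
Proof.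
move=> n0; have n1 : 0 < n%:R :> R by rewrite ltr0n.
have c1 := cosh_ge1 u; have c0 : 0 < cosh u by lra.
have p0 : 0 < Num.sqrt (cosh u) by rewrite sqrtr_gt0.
have i1 := (int_space1_sin n%:R p0).1.
transitivity (\int[mu]_xi (sinh u * (expR xi * bessel_prod n%:R xi * macD (Num.sqrt (cosh u)) xi))).
  by apply: eq_Rintegral => xi _; rewrite /kerS; ring.
rewrite RintegralZl// bessel_macD_integral//.
have p2 : Num.sqrt (cosh u) ^+ 2 = cosh u by rewrite sqr_sqrtr// ltW.
have -> : Num.sqrt (cosh u) ^+ 4 = cosh u ^+ 2 by rewrite (_ : 4%N = (2 * 2)%N)// exprM p2.
rewrite p2.
have iD : mu.-integrable Ioy (EFin \o (fun v => cos (n%:R * v) * (cosh u / (cosh u ^+ 2 + sinh v ^+ 2)))).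
  have mc : measurable_fun setT (fun v : R => cos (n%:R * v)) by meas.
  have iT := L1_sinh_kernel u mc (fun x => cos_max _).
  by apply: integrableS iT => //; exact: measurable_itv.
rewrite RintegralZl//.
rewrite mulrCA integral_cos_sinh//.
have S0 : 0 < sinh (n%:R / 2 * pi :> R) by rewrite sinh_gt0// mulr_gt0 ?pi_gt0// divr_gt0.
by move: (@pi R) (sinh _) S0 => q S S0; field; rewrite gt_eqF.
Qed.

Lemma Rintegral_opp_pi (f : R -> R) : measurable_fun setT f ->
  \int[mu]_(u in I) f u = \int[mu]_(u in I) f (- u).
Proof.
move=> mf; rewrite !(Rintegral_mkcond mu I).
have mfI : measurable_fun setT (f \_ I) by apply/(measurable_restrictT _ mI); exact: measurable_funTS.
rewrite (Rintegral_opp mfI).2; apply: eq_Rintegral => u _; rewrite !patchE.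
have -> : (- u \in I) = (u \in I) => //.
by apply/idP/idP; rewrite !inE/= !in_itv/= => /andP[h1 h2]; apply/andP; split; lra.
Qed.

Lemma Rintegral_odd_pi (f : R -> R) : measurable_fun setT f -> (forall u, f (- u) = - f u) ->
  bmf f -> \int[mu]_(u in I) f u = 0.
Proof.
move=> mf od bf; have := Rintegral_opp_pi mf.
have -> : \int[mu]_(u in I) f (- u) = - 1 * \int[mu]_(u in I) f u.
  by rewrite -RintegralZl//; [apply: eq_Rintegral => u _; rewrite od mulN1r|exact: bmf_L1].
lra.
Qed.

Lemma Rintegral_even_pi (f : R -> R) : (forall u, f (- u) = f u) ->
  bmf f -> \int[mu]_(u in I) f u = 2 * \int[mu]_(u in `[0, pi]) f u.
Proof.
move=> evf bf; have [mf _] := bf; rewrite (Rintegral_mkcond mu I).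
have mfI : measurable_fun setT (f \_ I) by apply/(measurable_restrictT _ mI); exact: measurable_funTS.
have ev u : (f \_ I) (- u) = (f \_ I) u.
  rewrite !patchE evf; have -> : (- u \in I) = (u \in I) => //.
  by apply/idP/idP; rewrite !inE/= !in_itv/= => /andP[h1 h2]; apply/andP; split; lra.
have i1 : mu.-integrable setT (EFin \o (f \_ I)) by have [h _] := @L1_patch _ _ R mu I f mI; exact: h (bmf_L1 bf).
have i2 : mu.-integrable Icy (EFin \o (f \_ I)) by exact: integrableS i1.
rewrite (Rintegral_even mfI ev i2).2; congr (2 * _).
rewrite -Rintegral_mkcondr; congr (Rintegral _ _ _).
have p0 := @pi_gt0 R.
apply/seteqP; split => u; rewrite /= !in_itv/= ?andbT.
  by move=> [u0 /andP[_ u1]]; rewrite u0.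
by move=> /andP[u0 u1]; split => //; apply/andP; split => //; lra.
Qed.

Lemma measurable_kerS_integral (g : R -> R) : bmf g ->
  measurable_fun setT (fun xi => \int[mu]_(u in I) (g u * kerS xi u)).
Proof.
move=> [mg _]; apply: (@measurable_Rintegral_param _ _ _ _ R mu I (fun xi u => g u * kerS xi u) mI).
by apply: measurable_funM; [exact: (measurableT_comp mg)|exact: measurable_kerS2].
Qed.

Lemma Fubini_kerS (g : R -> R) (n : nat) : bmf g -> (0 < n)%N ->
  mu.-integrable setT (EFin \o (fun xi => \int[mu]_(u in I) (g u * (expR xi * bessel_prod n%:R xi * kerS xi u)))) /\
  \int[mu]_xi \int[mu]_(u in I) (g u * (expR xi * bessel_prod n%:R xi * kerS xi u)) =
  pi / (8 * sinh (n%:R / 2 * pi)) * fsin g n.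
Proof.
move=> bg n0; have [mg [M gM]] := bg.
have mb := measurable_bessel_prod (n%:R : R).
pose w xi : R := bprod_bound n%:R * (expR xi * (1 + expR (- (4^-1 * xi)))) * mac0 1 xi.
have w0 xi : 0 <= w xi by rewrite mulr_ge0 ?mac0_ge0// mulr_ge0 ?bprod_bound_ge0// mulr_ge0 ?addr_ge0 ?expR_ge0.
have mF : measurable_fun (setT `*` I) (fun z : R * R => g z.2 * (expR z.1 * bessel_prod n%:R z.1 * kerS z.1 z.2)).
  apply: measurable_funTS; apply: measurable_funM; first exact: (measurableT_comp mg).
  apply: measurable_funM; last exact: measurable_kerS2.
  by apply: measurable_funM; [meas|exact: (measurableT_comp mb)].
have mFx (xi : R) : setT xi -> measurable_fun I (fun u => g u * (expR xi * bessel_prod n%:R xi * kerS xi u)).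
  by move=> _; have mk := measurable_kerS xi; apply: measurable_funTS; meas.
have i1 := L1Zl (2 * pi * (`|M| * expR pi)) measurableT (@L1_bmac_dom R n%:R 1 ltr01).
have Fb xi u : setT xi -> I u -> `|g u * (expR xi * bessel_prod n%:R xi * kerS xi u)| <= `|M| * expR pi * w xi.
  move=> _ Iu; rewrite normrM -(mulrA `|M|) ler_pM//; first by apply: le_trans (gM u Iu) _; exact: ler_norm.
  rewrite (_ : expR pi * w xi = bprod_bound n%:R * (expR xi * (1 + expR (- (4^-1 * xi)))) * (expR pi * mac0 1 xi)); last by rewrite /w; ring.
  rewrite normrM ler_pM//; last exact: kerS_le.
  rewrite normrM (ger0_norm (expR_ge0 _)) [leRHS]mulrCA ler_wpM2l ?expR_ge0//.
  exact: bessel_prod_le.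
have ih (xi : R) : setT xi -> mu.-integrable I (EFin \o (fun=> `|M| * expR pi * w xi)).
  by move=> _; exact/bmf_L1/bmf_cst.
have hg (xi : R) : setT xi -> \int[mu]_(u in I) (`|M| * expR pi * w xi) <= 2 * pi * (`|M| * expR pi) * bmac_dom n%:R 1 xi.
  move=> _; rewrite Rintegral_cst_pi mulrA ler_wpM2l//; last exact: bmac_le.
  by rewrite !mulr_ge0 ?expR_ge0// pi_ge0.
have [iF _ ->] := @RFubini_dom _ _ _ _ R mu mu setT I
  (fun xi u => g u * (expR xi * bessel_prod n%:R xi * kerS xi u)) (fun xi _ => `|M| * expR pi * w xi) _
  measurableT mI mF mFx ih Fb hg i1.
split; first exact: iF.
rewrite /fsin -RintegralZl//; last exact: (bmf_L1 (bmfM bg (bmf_sin n%:R))).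
apply: Rintegral_eq => u Iu.
have p0 : 0 < Num.sqrt (cosh u) by rewrite sqrtr_gt0; have := cosh_ge1 u; lra.
rewrite RintegralZl//; last first.
  have i2 := L1Zl (sinh u) measurableT (int_space1_sin n%:R p0).1.
  have E : (fun xi => expR xi * bessel_prod n%:R xi * kerS xi u) =
    (fun xi => sinh u * (expR xi * bessel_prod n%:R xi * macD (Num.sqrt (cosh u)) xi)).
    by apply/funext => xi; rewrite /kerS; ring.
  by rewrite E.
rewrite integral_bessel_kerS//.
have S0 : 0 < sinh (n%:R / 2 * pi :> R) by rewrite sinh_gt0// mulr_gt0 ?pi_gt0// divr_gt0// ltr0n.
by move: (@pi R) (sinh _) S0 => q S S0; field; rewrite gt_eqF.
Qed.

(** The substitution [x = e^xi / 2] is performed as [x = e^t] followed by a translation by [ln 2].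
    Its Jacobian [e^xi / 2] with the factors [1/2] and [32] gives 8, which cancels the 8 of the
    index integral. *)
Lemma coefficient_integral (g : R -> R) (n : nat) : bmf g -> (0 < n)%N ->
  \int[mu]_(x in Ioy) (2^-1 * bessel_prod n%:R (ln (2 * x)) * (32 * \int[mu]_(u in I) (g u * kerS (ln (2 * x)) u))) =
  pi / sinh (n%:R / 2 * pi) * fsin g n.
Proof.
move=> bg n0.
have lnE (t : R) : ln (2 * expR t) = t + ln 2.
  by rewrite lnM ?posrE ?expR_gt0// expRK addrC.
have eE (t : R) : expR (t + - ln 2) = expR t / 2 by rewrite expRD expRN lnK ?posrE.
have E8 : 8 * (pi / (8 * sinh (n%:R / 2 * pi)) * fsin g n) = pi / sinh (n%:R / 2 * pi) * fsin g n.
  have S0 : 0 < sinh (n%:R / 2 * pi :> R) by rewrite sinh_gt0// mulr_gt0 ?pi_gt0// divr_gt0// ltr0n.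
  by move: (@pi R) (sinh _) S0 => q S S0; field; rewrite gt_eqF.
have pw (t : R) : 2^-1 * bessel_prod n%:R t * (32 * \int[mu]_(u in I) (g u * kerS t u)) * (expR t / 2) =
    8 * \int[mu]_(u in I) (g u * (expR t * bessel_prod n%:R t * kerS t u)).
  have -> : \int[mu]_(u in I) (g u * (expR t * bessel_prod n%:R t * kerS t u)) =
     (expR t * bessel_prod n%:R t) * \int[mu]_(u in I) (g u * kerS t u).
    rewrite -RintegralZl//; last exact: (bmf_L1 (bmfM bg (bmf_kerS t))).
    by apply: eq_Rintegral => u _; ring.
  by field.
have [iF eF] := Fubini_kerS bg n0.
have := @RintegralZl _ _ R mu setT _ 8 measurableT iF; rewrite eF => eF8.
pose Phi xi := 2^-1 * bessel_prod n%:R xi * (32 * \int[mu]_(u in I) (g u * kerS xi u)).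
have mb := measurable_bessel_prod (n%:R : R).
have mk := measurable_kerS_integral bg.
have mPhi : measurable_fun setT Phi by rewrite /Phi; meas.
have ml : measurable_fun setT (fun x : R => ln (2 * x)) by meas.
have [_ e1] := Rintegral_expR (measurableT_comp mPhi ml).
have E1 : (fun t => (Phi \o (fun x : R => ln (2 * x))) (expR t) * expR t) = (fun t => Phi (t + ln 2) * expR t).
  by apply/funext => t; exact: (congr1 (fun y => Phi y * expR t) (lnE t)).
apply: (etrans e1); rewrite E1.
have mPs : measurable_fun setT (fun t : R => Phi (t + ln 2)).
  have h : measurable_fun setT (fun t : R => t + ln 2) by meas.
  exact: (measurableT_comp mPhi h).
have mh : measurable_fun setT (fun t : R => Phi (t + ln 2) * expR t) by meas.
apply: (etrans (Rintegral_shift (- ln 2) mh).2).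
apply: (etrans _ E8); apply: (etrans _ eF8); apply: eq_Rintegral => t _.
by apply: (etrans _ (pw t)); rewrite (subrK (ln 2) t) eE.
Qed.

Lemma bmf_fourier_sum (g : R -> R) (N : nat) : bmf g -> bmf (fourier_sum g N).
Proof.
move=> bg; apply: bmfZ; elim: N => [|N IH].
  have -> : (fun u : R => 2^-1 * fcos g 0 + \sum_(1 <= k < 1) (fcos g k * cos (k%:R * u) + fsin g k * sin (k%:R * u))) =
    (fun=> 2^-1 * fcos g 0); last exact: bmf_cst.
  by apply/funext => u; rewrite big_geq// addr0.
have -> : (fun u : R => 2^-1 * fcos g 0 + \sum_(1 <= k < N.+2) (fcos g k * cos (k%:R * u) + fsin g k * sin (k%:R * u))) =
  (fun u => (2^-1 * fcos g 0 + \sum_(1 <= k < N.+1) (fcos g k * cos (k%:R * u) + fsin g k * sin (k%:R * u))) +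
   (fcos g N.+1 * cos (N.+1%:R * u) + fsin g N.+1 * sin (N.+1%:R * u))).
  by apply/funext => u; rewrite big_nat_recr//= addrA.
by apply: bmfD => //; apply: bmfD; apply: bmfZ; [exact: bmf_cos|exact: bmf_sin].
Qed.

(** Against the odd kernel the cosine terms vanish, and each sine term is twice its half over
    [[0, pi]], whence [2 / pi]. *)
Lemma integral_fourier_sum_kerS (g : R -> R) (xi : R) (N : nat) : bmf g ->
  \int[mu]_(u in I) (fourier_sum g N u * kerS xi u) =
  \sum_(1 <= k < N.+1) fsin g k * (2 / pi * \int[mu]_(u in `[0, pi]) (kerS xi u * sin (k%:R * u))).
Proof.
move=> bg; have bk := bmf_kerS xi; have [mk _] := bk.
have bck k := bmfM (bmf_cos k%:R) bk; have bsk k := bmfM (bmf_sin k%:R) bk.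
have c0 k : \int[mu]_(u in I) (cos (k%:R * u) * kerS xi u) = 0.
  apply: Rintegral_odd_pi; [exact: (bck k).1| |exact: bck].
  by move=> u; rewrite kerSN (mulrN k%:R) cosN mulrN.
have s2 k : \int[mu]_(u in I) (sin (k%:R * u) * kerS xi u) = 2 * \int[mu]_(u in `[0, pi]) (kerS xi u * sin (k%:R * u)).
  rewrite Rintegral_even_pi; [|by move=> u; rewrite kerSN (mulrN k%:R) sinN mulrNN|exact: bsk].
  by congr (_ * _); apply: eq_Rintegral => u _; rewrite mulrC.
have p0 := @pi_gt0 R.
elim: N => [|N IH].
  rewrite big_geq//.
  transitivity (\int[mu]_(u in I) (pi^-1 * (2^-1 * fcos g 0) * (cos (0%:R * u) * kerS xi u))).
    by apply: eq_Rintegral => u _; rewrite /fourier_sum big_geq// addr0 mul0r cos0 mul1r.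
  by rewrite RintegralZl ?c0 ?mulr0//; exact: (bmf_L1 (bck 0%N)).
rewrite big_nat_recr//= -IH.
have b1 := bmf_L1 (bmfM (bmf_fourier_sum N bg) bk).
have b2 := bmf_L1 (bmfZ (pi^-1 * fcos g N.+1) (bck N.+1)).
have b3 := bmf_L1 (bmfZ (pi^-1 * fsin g N.+1) (bsk N.+1)).
transitivity (\int[mu]_(u in I) (fourier_sum g N u * kerS xi u + (pi^-1 * fcos g N.+1 * (cos (N.+1%:R * u) * kerS xi u)
    + pi^-1 * fsin g N.+1 * (sin (N.+1%:R * u) * kerS xi u)))).
  by apply: eq_Rintegral => u _; rewrite /fourier_sum big_nat_recr//=; ring.
rewrite RintegralD//; last exact: L1D.
rewrite RintegralD// RintegralZl//; last exact: (bmf_L1 (bck _)).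
rewrite RintegralZl//; last exact: (bmf_L1 (bsk _)).
by rewrite c0 s2; ring.
Qed.

(** Dominated convergence in [u]: the Fourier sums are bounded by [8 C + M] uniformly in [N]. *)
Lemma cvg_kernel_series (g : R -> R) (C xi : R) : 0 <= C ->
  (forall u v, `|g u - g v| <= C * `|u - v|) -> g (- pi) = g pi ->
  (fun N => \sum_(1 <= k < N.+1) fsin g k * (2 / pi * \int[mu]_(u in `[0, pi]) (kerS xi u * sin (k%:R * u)))) @ \oo -->
  \int[mu]_(u in I) (g u * kerS xi u).
Proof.
move=> C0 gL gpi; have bg := lipschitz_bmf C0 gL; have bk := bmf_kerS xi.
have [mg [M gM]] := bg; have [mk _] := bk.
have mf N : measurable_fun I (fun u => fourier_sum g N u * kerS xi u).
  by have [m _] := bmfM (bmf_fourier_sum N bg) bk; exact: measurable_funTS.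
have bd := bmf_L1 (bmf_cst ((8 * C + M) * (expR pi * mac0 1 xi))).
have cv u : I u -> (fun N => fourier_sum g N u * kerS xi u) @ \oo --> g u * kerS xi u.
  by move=> Iu; apply: cvgMl; exact: (cvg_fourier_sum C0).
have hb N u : I u -> `|fourier_sum g N u * kerS xi u| <= (8 * C + M) * (expR pi * mac0 1 xi).
  move=> Iu; rewrite normrM ler_pM//; last exact: kerS_le.
  rewrite -[fourier_sum g N u](subrK (g u)); apply: le_trans (ler_normD _ _) _.
  by rewrite lerD//; [exact: fourier_sum_bound|exact: gM].
have [_ H] := @Rdominated_cvg _ _ R mu I _ _ _ mI mf cv bd hb.
by under eq_fun do rewrite -integral_fourier_sum_kerS//.
Qed.

End kernel.

Local Open Scope complex_scope.

(** * Bessel functions of complex argument *)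

Section complex_tools.
Context (R : realType).
Local Notation mu := (@lebesgue_measure R).
Local Notation Icy := (`[0 : R, +oo[%classic : set (measurableTypeR R)).
Local Notation Ioy := (`]0 : R, +oo[%classic : set (measurableTypeR R)).

Lemma natC (n : nat) : n%:R = (n%:R : R)%:C :> R[i].
Proof. by rewrite rmorph_nat. Qed.

Lemma cexpE (a b : R) : cexp (a +i* b) = (expR a * cos b) +i* (expR a * sin b).
Proof. by rewrite /cexp /=; simpc. Qed.

Lemma cexp_real (a : R) : cexp a%:C = (expR a)%:C.
Proof. by rewrite cexpE cos0 sin0 mulr1 mulr0. Qed.

Lemma ccosh_imag (s : R) : ccosh (0 +i* s) = (cos s)%:C.
Proof.
rewrite /ccosh (_ : - (0 +i* s) = (0 +i* (- s))); last by simpc.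
rewrite !cexpE expR0 cosN sinN !mul1r (natC 2); apply: (canLR (mulfK _)).
  by rewrite -natC pnatr_eq0.
by simpc; rewrite -mulr2n mulr_natr.
Qed.

Lemma mul_natI (n : nat) (t : R) : (n%:R * 'i) * t%:C = 0 +i* (n%:R * t) :> R[i].
Proof. by rewrite natC; simpc. Qed.

Lemma besselK_imag (n : nat) (y : R) :
  besselK (n%:R * 'i) y%:C = (\int[mu]_(t in Icy) (expR (- (y * cosh t)) * cos (n%:R * t)))%:C.
Proof.
have E (t : R) : cexp (- y%:C * (cosh t)%:C) * ccosh (n%:R * 'i * t%:C) = (expR (- (y * cosh t)) * cos (n%:R * t))%:C.
  rewrite mul_natI ccosh_imag (_ : - y%:C * (cosh t)%:C = (- (y * cosh t))%:C); last by rewrite mulNr -rmorphM rmorphN.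
  by rewrite cexp_real -rmorphM.
rewrite /besselK /cintegral; congr (_ +i* _).
  by apply: eq_Rintegral => t _; rewrite E.
rewrite (_ : (fun t : R => _) = (fun=> 0)); last by apply/funext => t; rewrite E.
by rewrite /Rintegral integral0.
Qed.

Lemma expR_half_ln (y : R) : 0 < y -> expR (ln y / 2) = Num.sqrt y.
Proof.
move=> y0; rewrite -[in RHS](lnK y0) -[in RHS](_ : ln y / 2 + ln y / 2 = ln y); last by field.
by rewrite expRD -expr2 sqrtr_sqr ger0_norm ?expR_ge0.
Qed.

Lemma macX_cosh (xi t : R) : macX xi t = 2 * expR (xi / 2) * cosh t.
Proof. by rewrite /macX /cosh expRD expRD; field. Qed.

Lemma sin_piquarter : sin (pi / 4) = cos (pi / 4) :> R.
Proof.
have p0 := @pi_gt0 R.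
have c0 : 0 < cos (pi / 4 : R) by apply: cos_gt0_pihalf; apply/andP; lra.
have := @tan_piquarter R; rewrite /tan => /(congr1 (fun y => y * cos (pi / 4))).
by rewrite divfK ?mul1r// gt_eqF.
Qed.

Lemma cos_piquarter : 2 * cos (pi / 4) = Num.sqrt 2 :> R.
Proof.
have p0 := @pi_gt0 R.
have c0 : 0 < cos (pi / 4 : R) by apply: cos_gt0_pihalf; apply/andP; lra.
have := cos2Dsin2 (pi / 4 : R); rewrite sin_piquarter => h.
rewrite [in RHS](_ : 2 = (2 * cos (pi / 4)) ^+ 2); last by rewrite exprMn; lra.
by rewrite sqrtr_sqr ger0_norm// mulr_ge0// ltW.
Qed.

(** The argument equals [(1 + i) p * 2 sqrt(2 x)] with [p = sqrt (cosh u)], because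
    [e^(i pi/4) = (1 + i) / sqrt 2]; and [2 sqrt(2 x) = 2 e^(xi/2)] at [xi = ln (2 x)]. *)
Lemma besselK0_diag (x u : R) : 0 < x ->
  complex.Im (besselK 0 (4 * cexp ((pi / 4)%:C * 'i) * (Num.sqrt (cosh u) * Num.sqrt x)%:C)) =
  - macD (Num.sqrt (cosh u)) (ln (2 * x)).
Proof.
move=> x0; set p := Num.sqrt (cosh u).
have p0 : 0 < p by rewrite sqrtr_gt0; have := cosh_ge1 u; lra.
have x2 : 0 < 2 * x by rewrite mulr_gt0.
rewrite (_ : 4 * cexp ((pi / 4)%:C * 'i) * (p * Num.sqrt x)%:C =
   (2 * Num.sqrt 2 * (p * Num.sqrt x)) +i* (2 * Num.sqrt 2 * (p * Num.sqrt x))); last first.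
  have -> : (pi / 4)%:C * 'i = 0 +i* (pi / 4) :> R[i] by simpc.
  rewrite cexpE expR0 !mul1r sin_piquarter (natC 4) -cos_piquarter; simpc.
  by congr (_ +i* _); ring.
have E (t : R) : complex.Im (cexp (- ((2 * Num.sqrt 2 * (p * Num.sqrt x)) +i* (2 * Num.sqrt 2 * (p * Num.sqrt x))) * (cosh t)%:C) * ccosh (0 * t%:C)) =
    - 1 * (expR (- (p * macX (ln (2 * x)) t)) * sin (p * macX (ln (2 * x)) t)).
  have -> : ccosh (0 * t%:C) = 1 :> R[i] by rewrite mul0r ccosh_imag cos0.
  have -> : p * macX (ln (2 * x)) t = 2 * Num.sqrt 2 * (p * Num.sqrt x) * cosh t.
    by rewrite macX_cosh expR_half_ln// sqrtrM//; ring.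
  rewrite mulr1; set Y := 2 * Num.sqrt 2 * (p * Num.sqrt x).
  have -> : - (Y +i* Y) * (cosh t)%:C = (- (Y * cosh t)) +i* (- (Y * cosh t)) by simpc.
  by rewrite cexpE /= sinN; ring.
transitivity (\int[mu]_(t in Icy) (- 1 * (expR (- (p * macX (ln (2 * x)) t)) * sin (p * macX (ln (2 * x)) t)))).
  by apply: eq_Rintegral => t _; exact: E.
rewrite RintegralZl ?mulN1r//; exact: L1_expsin_macX.
Qed.

(** The real part of the argument is [k + 1], inside the half-plane of Euler's integral; the
    substitution is [t = e^s]. *)
Lemma cgamma_gamma (n k : nat) : cgamma (n%:R * 'i + k%:R + 1) = gammaC n%:R k +i* gammaS n%:R k :> R[i].
Proof.
have E (t : R) : cpow t (n%:R * 'i + k%:R + 1 - 1) * (expR (- t))%:C =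
   (expR (k%:R * ln t) * cos (n%:R * ln t) * expR (- t)) +i* (expR (k%:R * ln t) * sin (n%:R * ln t) * expR (- t)).
  rewrite addrK /cpow (_ : (n%:R * 'i + k%:R) * (ln t)%:C = (k%:R * ln t) +i* (n%:R * ln t)); last first.
    by rewrite (natC n) (natC k); simpc.
  by rewrite cexpE; simpc.
have m1 : measurable_fun setT (fun t : R => expR (k%:R * ln t) * cos (n%:R * ln t) * expR (- t)) by meas.
have m2 : measurable_fun setT (fun t : R => expR (k%:R * ln t) * sin (n%:R * ln t) * expR (- t)) by meas.
rewrite /cgamma /cintegral; congr (_ +i* _).
  under eq_Rintegral do rewrite E.
  rewrite (Rintegral_expR m1).2; apply: eq_Rintegral => t _.
  rewrite expRK /gamma_weight -natr1 mulrDl mul1r expRD expRD; ring.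
under eq_Rintegral do rewrite E.
rewrite (Rintegral_expR m2).2; apply: eq_Rintegral => t _.
rewrite expRK /gamma_weight -natr1 mulrDl mul1r expRD expRD; ring.
Qed.

Lemma cvg_complex (u v : nat -> R) (a b : R) : u @ \oo --> a -> v @ \oo --> b ->
  (fun n => (u n +i* v n : R[i]^o)) @ \oo --> (a +i* b : R[i]^o).
Proof.
move=> /cvgrPdist_lt ua /cvgrPdist_lt vb; apply/cvgrPdist_lt => e e0.
have [r r0 ->] : exists2 r : R, 0 < r & e = r%:C.
  by exists (complex.Re e); move: e0; case: e => x y; rewrite ltcE/= => /andP[/eqP E //]; rewrite E.
have r2 : 0 < r / 2 by rewrite divr_gt0.
near=> n.
have h1 : `|a - u n| < r / 2 by near: n; exact: ua.
have h2 : `|b - v n| < r / 2 by near: n; exact: vb.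
rewrite (_ : (a +i* b) - _ = (a - u n) +i* (b - v n)); last by simpc.
rewrite normc_def ltcR.
apply: (@le_lt_trans _ _ (`|a - u n| + `|b - v n|)); last by rewrite (splitr r) ltrD.
rewrite -[leRHS]ger0_norm ?addr_ge0// -sqrtr_sqr ler_wsqrtr//.
rewrite /= [leRHS]sqrrD !real_normK ?num_real// lerD2r lerDl mulrn_wge0// mulr_ge0//.
Unshelve. all: by end_near. Qed.

Lemma series_complex (c d : nat -> R) (N : nat) :
  series (fun k => c k +i* d k : R[i]^o) N = series c N +i* series d N.
Proof.
elim: N => [|N IH]; first by rewrite /series/= !big_geq.
by rewrite !seriesSr IH; simpc.
Qed.

Lemma invcE (a b : R) : (a +i* b)^-1 = (a / (a ^+ 2 + b ^+ 2)) +i* (- b / (a ^+ 2 + b ^+ 2)).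
Proof. by rewrite mulNr. Qed.

Lemma besselJ_phase (n : nat) (x : R) : 0 < x ->
  complex.Re (besselJ (n%:R * 'i) (2 * Num.sqrt (2 * x))) = bessel_phase n%:R (ln (2 * x)) (ln (2 * x) / 2).
Proof.
move=> x0; have x2 : 0 < 2 * x by rewrite mulr_gt0.
set xi := ln (2 * x); pose a := n%:R * (xi / 2).
pose P k := bessel_coeff (rgamma_re n%:R) xi k; pose Q k := bessel_coeff (rgamma_im n%:R) xi k.
have cP := @bessel_cvg R _ _ xi (rgamma_bound_ge0 n%:R) (rgamma_re_le n%:R).
have cQ := @bessel_cvg R _ _ xi (rgamma_bound_ge0 n%:R) (rgamma_im_le n%:R).
have lnE : ln (2 * Num.sqrt (2 * x) / 2) = xi / 2.
  by rewrite mulrAC mulfV// mul1r -expR_half_ln// expRK.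
have E k : (- 1) ^+ k * cpow (2 * Num.sqrt (2 * x) / 2) (n%:R * 'i + (2 * k)%:R) / (k`!%:R * cgamma (n%:R * 'i + k%:R + 1)) =
    (P k * cos a - Q k * sin a) +i* (P k * sin a + Q k * cos a).
  rewrite cgamma_gamma /cpow lnE.
  rewrite (_ : (n%:R * 'i + (2 * k)%:R) * (xi / 2)%:C = (k%:R * xi) +i* a); last first.
    by rewrite (natC n) (natC (2 * k)) /a; simpc; rewrite natrM; congr (_ +i* _); field.
  rewrite cexpE (natC k`!) invfM.
  have -> : (gammaC n%:R k +i* gammaS n%:R k)^-1 = rgamma_re n%:R k +i* rgamma_im n%:R k :> R[i] by exact: invcE.
  rewrite (_ : (- 1) ^+ k = ((- 1) ^+ k)%:C); last by rewrite rmorphXn rmorphN rmorph1.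
  rewrite -fmorphV; simpc; rewrite /P /Q /bessel_coeff; congr (_ +i* _); ring.
have cre : series (fun k => P k * cos a - Q k * sin a) @ \oo --> bessel_phase n%:R xi (xi / 2).
  have -> : series (fun k => P k * cos a - Q k * sin a) = (fun N => series P N * cos a - series Q N * sin a).
    by apply/funext => N; rewrite /series/= !mulr_suml sumrB.
  by apply: cvgB; apply: cvgMl.
have cim : series (fun k => P k * sin a + Q k * cos a) @ \oo --> besselP n%:R xi * sin a + besselQ n%:R xi * cos a.
  have -> : series (fun k => P k * sin a + Q k * cos a) = (fun N => series P N * sin a + series Q N * cos a).
    by apply/funext => N; rewrite /series/= !mulr_suml big_split.
  by apply: cvgD; apply: cvgMl.
rewrite /besselJ; under eq_fun do rewrite E.
rewrite (_ : series _ = (fun N => series (fun k => P k * cos a - Q k * sin a) N +i* series (fun k => P k * sin a + Q k * cos a) N : R[i]^o)); last first.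
  by apply/funext => N; exact: series_complex.
by rewrite (cvg_lim (@norm_hausdorff _ _) (cvg_complex cre cim)).
Qed.

Lemma besselJK (n : nat) (x : R) : 0 < x ->
  (complex.Re (besselJ (n%:R * 'i) (2 * Num.sqrt (2 * x))))%:C * besselK (n%:R * 'i) (2 * Num.sqrt (2 * x))%:C =
  (2^-1 * bessel_prod n%:R (ln (2 * x)))%:C.
Proof.
move=> x0; have x2 : 0 < 2 * x by rewrite mulr_gt0.
rewrite bessel_prod_phase besselJ_phase// besselK_imag -rmorphM.
congr ((_ * _)%:C); apply: eq_Rintegral => t _.
by rewrite macX_cosh expR_half_ln.
Qed.

End complex_tools.

(** * Real and imaginary parts, and the theorem *)

Section parts.
Context (R : realType).
Local Notation mu := (@lebesgue_measure R).
Local Notation I := (`[- pi, pi]%classic : set (measurableTypeR R)).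

Lemma clamp_lipschitz_on (h : R -> R) (C : R) : 0 <= C ->
  (forall u v, u \in `[- pi, pi] -> v \in `[- pi, pi] -> `|h u - h v| <= C * `|u - v|) ->
  forall u v, `|h (clamp u) - h (clamp v)| <= C * `|u - v|.
Proof.
move=> C0 hL u v; apply: le_trans (hL _ _ (clamp_itv u) (clamp_itv v)) _.
by rewrite ler_wpM2l// clamp_lipschitz.
Qed.

Lemma norm_ReIm_le (z : R[i]) (r : R) : `|z| <= r%:C -> `|complex.Re z| <= r /\ `|complex.Im z| <= r.
Proof.
rewrite normc_def lecR => h.
by split; apply: le_trans h; rewrite -sqrtr_sqr ler_wsqrtr// ?lerDl ?lerDr ?sqr_ge0.
Qed.

Lemma sinh_double (y : R) : sinh (2 * y) = 2 * sinh y * cosh y.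
Proof. by rewrite /sinh /cosh (_ : 2 * y = y + y) ?opprD ?expRD; [field|ring]. Qed.

Lemma mulrzC (r a b : R) : r%:C * (a +i* b) = (r * a) +i* (r * b).
Proof. by simpc. Qed.

Lemma mulzrC (z : R[i]) (r : R) : z * r%:C = (complex.Re z * r) +i* (complex.Im z * r).
Proof. by case: z => a b; simpc. Qed.

Lemma sum_complex (c d : nat -> R) (N : nat) :
  \sum_(1 <= k < N.+1) (c k +i* d k) = (\sum_(1 <= k < N.+1) c k) +i* (\sum_(1 <= k < N.+1) d k).
Proof.
elim: N => [|N IH]; first by rewrite !big_geq.
by rewrite !(big_nat_recr N.+1)//= IH; simpc.
Qed.

End parts.

Theorem theorem4 (R : realType) (psi : R -> R[i])
    (psi_periodic : forall u : R, psi (u + 2 * pi) = psi u)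
    (psi_lipschitz : exists2 C : R, 0 < C &
      forall u v : R, u \in `[- pi, pi] -> v \in `[- pi, pi] ->
        `|psi u - psi v| <= (C * `|u - v|)%:C)
    (f : R -> R[i])
    (f_def : forall x : R, 0 < x ->
      f x = - 32 * cintegral `[- pi, pi] (fun u : R =>
        psi u * (sinh u)%:C *
        (complex.Im (besselK 0 (4 * cexp ((pi / 4)%:C * 'i)
                          * (Num.sqrt (cosh u) * Num.sqrt x)%:C)))%:C))
    (a : nat -> R[i])
    (a_def : forall n : nat,
      a n = ((cosh (pi * n%:R / 2))^-1)%:C *
        cintegral `]0, +oo[ (fun x : R =>
          (complex.Re (besselJ (n%:R * 'i) (2 * Num.sqrt (2 * x))))%:C *
          besselK (n%:R * 'i) (2 * Num.sqrt (2 * x))%:C * f x))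
    (Psi : nat -> R -> R)
    (Psi_def : forall (n : nat) (x : R), 0 < x ->
      Psi n x = \int[lebesgue_measure]_(u in `[0, pi])
        (complex.Im (besselK 0 (4 * cexp ((pi / 4)%:C * 'i)
                          * (Num.sqrt (cosh u) * Num.sqrt x)%:C))
         * sinh u * sin (n%:R * u)))
    (x : R) (x_gt0 : 0 < x) :
  let s : nat -> R[i]^o := fun N : nat =>
    \sum_(1 <= n < N.+1) (sinh (pi * n%:R) * Psi n x)%:C * a n in
  cvgn s /\ f x = (- (32 / pi ^+ 2))%:C * limn s.
Proof.
case: psi_lipschitz => C C_gt0 psiL; have C0 := ltW C_gt0.
(* The real theory is applied to each part of [psi]; clamping makes the parts Lipschitz on the whole
   line without changing them on [[-pi, pi]]. *)
pose gr (u : R) := complex.Re (psi (clamp u)); pose gi (u : R) := complex.Im (psi (clamp u)).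
have p0 := @pi_gt0 R.
have grL : forall u v, `|gr u - gr v| <= C * `|u - v|.
  apply: (@clamp_lipschitz_on R (fun u => complex.Re (psi u))) => // u v Iu Iv.
  have [h _] := norm_ReIm_le (psiL u v Iu Iv); move: h.
  by case: (psi u) (psi v) => [r1 i1] [r2 i2].
have giL : forall u v, `|gi u - gi v| <= C * `|u - v|.
  apply: (@clamp_lipschitz_on R (fun u => complex.Im (psi u))) => // u v Iu Iv.
  have [_ h] := norm_ReIm_le (psiL u v Iu Iv); move: h.
  by case: (psi u) (psi v) => [r1 i1] [r2 i2].
have Ipi : (`[- pi, pi]%classic : set R) pi by rewrite /= in_itv/=; lra.
have INpi : (`[- pi, pi]%classic : set R) (- pi) by rewrite /= in_itv/=; lra.
(* Periodicity enters through this equality of end values, which the Fourier argument on the circle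
   uses. *)
have psipi : psi (- pi) = psi pi by rewrite -psi_periodic; congr psi; ring.
have grpi : gr (- pi) = gr pi by rewrite /gr !clamp_id// psipi.
have gipi : gi (- pi) = gi pi by rewrite /gi !clamp_id// psipi.
pose F (g : R -> R) (y : R) := \int[lebesgue_measure]_(u in `[- pi, pi]) (g u * kerS (ln (2 * y)) u).
have bkS (y : R) := bmf_kerS (ln (2 * y)).
have bgr := lipschitz_bmf C0 grL; have bgi := lipschitz_bmf C0 giL.
have fE (y : R) : 0 < y -> f y = (32 * F gr y) +i* (32 * F gi y).
  move=> y0; rewrite f_def// /cintegral.
  have pw (u : R) : u \in `[- pi, pi] -> psi u * (sinh u)%:C *
      (complex.Im (besselK 0 (4 * cexp ((pi / 4)%:C * 'i) * (Num.sqrt (cosh u) * Num.sqrt y)%:C)))%:C =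
      (- 1 * (gr u * kerS (ln (2 * y)) u)) +i* (- 1 * (gi u * kerS (ln (2 * y)) u)).
    move=> Iu; rewrite besselK0_diag// /gr /gi clamp_id// /kerS.
    by rewrite !mulzrC /=; congr (_ +i* _); ring.
  rewrite (_ : \int[_]_(_ in _) complex.Re _ = - F gr y); last first.
    rewrite /F -[RHS]mulN1r -RintegralZl//; last exact: (bmf_L1 (bmfM bgr (bkS y))).
    by apply: Rintegral_eq => u Iu; rewrite pw.
  rewrite (_ : \int[_]_(_ in _) complex.Im _ = - F gi y); last first.
    rewrite /F -[RHS]mulN1r -RintegralZl//; last exact: (bmf_L1 (bmfM bgi (bkS y))).
    by apply: Rintegral_eq => u Iu; rewrite pw.
  by rewrite (natC _ 32) -rmorphN mulrzC; congr (_ +i* _); ring.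
have aE n : (0 < n)%N -> a n = ((cosh (pi * n%:R / 2))^-1 * (pi / sinh (n%:R / 2 * pi) * fsin gr n)) +i*
    ((cosh (pi * n%:R / 2))^-1 * (pi / sinh (n%:R / 2 * pi) * fsin gi n)).
  move=> n0; rewrite a_def /cintegral.
  have pw (y : R) : 0 < y -> (complex.Re (besselJ (n%:R * 'i) (2 * Num.sqrt (2 * y))))%:C *
          besselK (n%:R * 'i) (2 * Num.sqrt (2 * y))%:C * f y =
     (2^-1 * bessel_prod n%:R (ln (2 * y)) * (32 * F gr y)) +i* (2^-1 * bessel_prod n%:R (ln (2 * y)) * (32 * F gi y)).
    by move=> y0; rewrite besselJK// fE// mulrzC.
  rewrite -(coefficient_integral bgr n0) -(coefficient_integral bgi n0).
  rewrite (_ : \int[_]_(_ in _) complex.Re _ = \int[lebesgue_measure]_(y in `]0, +oo[)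
     (2^-1 * bessel_prod n%:R (ln (2 * y)) * (32 * F gr y))); last first.
    by apply: Rintegral_eq => y; rewrite /= in_itv/= andbT => y0; rewrite pw.
  rewrite (_ : \int[_]_(_ in _) complex.Im _ = \int[lebesgue_measure]_(y in `]0, +oo[)
     (2^-1 * bessel_prod n%:R (ln (2 * y)) * (32 * F gi y))); last first.
    by apply: Rintegral_eq => y; rewrite /= in_itv/= andbT => y0; rewrite pw.
  exact: mulrzC.
pose J n := \int[lebesgue_measure]_(u in `[0, pi]) (kerS (ln (2 * x)) u * sin (n%:R * u)).
have PsiE n : Psi n x = - J n.
  have iJ : lebesgue_measure.-integrable `[0, pi] (EFin \o (fun u => kerS (ln (2 * x)) u * sin (n%:R * u))).
    apply: integrableS (bmf_L1 (bmfM (bkS x) (bmf_sin n%:R))); [exact: measurable_itv..|].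
    by move=> u; rewrite /= !in_itv/= => /andP[u0 u1]; rewrite u1 andbT (le_trans _ u0)// oppr_le0 ltW.
  rewrite Psi_def// /J -[RHS]mulN1r -RintegralZl//.
  by apply: eq_Rintegral => u _; rewrite besselK0_diag// /kerS; ring.
pose t (g : R -> R) n := fsin g n * (2 / pi * J n).
(* Since [sinh (pi n) = 2 sinh (pi n / 2) cosh (pi n / 2)], both hyperbolic denominators in [a n]
   cancel. What is left, [-2 pi] times a sine coefficient times [J n], is [- pi^2] times the term of
   the kernel series. *)
have termE n : (0 < n)%N -> (sinh (pi * n%:R) * Psi n x)%:C * a n = (- pi ^+ 2 * t gr n) +i* (- pi ^+ 2 * t gi n).
  move=> n0; rewrite aE// PsiE.
  have S0 : 0 < sinh (n%:R / 2 * pi : R) by rewrite sinh_gt0// mulr_gt0// divr_gt0// ltr0n.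
  have c0 : 0 < cosh (n%:R / 2 * pi : R) by have := cosh_ge1 (n%:R / 2 * pi : R); lra.
  rewrite (_ : pi * n%:R = 2 * (n%:R / 2 * pi)); last by move: (@pi R) => q; field.
  rewrite sinh_double (_ : 2 * (n%:R / 2 * pi) / 2 = n%:R / 2 * pi); last by move: (@pi R) => q; field.
  rewrite mulrzC /t; move: (@pi R) p0 (sinh _) S0 (cosh _) c0 => q q0 S S0 c c0.
  by congr (_ +i* _); field; rewrite !gt_eqF.
have cr := @cvg_kernel_series R _ C (ln (2 * x)) C0 grL grpi.
have ci := @cvg_kernel_series R _ C (ln (2 * x)) C0 giL gipi.
have sE : (fun N => \sum_(1 <= n < N.+1) (sinh (pi * n%:R) * Psi n x)%:C * a n : R[i]^o) =
    (fun N => (- pi ^+ 2 * \sum_(1 <= n < N.+1) t gr n) +i* (- pi ^+ 2 * \sum_(1 <= n < N.+1) t gi n) : R[i]^o).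
  apply/funext => N; rewrite !mulr_sumr -sum_complex.
  by apply: eq_big_nat => n /andP[n0 _]; exact: termE.
have cr2 : (fun N => - pi ^+ 2 * \sum_(1 <= n < N.+1) t gr n) @ \oo --> - pi ^+ 2 * F gr x by apply: cvgMr; exact: cr.
have ci2 : (fun N => - pi ^+ 2 * \sum_(1 <= n < N.+1) t gi n) @ \oo --> - pi ^+ 2 * F gi x by apply: cvgMr; exact: ci.
have cs := cvg_complex cr2 ci2.
rewrite /= sE; split; first exact: cvgP cs.
rewrite (cvg_lim (@norm_hausdorff _ _) cs) fE// mulrzC.
by congr (_ +i* _); move: (F gr x) (F gi x) => y1 y2; move: (@pi R) p0 => q q0; field; rewrite gt_eqF.
Qed.
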